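(* Fix a prime $p\ge 5$ and let $S\subset\mathbb{P}^3$ be an octanomial cubic surface defined over $\mathbb{Q}_p$, i.e. the zero set of $$a\,xyz+b\,xyw+c\,xzw+d\,yzw+e\,x^2y+f\,xy^2+g\,z^2w+h\,zw^2$$ with $a,b,c,d,e,f,g,h\in\mathbb{Q}_p$. If $S$ is tropically smooth, then the $27$ lines on $S$ have pairwise distinct tropicalizations in $\mathbb{TP}^3$. In that case, it follows that all $27$ lines on $S$ are defined over $\mathbb{Q}_p$.
   Context: Let $\mathcal{A}\subset\mathbb{Z}^4$ be the set of the eight exponent vectors of the monomials $xyz,\,xyw,\,xzw,\,yzw,\,x^2y,\,xy^2,\,z^2w,\,zw^2$, that is, $(1,1,1,0),(1,1,0,1),(1,0,1,1),(0,1,1,1),(2,1,0,0),(1,2,0,0),(0,0,2,1),(0,0,1,2)$. Its convex hull ${\rm conv}(\mathcal{A})$ is a $3$-dimensional lattice polytope whose vertex set is $\mathcal{A}$. Tropically smooth: the regular polyhedral subdivision of ${\rm conv}(\mathcal{A})$ induced by the $p$-adic valuations of the coefficients (lift the point of $\mathcal{A}$ belonging to each monomial to height the valuation of its coefficient, and project the lower faces of the convex hull) is a unimodular triangulation, i.e. all its maximal simplices are lattice tetrahedra of normalized volume $1$ with vertices in $\mathcal{A}$. In particular all coefficients are nonzero. The $27$ lines on $S$ are considered over the algebraic closure $\overline{\mathbb{Q}}_p$, with the unique extension ${\rm val}$ of the $p$-adic valuation. Tropical projective space is $\mathbb{TP}^3=\bigl((\mathbb{R}\cup\{\infty\})^4\setminus\{(\infty,\infty,\infty,\infty)\}\bigr)/\mathbb{R}(1,1,1,1)$.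 The tropicalization of a line $L\subset\mathbb{P}^3$ is the closure in $\mathbb{TP}^3$ of the image of $L(\overline{\mathbb{Q}}_p)$ under the coordinatewise valuation $(x:y:z:w)\mapsto({\rm val}(x),{\rm val}(y),{\rm val}(z),{\rm val}(w))$; lines contained in coordinate planes have tropicalizations in the boundary of $\mathbb{TP}^3$. *)

(* Defs.v *)
From HB Require Import structures.
From mathcomp Require Import all_boot all_order all_algebra.
From mathcomp Require Import all_classical all_reals all_analysis.

Set Implicit Arguments.
Unset Strict Implicit.
Unset Printing Implicit Defensive.

Import Order.TTheory GRing.Theory Num.Theory.
Local Open Scope classical_set_scope.
Local Open Scope ring_scope.

(* Additive valuations with values in R u {oo}. *)
Definition valuation (R : realType) (F : fieldType) (v : F -> \bar R) : Prop :=
  [/\ forall x, v x != -oo%E,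
      forall x, (v x == +oo%E) = (x == 0),
      forall x y, v (x * y) = (v x + v y)%E
    & forall x y, (Order.min (v x) (v y) <= v (x + y)%R)%E].

Definition padic_val_rat (p : nat) (q : rat) : int :=
  (logn p `|numq q|%N)%:Z - (logn p `|denq q|%N)%:Z.

(* (K, v) is Q_p with its valuation normalized by v p = 1, characterized (up to
   a unique isomorphism) as the completion of the rationals for the p-adic
   valuation: v extends it, the image of rat is dense, and every Cauchy
   sequence of K converges. *)
Definition is_padic_field (p : nat) (R : realType) (K : fieldType)
    (v : K -> \bar R) : Prop :=
  [/\ valuation v,
      forall q : rat, q != 0 -> v (ratr q) = ((padic_val_rat p q)%:~R)%:E,
      forall (x : K) (M : R), exists q : rat, (M%:E <= v (x - ratr q)%R)%E
    & forall u : nat -> K,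
        (forall M : R, exists N : nat, forall m n : nat,
          (N <= m)%N -> (N <= n)%N -> (M%:E <= v (u m - u n)%R)%E) ->
        exists l : K, forall M : R, exists N : nat, forall n : nat,
          (N <= n)%N -> (M%:E <= v (u n - l)%R)%E].

(* C, with the embedding iota, is an algebraic closure of K, and w is a
   valuation on C extending v. *)
Definition is_valued_algebraic_closure (R : realType) (K : fieldType)
    (v : K -> \bar R) (C : closedFieldType) (iota : {rmorphism K -> C})
    (w : C -> \bar R) : Prop :=
  [/\ forall z : C, algebraicOver iota z,
      valuation w
    & forall x : K, w (iota x) = v x].

(* Exponents, in the variables x, y, z, w, of the monomials
   xyz, xyw, xzw, yzw, x^2y, xy^2, z^2w, zw^2. *)
Definition exponents : seq (seq nat) :=
  [:: [:: 1; 1; 1; 0]; [:: 1; 1; 0; 1]; [:: 1; 0; 1; 1]; [:: 0; 1; 1; 1];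
      [:: 2; 1; 0; 0]; [:: 1; 2; 0; 0]; [:: 0; 0; 2; 1]; [:: 0; 0; 1; 2]]%N.

Definition expo (i : 'I_8) (j : 'I_4) : nat := nth 0%N (nth [::] exponents i) j.

Definition octanomial (F : fieldType) (c : 8.-tuple F) (u : 'rV[F]_4) : F :=
  \sum_(i < 8) tnth c i * \prod_(j < 4) u 0 j ^+ expo i j.

Lemma octanomialE (F : fieldType) (a b c d e f g h : F) (u : 'rV[F]_4) :
  let x := u 0 (inord 0) in let y := u 0 (inord 1) in
  let z := u 0 (inord 2) in let w := u 0 (inord 3) in
  octanomial [tuple a; b; c; d; e; f; g; h] u =
    a * x * y * z + b * x * y * w + c * x * z * w + d * y * z * w
    + e * x ^+ 2 * y + f * x * y ^+ 2 + g * z ^+ 2 * w + h * z * w ^+ 2.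
Proof.
have uE (j : 'I_4) (k : nat) : val j = k -> u 0 j = u 0 (inord k).
  by move=> <-; rewrite inord_val.
rewrite /octanomial !big_ord_recl !big_ord0 /expo /= !(tnth_nth 0) /=.
rewrite (uE ord0 0%N)// (uE (lift ord0 ord0) 1%N)//.
rewrite (uE (lift ord0 (lift ord0 ord0)) 2%N)//.
rewrite (uE (lift ord0 (lift ord0 (lift ord0 ord0))) 3%N)//.
by rewrite !expr0 !expr1 !(mul1r, mulr1, addr0) !mulrA !addrA.
Qed.

(* The points of the lower face of the convex hull of the lifted points
   (expo i, ht i) selected by the functional (phi, 1). *)
Definition lower_face (R : realType) (ht : 'I_8 -> \bar R) (phi : 'rV[R]_4) :
    {set 'I_8} :=
  let lift_val i := (ht i + (\sum_(j < 4) phi 0 j * (expo i j)%:R)%:E)%E in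
  [set i | [forall k, (lift_val i <= lift_val k)%E]].

(* Cells of the regular subdivision are represented by the indices of the points
   they contain; each of the eight points is a vertex of their convex hull, so
   that a cell and its convex hull determine each other. *)
Definition is_cell (R : realType) (ht : 'I_8 -> \bar R) (s : {set 'I_8}) : Prop :=
  exists phi : 'rV[R]_4, s = lower_face ht phi.

Definition is_maximal_cell (R : realType) (ht : 'I_8 -> \bar R)
    (s : {set 'I_8}) : Prop :=
  is_cell ht s /\ forall t, is_cell ht t -> s \subset t -> t = s.

(* Forgetting the last coordinate identifies the lattice points of the
   hyperplane x + y + z + w = 3 with Z^3. *)
Definition normalized_volume (t : 'I_4 -> 'I_8) : nat :=
  absz (\det (\matrix_(k < 3, j < 3)
      ((expo (t (lift ord0 k)) (lift ord_max j))%:Z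
       - (expo (t ord0) (lift ord_max j))%:Z))).

Definition tropically_smooth (R : realType) (K : fieldType) (v : K -> \bar R)
    (c : 8.-tuple K) : Prop :=
  (forall i, tnth c i != 0) /\
  (forall s, is_maximal_cell (fun i => v (tnth c i)) s ->
     exists t : 'I_4 -> 'I_8,
       s = [set t k | k : 'I_4] /\ normalized_volume t = 1%N).

(* A line of P^3 is a 2-dimensional linear subspace of the space of row
   vectors. *)
Definition is_line_on (K : fieldType) (C : closedFieldType)
    (iota : {rmorphism K -> C}) (c : 8.-tuple K) (L : {vspace 'rV[C]_4}) : Prop :=
  \dim L = 2%N /\
  forall u, u \in L -> octanomial (map_tuple iota c) u = 0.

Definition is_defined_over (K : fieldType) (C : closedFieldType)
    (iota : {rmorphism K -> C}) (L : {vspace 'rV[C]_4}) : Prop :=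
  exists u1 u2 : 'rV[K]_4, L = <<[:: map_mx iota u1; map_mx iota u2]>>%VS.

Section TropicalProjectiveSpace.
Variable R : realType.

(* (R u {oo})^4 minus {(oo, oo, oo, oo)}, with the topology induced by the
   product topology on the row vectors of extended reals. *)
Definition tcone_set : set 'rV[\bar R]_4 :=
  [set x | (forall j, x ord0 j != -oo%E) /\ (exists j, x ord0 j != +oo%E)].

Definition tcone : Type := set_type tcone_set.
HB.instance Definition _ := Topological.on tcone.

Definition tcone_eq (x y : tcone) : bool :=
  `[< exists r : R, forall j, val y ord0 j = (val x ord0 j + r%:E)%E >].

Lemma tcone_eq_equiv : equiv_class_of tcone_eq.
Proof.
have NN (x : \bar R) (r : R) : (x + r%:E + (- r)%:E = x)%E.
  by case: x => [x||]//=; rewrite -!EFinD addrK.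
split.
- by move=> x; apply/asboolP; exists 0 => j; rewrite adde0.
- have S x y : tcone_eq x y -> tcone_eq y x.
    move=> /asboolP[r rE]; apply/asboolP; exists (- r) => j.
    by rewrite rE NN.
  by move=> x y; apply/idP/idP; exact: S.
- move=> y x z /asboolP[r rE] /asboolP[s sE]; apply/asboolP.
  exists (r + s) => j; rewrite sE rE EFinD.
  by case: (val x ord0 j) => [t||]//=; rewrite -!EFinD addrA.
Qed.

Canonical tcone_equiv : equiv_rel tcone := EquivRelPack tcone_eq_equiv.

Definition TP3 := quotient_topology {eq_quot tcone_equiv}%qT.
HB.instance Definition _ := Topological.on TP3.
HB.instance Definition _ := Quotient.on TP3.

Definition tropicalization (C : fieldType) (w : C -> \bar R)
    (L : {vspace 'rV[C]_4}) : set TP3 :=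
  closure [set t : TP3 | exists u : 'rV[C]_4, exists x : tcone,
    [/\ u \in L, u != 0, val x = map_mx w u & t = (\pi_TP3 x)%qT]].

End TropicalProjectiveSpace.

(* Main.v *)
Require Import Defs.
From HB Require Import structures.
From mathcomp Require Import all_boot all_order all_algebra.
From mathcomp Require Import all_classical all_reals all_analysis.
From mathcomp Require Import ring lra zify.

Set Implicit Arguments.
Unset Strict Implicit.
Unset Printing Implicit Defensive.

Import Order.TTheory GRing.Theory Num.Theory.
Local Open Scope ring_scope.

(** Write the equation as x y A + z w B with A = e x + f y + a z + b w and
    B = c x + d y + g z + h w.  On a line of the surface, x y A and - z w B are
    the same product of three linear forms in two variables.  Either both
    products vanish, which gives nine lines, or each of x, y, A is proportional
    to one of z, w, B ([classification]).  If x = al z and y = be w, the line is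
    a transversal of the lines x = z = 0 and y = w = 0; if x = al z while w is
    proportional to A, the line is the residual line of the plane x = al z,
    which contains x = z = 0 and a transversal.  In both cases (al, be) solves
    the two equations of [line_system].  If the system has three
    solutions for each of the four ways to pair x or y with z or w, there are
    4 * 3 residual lines, and 2 * 3 transversals since exchanging al and be
    identifies the pairings two by two: altogether 9 + 12 + 6 lines.

    Eliminating be leaves a cubic in al ([cubicE]), whose coefficients are
    polynomials in a, ..., h that are homogeneous for the grading by exponent
    vectors.  Tropical smoothness makes every minimum of valuations over a
    graded piece unique, also for multiples of the minimizing monomial
    ([fiber_unique_min]): by linear programming duality the degree lies in the
    cone over a unimodular simplex of the subdivision, and it has exactly one
    expression by natural coordinates there.  The valuations of the coefficients
    of the cubic are then known, and its Newton polygon has three distinct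
    slopes, or one slope of multiplicity two in one of two mirror situations
    ([newton_slopes]).  In the first case the valuations of the three al differ;
    in the second one the two al of equal valuation come with be of different
    valuations ([solved_double]).  Hence the pairs of valuations are pairwise
    distinct.  A root of strictly smallest or largest valuation is a limit of
    quotients of power sums of the roots, so it lies in the complete base field
    ([dominant_root]), and all al, be are rational over it.

    A linear form that vanishes on a line imposes on the tropical line the
    closed condition that its minimum is attained twice
    ([tropical_vanishing]).  So the tropical line determines which forms in two
    coordinates vanish on the line, and this separates the fifteen families of
    lines ([zero_pattern_family]); within a family of three it determines the
    valuations of al and be ([tropicalization_line_of_inj]). *)

(** * Farkas' lemma and linear programming duality *)

Definition dot (R : pzSemiRingType) (J : finType) (x y : J -> R) : R :=
  \sum_j x j * y j.

Lemma dotBr (R : comRingType) (J : finType) (x v w : J -> R) (s t : R) :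
  dot x (fun j => s * v j - t * w j) = s * dot x v - t * dot x w.
Proof.
by rewrite /dot !mulr_sumr -sumrB; apply: eq_bigr => j _; ring.
Qed.

Lemma dotBl (R : comRingType) (J : finType) (x y v : J -> R) (s t : R) :
  dot (fun j => s * x j - t * y j) v = s * dot x v - t * dot y v.
Proof.
by rewrite /dot !mulr_sumr -sumrB; apply: eq_bigr => j _; ring.
Qed.

(** The induction adds one vector a_0.  If the functional x found for the other
    vectors is negative on a_0, they and b are projected to its kernel along
    a_0, and the induction hypothesis is applied to the projections. *)
Lemma farkas_seq (R : realFieldType) (I J : finType) (r : seq I) :
  uniq r -> forall (a : I -> J -> R) (b : J -> R),
  (exists l : I -> R, (forall i, 0 <= l i) /\
     forall j, b j = \sum_(i <- r) l i * a i j) \/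
  (exists x : J -> R, (forall i, i \in r -> 0 <= dot x (a i)) /\ dot x b < 0).
Proof.
elim: r => [_ a b|i0 r IH /= /andP[i0r ur] a b].
  have [/forallP b0|] := boolP [forall j, b j == 0].
    left; exists (fun=> 0); split => // j; rewrite big_nil; exact/eqP.
  rewrite negb_forall => /existsP[j bj]; right; exists (fun j => - b j).
  split => //; rewrite /dot (bigD1 j)//= mulNr.
  rewrite -subr_gt0 sub0r opprD opprK ltr_wpDr//.
    rewrite -sumrN sumr_ge0// => k _; rewrite mulNr opprK -expr2; exact: sqr_ge0.
  by rewrite -expr2 lt0r sqrf_eq0 bj sqr_ge0.
have [[l [l0 lE]]|[x [xa xb]]] := IH ur a b.
  left; exists (fun i => if i == i0 then 0 else l i); split.
    by move=> i; case: ifP.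
  move=> j; rewrite big_cons eqxx mul0r add0r lE big_seq [RHS]big_seq.
  apply: eq_bigr => i ir; case: eqP => // ii0.
  by rewrite -ii0 ir in i0r.
have [xi0|xi0] := leP 0 (dot x (a i0)).
  right; exists x; split => // i; rewrite inE => /orP[/eqP->//|]; exact: xa.
set p := dot x (a i0) in xi0.
pose a' i j := dot x (a i) * a i0 j - p * a i j.
pose b' j := dot x b * a i0 j - p * b j.
have [[l [l0 lE]]|[y [ya yb]]] := IH ur a' b'.
  left; exists (fun i => if i == i0 then
      (\sum_(k <- r) l k * dot x (a k) - dot x b) / - p else l i); split.
    move=> i; case: ifP => // _; rewrite divr_ge0 ?oppr_ge0 ?(ltW xi0)//.
    rewrite subr_ge0 (le_trans (ltW xb))// big_seq sumr_ge0// => k kr.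
    by rewrite mulr_ge0// xa.
  move=> j; rewrite big_cons eqxx.
  have -> : \sum_(i <- r) (if i == i0 then
      (\sum_(k <- r) l k * dot x (a k) - dot x b) / - p else l i) * a i j
      = \sum_(i <- r) l i * a i j.
    rewrite big_seq [RHS]big_seq; apply: eq_bigr => i ir; case: eqP => // ii0.
    by rewrite -ii0 ir in i0r.
  have p0 : p != 0 by rewrite lt_eqF.
  have := lE j; rewrite /b' /a'.
  have -> : \sum_(i <- r) l i * (dot x (a i) * a i0 j - p * a i j) =
     (\sum_(k <- r) l k * dot x (a k)) * a i0 j - p * \sum_(i <- r) l i * a i j.
    rewrite mulr_suml mulr_sumr -sumrB; apply: eq_bigr => k _; ring.
  move=> E; apply: (mulfI p0); rewrite mulrDr.
  have -> : p * ((\sum_(k <- r) l k * dot x (a k) - dot x b) / - p * a i0 j) =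
     - ((\sum_(k <- r) l k * dot x (a k) - dot x b) * a i0 j) by field.
  lra.
right; exists (fun j => dot y (a i0) * x j - p * y j); split.
  move=> i; rewrite inE dotBl => /orP[/eqP->|ir].
    by rewrite -/p mulrC subrr.
  by have := ya i ir; rewrite /a' dotBr mulrC.
by rewrite dotBl mulrC -dotBr.
Qed.

(** Optimality is primal feasibility, dual feasibility and absence of a duality
    gap, which together form a single linear system in (l, phi); a Farkas
    certificate of its insolvability contradicts the feasible points m and
    phi0. *)
Lemma lp_duality (R : realFieldType) (I J : finType) (A : I -> J -> R)
    (h : I -> R) (P : J -> R) (m : I -> R) (phi0 : J -> R) :
  (forall i, 0 <= m i) -> (forall j, P j = \sum_i m i * A i j) ->
  (forall i, 0 <= h i + dot phi0 (A i)) ->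
  exists (l : I -> R) (phi : J -> R),
  [/\ forall i, 0 <= l i, forall j, P j = \sum_i l i * A i j,
      forall i, 0 <= h i + dot phi (A i)
    & forall i, l i != 0 -> h i + dot phi (A i) = 0].
Proof.
move=> m0 mE phi0P.
(* The rows express P by the A i, define the slacks of the dual inequalities,
   and bound the duality gap.  The columns are l, the positive and the negative
   part of phi, the slacks, and the slack of the gap. *)
pose col (k : I + (J + J) + (I + unit)) (r : J + I + unit) : R :=
  match k, r with
  | inl (inl i), inl (inl j) => A i j
  | inl (inl i), inl (inr _) => 0
  | inl (inl i), inr _ => h i
  | inl (inr (inl j)), inl (inl _) => 0
  | inl (inr (inl j)), inl (inr i) => A i j
  | inl (inr (inl j)), inr _ => P j
  | inl (inr (inr j)), inl (inl _) => 0
  | inl (inr (inr j)), inl (inr i) => - A i j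
  | inl (inr (inr j)), inr _ => - P j
  | inr (inl i), inl (inr i') => - (i == i')%:R
  | inr (inl i), _ => 0
  | inr (inr _), inr _ => 1
  | inr (inr _), _ => 0
  end.
pose b (r : J + I + unit) : R :=
  match r with inl (inl j) => P j | inl (inr i) => - h i | inr _ => 0 end.
have unitE (F : unit -> R) : \sum_u F u = F tt.
  by rewrite (bigD1 tt)//= big1 ?addr0// => -[].
have delta (i : I) (F : I -> R) : \sum_k F k * - (k == i)%:R = - F i.
  rewrite (bigD1 i)//= eqxx big1 ?addr0 ?mulrN1// => k /negbTE ->.
  by rewrite oppr0 mulr0.
have [[l [l0 lE]]|[x [xa xb]]] := farkas_seq (index_enum_uniq _) col b.
  pose L i := l (inl (inl i)).
  pose phi j := l (inl (inr (inl j))) - l (inl (inr (inr j))).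
  have LP j : P j = \sum_i L i * A i j.
    have := lE (inl (inl j)); rewrite !big_sumType /= unitE => ->.
    rewrite [X in _ + (X + _) + _]big1 => [|*]; last by rewrite mulr0.
    rewrite [X in _ + (_ + X) + _]big1 => [|*]; last by rewrite mulr0.
    rewrite [X in _ + _ + (X + _)]big1 => [|*]; last by rewrite mulr0.
    by rewrite mulr0 !addr0.
  have phiE i : - h i = dot phi (A i) - l (inr (inl i)).
    have := lE (inl (inr i)); rewrite !big_sumType /= unitE delta => ->.
    rewrite [X in X + _ + _]big1 ?add0r ?mulr0 ?addr0//; last first.
      by move=> *; rewrite mulr0.
    rewrite /dot -big_split /=; congr (_ - _); apply: eq_bigr => j _.
    by rewrite /phi; ring.
  have dE : 0 = \sum_i L i * h i + dot phi P + l (inr (inr tt)).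
    have := lE (inr tt); rewrite !big_sumType /= unitE.
    rewrite [X in _ + (X + _)]big1 => [|*]; last by rewrite mulr0.
    rewrite add0r mulr1 => E; apply: (etrans E); congr (_ + _ + _).
    rewrite /dot -big_split /=; apply: eq_bigr => j _.
    by rewrite /phi; ring.
  have slack i : h i + dot phi (A i) = l (inr (inl i)).
    by have := phiE i; lra.
  exists L, phi; split => // [i|i|i Li0]; rewrite ?l0 ?slack//.
  have sum0 : \sum_i L i * l (inr (inl i)) <= 0.
    have -> : \sum_i L i * l (inr (inl i)) = \sum_i L i * h i + dot phi P.
      rewrite /dot; under [X in _ = _ + X]eq_bigr do rewrite LP mulr_sumr.
      rewrite exchange_big /= -big_split /=; apply: eq_bigr => k _.
      rewrite -slack mulrDr /dot mulr_sumr; congr (_ + _).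
      by apply: eq_bigr => j _; ring.
    by have := l0 (inr (inr tt)); lra.
  have t0 k : 0 <= L k * l (inr (inl k)) by rewrite mulr_ge0// l0.
  have : \sum_k L k * l (inr (inl k)) == 0.
    by rewrite eq_le sum0 sumr_ge0.
  rewrite psumr_eq0// => /allP /(_ i (mem_index_enum _)) /=.
  by rewrite mulf_eq0 (negbTE Li0) => /eqP.
exfalso.
(* The certificate x gives a dual direction X, weights nu and a scale tau. *)
pose X j := x (inl (inl j)); pose nu i := - x (inl (inr i)).
pose tau := x (inr tt).
have c1 i : 0 <= dot X (A i) + tau * h i.
  have := xa (inl (inl i)) (mem_index_enum _).
  rewrite /dot !big_sumType /= unitE.
  by rewrite [X in _ + X + _]big1 ?addr0// => *; rewrite mulr0.
have c2 i : 0 <= nu i.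
  have := xa (inr (inl i)) (mem_index_enum _).
  rewrite /dot !big_sumType /= unitE.
  under [X in _ + X + _]eq_bigr do rewrite eq_sym.
  rewrite delta [X in X + _ + _]big1 ?add0r ?mulr0 ?addr0// => *.
  by rewrite mulr0.
have c3 : 0 <= tau.
  have := xa (inr (inr tt)) (mem_index_enum _).
  rewrite /dot !big_sumType /= unitE mulr1.
  rewrite [X in X + _ + _]big1 => [|*]; last by rewrite mulr0.
  by rewrite [X in _ + X + _]big1 ?add0r// => *; rewrite mulr0.
have c4 j : \sum_i nu i * A i j = tau * P j.
  have := xa (inl (inr (inl j))) (mem_index_enum _).
  rewrite /dot !big_sumType /= unitE.
  rewrite [X in X + _ + _]big1 => [H1|*]; last by rewrite mulr0.
  have := xa (inl (inr (inr j))) (mem_index_enum _).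
  rewrite /dot !big_sumType /= unitE.
  rewrite [X in X + _ + _]big1 => [|*]; last by rewrite mulr0.
  under eq_bigr do rewrite mulrN.
  rewrite sumrN => H2; under eq_bigr do rewrite mulNr.
  rewrite sumrN /tau; lra.
have c5 : dot X P + \sum_i nu i * h i < 0.
  have := xb; rewrite /dot !big_sumType /= unitE mulr0 addr0.
  by under [X in _ + X]eq_bigr do rewrite mulrN -mulNr.
have swap (y : J -> R) (n : I -> R) (Q : J -> R) :
    (forall j, \sum_i n i * A i j = Q j) ->
    dot y Q = \sum_i n i * dot y (A i).
  move=> nE; rewrite /dot; under eq_bigr do rewrite -nE mulr_sumr.
  rewrite exchange_big /=; apply: eq_bigr => i _; rewrite mulr_sumr.
  by apply: eq_bigr => j _; ring.
have XP := swap X m P (fun j => esym (mE j)).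
have XnP : tau * dot X P = \sum_i nu i * dot X (A i).
  rewrite -(swap X nu (fun j => tau * P j))// /dot mulr_sumr.
  by apply: eq_bigr => j _; ring.
have [t0|t0] := eqVneq tau 0.
  have : 0 <= dot X P.
    rewrite XP sumr_ge0// => i _; rewrite mulr_ge0//.
    by have := c1 i; rewrite t0 mul0r addr0.
  have : 0 <= \sum_i nu i * (h i + dot phi0 (A i)).
    by rewrite sumr_ge0// => i _; rewrite mulr_ge0.
  under eq_bigr do rewrite mulrDr.
  rewrite big_split /= -(swap phi0 nu (fun j => tau * P j))//.
  have -> : dot phi0 (fun j => tau * P j) = 0.
    by rewrite /dot big1// => j _; rewrite t0 mul0r mulr0.
  lra.
have tp : 0 < tau by rewrite lt0r t0.
have : 0 <= \sum_i nu i * (dot X (A i) + tau * h i).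
  by rewrite sumr_ge0// => i _; rewrite mulr_ge0.
under eq_bigr do rewrite mulrDr mulrCA.
rewrite big_split /= -XnP -mulr_sumr -mulrDr pmulr_rge0//.
lra.
Qed.

(** * Unimodular simplices of the polytope *)

Lemma sum_expo (i : 'I_8) : (\sum_(j < 4) expo i j = 3)%N.
Proof.
rewrite !big_ord_recl big_ord0 /expo /=.
by case: i; do 8?[case => //].
Qed.

Lemma sum_expo_weight (R : pzSemiRingType) (f : 'I_8 -> R) :
  \sum_j \sum_i f i * (expo i j)%:R = (\sum_i f i) *+ 3.
Proof.
rewrite exchange_big /= -sumrMnl; apply: eq_bigr => i _.
by rewrite -mulr_sumr -natr_sum sum_expo mulr_natr.
Qed.

Section UnimodularCell.
Variables (R : realType) (t : 'I_4 -> 'I_8).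
Hypothesis t1 : normalized_volume t = 1%N.

Let M : 'M[int]_3 := \matrix_(k < 3, j < 3)
      ((expo (t (lift ord0 k)) (lift ord_max j))%:Z
       - (expo (t ord0) (lift ord_max j))%:Z).

Let uM : M \in unitmx.
Proof.
rewrite unitmxE; apply/unitrP; exists (\det M).
have : absz (\det M) = 1%N by exact: t1.
by case: (\det M) => [[|[|]]|[|]].
Qed.

(** The coordinates with respect to the vertices other than the first one are
    obtained with the inverse edge matrix, which is integral: this is where
    normalized volume one enters. *)
Lemma affine_coordinates (c : 'I_4 -> R) (k : 'I_3) :
  c (lift ord0 k) = \sum_(j < 3)
    (\sum_l c l * (expo (t l) (lift ord_max j))%:R
     - (\sum_l c l) * (expo (t ord0) (lift ord_max j))%:R)
    * (invmx M j k)%:~R.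
Proof.
pose r : 'rV[R]_3 := \row_k c (lift ord0 k).
have E : r = r *m map_mx intr M *m map_mx intr (invmx M).
  by rewrite -mulmxA -map_mxM /= mulmxV// map_mx1 mulmx1.
have -> : c (lift ord0 k) = r 0 k by rewrite mxE.
rewrite E mxE; apply: eq_bigr => j _; rewrite !mxE; congr (_ * _).
rewrite mulr_suml -sumrB [RHS]big_ord_recl subrr add0r; apply: eq_bigr => l _.
by rewrite !mxE rmorphB /= mulrBr !pmulrn.
Qed.

Lemma affinely_independent (c : 'I_4 -> R) :
  (forall j, \sum_l c l * (expo (t l) j)%:R = 0) -> forall l, c l = 0.
Proof.
move=> c0.
have S0 : \sum_l c l = 0.
  have : \sum_j \sum_l c l * (expo (t l) j)%:R = 0 by rewrite big1.
  rewrite exchange_big /=.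
  under eq_bigr do rewrite -mulr_sumr -natr_sum sum_expo.
  by rewrite -mulr_suml => /eqP; rewrite mulf_eq0 pnatr_eq0 orbF => /eqP.
have cS k : c (lift ord0 k) = 0.
  by rewrite affine_coordinates big1// => j _; rewrite c0 S0 mul0r subr0 mul0r.
move=> l; case: (unliftP ord0 l) => [k|] ->//.
by move: S0; rewrite big_ord_recl big1 ?addr0.
Qed.

Lemma unimodular_inj : injective t.
Proof.
move=> k k' tkk'; apply/eqP/negPn/negP => kk'.
suff /(_ k)/eqP : forall l, (l == k)%:R - (l == k')%:R = 0 :> R.
  by rewrite eqxx (negbTE kk') subr0 oner_eq0.
apply: affinely_independent => j.
under eq_bigr do rewrite mulrBl; rewrite sumrB.
rewrite (bigD1 k)//= eqxx big1 => [|l /negbTE->]; last by rewrite mul0r.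
rewrite [X in _ - X](bigD1 k')//= eqxx big1 => [|l /negbTE->]; last by rewrite mul0r.
by rewrite tkk' subrr.
Qed.

Lemma sum_cell (f : 'I_8 -> R) (g : 'I_8 -> R) :
  (forall i, i \notin [set t k | k : 'I_4] -> f i = 0) ->
  \sum_i f i * g i = \sum_k f (t k) * g (t k).
Proof.
move=> f0; rewrite (bigID (fun i => i \in [set t k | k : 'I_4]))/=.
rewrite [X in _ + X]big1 => [|i /f0 ->]; last by rewrite mul0r.
rewrite addr0 big_imset//= => k k' _ _; exact: unimodular_inj.
Qed.

Lemma unimodular_integral (c : 'I_8 -> R) (P : 'I_4 -> nat) (N : nat) :
  (forall i, i \notin [set t k | k : 'I_4] -> c i = 0) ->
  (forall i, 0 <= c i) ->
  (forall j, \sum_i c i * (expo i j)%:R = (P j)%:R) -> \sum_i c i = N%:R ->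
  forall i, exists m : nat, c i = m%:R.
Proof.
move=> cout c0 cP cN i.
have [/imsetP[k _ ->]|/cout->] := boolP (i \in [set t k | k : 'I_4]); last first.
  by exists 0%N.
have cint l : c (t (lift ord0 l)) \is a Num.int.
  have /= -> := affine_coordinates (c \o t) l; apply: rpred_sum => j _.
  rewrite rpredM ?intr_int// rpredB//.
    by rewrite -(sum_cell (fun i => (expo i (lift ord_max j))%:R))// cP natr_int.
  rewrite rpredM ?natr_int//.
  under eq_bigr do rewrite -[c _]mulr1.
  rewrite -(sum_cell (fun=> 1))//; under eq_bigr do rewrite mulr1.
  by rewrite cN natr_int.
have : c (t k) \is a Num.int.
  case: (unliftP ord0 k) => [l|] ->//.
  have -> : c (t ord0) = N%:R - \sum_l c (t (lift ord0 l)).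
    rewrite -cN; under eq_bigr do rewrite -[c _]mulr1.
    rewrite (sum_cell (fun=> 1))//= big_ord_recl mulr1.
    by under [X in _ + X - _]eq_bigr do rewrite mulr1; rewrite addrK.
  by rewrite rpredB ?natr_int// rpred_sum.
move=> ci; have : c (t k) \is a Num.nat by rewrite natrEint ci c0.
by move=> /natrP[m ->]; exists m.
Qed.

End UnimodularCell.

(** * Unique minima from a unimodular subdivision *)

Section Fibers.
Variables (R : realType) (ht : 'I_8 -> R).

Definition lift_val (phi : 'rV[R]_4) i :=
  ht i + \sum_(j < 4) phi 0 j * (expo i j)%:R.

Lemma mem_lower_face (phi : 'rV[R]_4) i :
  (i \in lower_face (fun i => (ht i)%:E) phi)
  = [forall k, lift_val phi i <= lift_val phi k].
Proof. by rewrite inE; apply: eq_forallb => k; rewrite -!EFinD lee_fin. Qed.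

Lemma cell_sub_maximal (s : {set 'I_8}) : is_cell (fun i => (ht i)%:E) s ->
  exists2 s', is_maximal_cell (fun i => (ht i)%:E) s' & s \subset s'.
Proof.
move=> /asboolP sc.
have [s' /maxsetP[/asboolP s'c s'max] ss'] :=
  @maxset_exists _ (fun s => `[< is_cell (fun i => (ht i)%:E) s >]) s sc.
by exists s' => //; split => // u uc; apply: s'max; exact/asboolP.
Qed.

(** A nonnegative real combination of the exponents of minimal height is
    supported on a cell, by complementary slackness, hence on a maximal cell,
    which is a unimodular simplex; so its coefficients are natural numbers m.
    The functional of that cell shows that a combination n of k times the same
    degree has height at least that of k m, with equality only if n is
    supported on the simplex, where coordinates are unique. *)
Lemma fiber_unique_min :
  (forall s, is_maximal_cell (fun i => (ht i)%:E) s ->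
     exists t : 'I_4 -> 'I_8,
       s = [set t k | k : 'I_4] /\ normalized_volume t = 1%N) ->
  forall l : 'I_8 -> nat, exists m : 'I_8 -> nat,
    (forall j, \sum_i m i * expo i j = \sum_i l i * expo i j)%N /\
    forall k n, (forall j, \sum_i n i * expo i j = k * \sum_i m i * expo i j)%N ->
      (exists i, n i <> k * m i)%N ->
      k%:R * \sum_i (m i)%:R * ht i < \sum_i (n i)%:R * ht i.
Proof.
move=> smooth l.
have sum_natr (f : 'I_8 -> nat) j :
    \sum_i (f i)%:R * (expo i j)%:R = (\sum_i f i * expo i j)%:R :> R.
  by rewrite natr_sum; apply: eq_bigr => i _; rewrite natrM.
(* The coordinates of an exponent sum to 3, so this constant functional lifts
   all heights above 0. *)
pose K := \sum_i `|ht i|.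
have K0 i : 0 <= ht i + dot (fun=> K) (fun j => (expo i j)%:R).
  rewrite /dot -mulr_sumr -natr_sum sum_expo.
  have : - `|ht i| <= ht i by rewrite lerNl -normrN ler_norm.
  have : `|ht i| <= K by rewrite /K (bigD1 i)//= lerDl sumr_ge0.
  have := normr_ge0 (ht i); lra.
have [c [phi [c0 cP phi0 cphi]]] := lp_duality (fun i => ler0n _ (l i))
  (fun j => erefl (\sum_i (l i)%:R * (expo i j)%:R)) K0.
pose lphi : 'rV[R]_4 := \row_j phi j.
have liftE i : lift_val lphi i = ht i + dot phi (fun j => (expo i j)%:R).
  by congr (_ + _); apply: eq_bigr => j _; rewrite mxE.
have [s' s'max ss'] := cell_sub_maximal (ex_intro _ lphi erefl).
have [t [s't t1]] := smooth _ s'max.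
have [[psi s'psi] _] := s'max.
have cout i : i \notin [set t k | k : 'I_4] -> c i = 0.
  rewrite -s't => is'; apply/eqP/negPn/negP => ci.
  move/fintype.subsetP: ss' => /(_ i); rewrite (negbTE is') mem_lower_face.
  suff -> : [forall k, lift_val lphi i <= lift_val lphi k] by move=> /(_ isT).
  by apply/forallP => k; rewrite !liftE cphi.
have cdeg : \sum_i c i = (\sum_i l i)%:R.
  have : (\sum_i c i) *+ 3 = (\sum_i (l i)%:R) *+ 3.
    by rewrite -!sum_expo_weight; apply: eq_bigr => j _; rewrite -cP.
  by move=> /eqP; rewrite eqrMn2r//= => /eqP ->; rewrite natr_sum.
have cnat i : {m : nat | c i = m%:R}.
  apply/cid; apply: (unimodular_integral t1 cout c0 _ cdeg) => j.
  by rewrite -cP; exact: sum_natr.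
pose m i := sval (cnat i); have mE i : c i = (m i)%:R := svalP (cnat i).
exists m; split.
  move=> j; apply/eqP; rewrite -(eqr_nat R) -!sum_natr cP; apply/eqP.
  by apply: eq_bigr => i _; rewrite mE.
move=> k n nP nkm.
have mout i : i \notin [set t k | k : 'I_4] -> (m i)%:R = 0 :> R.
  by move=> /cout; rewrite mE.
have degE : \sum_i (n i)%:R = k%:R * \sum_i (m i)%:R :> R.
  have : (\sum_i (n i)%:R) *+ 3 = (k%:R * \sum_i (m i)%:R) *+ 3 :> R.
    rewrite -mulrnAr -!sum_expo_weight mulr_sumr; apply: eq_bigr => j _.
    by rewrite !sum_natr nP natrM.
  by move=> /eqP; rewrite eqrMn2r//= => /eqP.
pose mu := lift_val psi (t ord0).
have tin k' : t k' \in s' by rewrite s't imset_f.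
have muP i : mu <= lift_val psi i.
  by have := tin ord0; rewrite s'psi mem_lower_face => /forallP.
have muE i : i \in s' -> lift_val psi i = mu.
  rewrite s'psi mem_lower_face => /forallP /(_ (t ord0)) H.
  by apply/eqP; rewrite eq_le H muP.
have muN i : lift_val psi i = mu -> i \in s'.
  by move=> E; rewrite s'psi mem_lower_face; apply/forallP => k'; rewrite E.
have sumE (f : 'I_8 -> nat) : \sum_i (f i)%:R * ht i =
    \sum_i (f i)%:R * (lift_val psi i - mu) + mu * \sum_i (f i)%:R
    - \sum_j psi 0 j * (\sum_i f i * expo i j)%:R.
  under [X in _ - X]eq_bigr do rewrite -sum_natr mulr_sumr.
  rewrite exchange_big mulr_sumr -big_split -sumrB /=; apply: eq_bigr => i _.
  rewrite /lift_val.
  have -> : \sum_j psi 0 j * ((f i)%:R * (expo i j)%:R) =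
     (f i)%:R * \sum_j psi 0 j * (expo i j)%:R.
    by rewrite mulr_sumr; apply: eq_bigr => j _; rewrite mulrCA.
  by ring.
have m0 : \sum_i (m i)%:R * (lift_val psi i - mu) = 0.
  rewrite big1// => i _; have [is'|is'] := boolP (i \in s').
    by rewrite muE// subrr mulr0.
  by rewrite mout ?mul0r// -s't.
rewrite !sumE m0 degE.
have -> : \sum_j psi 0 j * (\sum_i n i * expo i j)%:R =
    k%:R * \sum_j psi 0 j * (\sum_i m i * expo i j)%:R.
  by rewrite mulr_sumr; apply: eq_bigr => j _; rewrite nP natrM mulrCA.
suff : 0 < \sum_i (n i)%:R * (lift_val psi i - mu) by lra.
have pos i : 0 <= (n i)%:R * (lift_val psi i - mu).
  by rewrite mulr_ge0// subr_ge0.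
rewrite lt0r sumr_ge0// andbT; apply/negP; rewrite psumr_eq0// => /allP n0.
have nout i : i \notin [set t k | k : 'I_4] -> (n i)%:R = 0 :> R.
  rewrite -s't => is'; have := n0 i (mem_index_enum _).
  rewrite /= mulf_eq0 subr_eq0 => /orP[/eqP//|/eqP/muN].
  by rewrite (negbTE is').
case: nkm => i; apply.
suff : (n i)%:R = k%:R * (m i)%:R :> R.
  by rewrite -natrM => /eqP; rewrite eqr_nat => /eqP.
have [/imsetP[k' _ ->]|ti] := boolP (i \in [set t k | k : 'I_4]); last first.
  by rewrite mout// nout// mulr0.
apply/eqP; rewrite -subr_eq0; apply/eqP.
apply: (affinely_independent t1
  (c := fun k' => (n (t k'))%:R - k%:R * (m (t k'))%:R)) => j.
under eq_bigr do rewrite mulrBl; rewrite sumrB.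
rewrite -(sum_cell t1 (f := fun i => (n i)%:R) (fun i => (expo i j)%:R))//.
under [X in _ - X]eq_bigr do rewrite -mulrA.
rewrite -mulr_sumr.
rewrite -(sum_cell t1 (f := fun i => (m i)%:R) (fun i => (expo i j)%:R))//.
by rewrite !sum_natr nP natrM subrr.
Qed.

End Fibers.

(** * The coefficient valuations of a smooth surface *)

(** The monomial with exponents a', ..., h' in the coefficients has k times the
    degree of the one with exponents a, ..., h, for the grading in which a
    coefficient has the exponent vector of its monomial in x, y, z, w. *)
Definition same_fiber (k a b c d e f g h a' b' c' d' e' f' g' h' : nat) : Prop :=
  [/\ k * (a + b + c + e.*2 + f) = a' + b' + c' + e'.*2 + f',
      k * (a + b + d + e + f.*2) = a' + b' + d' + e' + f'.*2,
      k * (a + c + d + g.*2 + h) = a' + c' + d' + g'.*2 + h'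
    & k * (b + c + d + g + h.*2) = b' + c' + d' + g' + h'.*2]%N.

(** The form of [fiber_unique_min] in which everything else uses smoothness; the
    eight separate arguments make the symmetries of the octanomial visible as
    permutations. *)
Definition fiberwise_generic (R : realType) (va vb vc vd ve vf vg vh : R) : Prop :=
  forall a b c d e f g h : nat, exists ma mb mc md me mf mg mh : nat,
    same_fiber 1 a b c d e f g h ma mb mc md me mf mg mh /\
    forall k na nb nc nd ne nf ng nh : nat,
      same_fiber k ma mb mc md me mf mg mh na nb nc nd ne nf ng nh ->
      (na, nb, nc, nd, ne, nf, ng, nh) <>
        (k * ma, k * mb, k * mc, k * md, k * me, k * mf, k * mg, k * mh)%N ->
      k%:R * (ma%:R * va + mb%:R * vb + mc%:R * vc + md%:R * vd
        + me%:R * ve + mf%:R * vf + mg%:R * vg + mh%:R * vh)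
      < na%:R * va + nb%:R * vb + nc%:R * vc + nd%:R * vd
        + ne%:R * ve + nf%:R * vf + ng%:R * vg + nh%:R * vh.

Section Symmetries.
Variables (R : realType) (va vb vc vd ve vf vg vh : R).

(** The dihedral symmetry of the octanomial is generated by exchanging x and y,
    z and w, and the pairs (x, y) and (z, w). *)
Lemma generic_swap_xy : fiberwise_generic va vb vc vd ve vf vg vh ->
  fiberwise_generic va vb vd vc vf ve vg vh.
Proof.
move=> G a b c d e f g h.
have [ma [mb [mc [md [me [mf [mg [mh [E H]]]]]]]]] := G a b d c f e g h.
exists ma, mb, md, mc, mf, me, mg, mh; split; first by case: E => *; split; lia.
move=> k na nb nc nd ne nf ng nh E' ne'.
have := H k na nb nd nc nf ne ng nh; move=> /(_ _)/wrap[].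
  by case: E' => *; split; lia.
move=> /(_ _)/wrap[]; first by case=> *; apply: ne'; congr (_, _, _, _, _, _, _, _).
lra.
Qed.

Lemma generic_swap_zw : fiberwise_generic va vb vc vd ve vf vg vh ->
  fiberwise_generic vb va vc vd ve vf vh vg.
Proof.
move=> G a b c d e f g h.
have [ma [mb [mc [md [me [mf [mg [mh [E H]]]]]]]]] := G b a c d e f h g.
exists mb, ma, mc, md, me, mf, mh, mg; split; first by case: E => *; split; lia.
move=> k na nb nc nd ne nf ng nh E' ne'.
have := H k nb na nc nd ne nf nh ng; move=> /(_ _)/wrap[].
  by case: E' => *; split; lia.
move=> /(_ _)/wrap[]; first by case=> *; apply: ne'; congr (_, _, _, _, _, _, _, _).
lra.
Qed.

Lemma generic_swap_pairs : fiberwise_generic va vb vc vd ve vf vg vh ->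
  fiberwise_generic vc vd va vb vg vh ve vf.
Proof.
move=> G a b c d e f g h.
have [ma [mb [mc [md [me [mf [mg [mh [E H]]]]]]]]] := G c d a b g h e f.
exists mc, md, ma, mb, mg, mh, me, mf; split; first by case: E => *; split; lia.
move=> k na nb nc nd ne nf ng nh E' ne'.
have := H k nc nd na nb ng nh ne nf; move=> /(_ _)/wrap[].
  by case: E' => *; split; lia.
move=> /(_ _)/wrap[]; first by case=> *; apply: ne'; congr (_, _, _, _, _, _, _, _).
lra.
Qed.

End Symmetries.

Lemma smooth_generic (R : realType) (K : fieldType) (v : K -> \bar R)
    (a b c d e f g h : K) (va vb vc vd ve vf vg vh : R) :
  v a = va%:E -> v b = vb%:E -> v c = vc%:E -> v d = vd%:E ->
  v e = ve%:E -> v f = vf%:E -> v g = vg%:E -> v h = vh%:E ->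
  tropically_smooth v [tuple a; b; c; d; e; f; g; h] ->
  fiberwise_generic va vb vc vd ve vf vg vh.
Proof.
move=> Ea Eb Ec Ed Ee Ef Eg Eh [_ smooth].
pose ht (i : 'I_8) := nth 0 [:: va; vb; vc; vd; ve; vf; vg; vh] i.
have htE : (fun i => v (tnth [tuple a; b; c; d; e; f; g; h] i)) =
    (fun i => (ht i)%:E).
  apply/funext; case; rewrite /ht.
  by do 8![case=> [?|]; first by rewrite (tnth_nth 0)].
rewrite htE in smooth.
pose F (T : Type) (x0 x1 x2 x3 x4 x5 x6 x7 : T) (i : 'I_8) :=
  nth x0 [:: x0; x1; x2; x3; x4; x5; x6; x7] i.
move=> la lb lc ld le lf lg lh.
have [m [mP mmin]] := fiber_unique_min smooth (F _ la lb lc ld le lf lg lh).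
have sumE (V : nmodType) (G : 'I_8 -> V) : \sum_i G i =
    G (inord 0) + G (inord 1) + G (inord 2) + G (inord 3)
    + G (inord 4) + G (inord 5) + G (inord 6) + G (inord 7).
  rewrite !big_ord_recl big_ord0 addr0 !addrA.
  by do ![congr (_ + _)]; congr G; apply: val_inj; rewrite /= inordK.
have sumEn (G : 'I_8 -> nat) : (\sum_i G i =
    G (inord 0) + G (inord 1) + G (inord 2) + G (inord 3)
    + G (inord 4) + G (inord 5) + G (inord 6) + G (inord 7))%N.
  exact: (sumE nat).
have fibE (G : 'I_8 -> nat) : [/\ \sum_i G i * expo i (inord 0) =
   G (inord 0) + G (inord 1) + G (inord 2) + (G (inord 4)).*2 + G (inord 5),
   \sum_i G i * expo i (inord 1) =
   G (inord 0) + G (inord 1) + G (inord 3) + G (inord 4) + (G (inord 5)).*2,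
   \sum_i G i * expo i (inord 2) =
   G (inord 0) + G (inord 2) + G (inord 3) + (G (inord 6)).*2 + G (inord 7)
   & \sum_i G i * expo i (inord 3) =
   G (inord 1) + G (inord 2) + G (inord 3) + G (inord 6) + (G (inord 7)).*2]%N.
  by split; rewrite sumEn /expo !inordK//= ?muln0 ?muln1 ?muln2 ?addn0; lia.
have j4 (P : 'I_4 -> Prop) : P (inord 0) -> P (inord 1) -> P (inord 2) ->
    P (inord 3) -> forall j, P j.
  move=> P0 P1 P2 P3 j; rewrite -[j]inord_val.
  by case: j => -[|[|[|[|]]]].
exists (m (inord 0)), (m (inord 1)), (m (inord 2)), (m (inord 3)),
  (m (inord 4)), (m (inord 5)), (m (inord 6)), (m (inord 7)); split.
  have [E0 E1 E2 E3] := fibE m.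
  have := fibE (F _ la lb lc ld le lf lg lh).
  rewrite -!mP E0 E1 E2 E3 /F !inordK//= => -[H0 H1 H2 H3].
  by split; rewrite mul1n.
move=> k na nb nc nd ne nf ng nh [N0 N1 N2 N3] neq.
pose n := F _ na nb nc nd ne nf ng nh.
have := mmin k n; move=> /(_ _)/wrap[].
  have [E0 E1 E2 E3] := fibE m; have [F0 F1 F2 F3] := fibE n.
  by apply: j4; rewrite ?E0 ?E1 ?E2 ?E3 ?F0 ?F1 ?F2 ?F3 ?N0 ?N1 ?N2 ?N3;
     rewrite /n /F !inordK.
move=> /(_ _)/wrap[].
  apply/not_existsP => H; apply: neq.
  have {}H i : n i = (k * m i)%N by apply/not_notP/H.
  by do ![congr (_, _)]; rewrite -H /n /F inordK.
by rewrite !sumE /ht /n /F !inordK.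
Qed.

(** * Newton slopes of the elimination cubic *)

Definition strict_min2 (R : realType) (m x y : R) : Prop :=
  (m = x /\ x < y) \/ (m = y /\ y < x).

Definition strict_min3 (R : realType) (m x y z : R) : Prop :=
  [\/ [/\ m = x, x < y & x < z], [/\ m = y, y < x & y < z]
    | [/\ m = z, z < x & z < y]].

Definition strict_min5 (R : realType) (m x1 x2 x3 x4 x5 : R) : Prop :=
  [\/ [/\ m = x1, x1 < x2, x1 < x3, x1 < x4 & x1 < x5],
      [/\ m = x2, x2 < x1, x2 < x3, x2 < x4 & x2 < x5],
      [/\ m = x3, x3 < x1, x3 < x2, x3 < x4 & x3 < x5]
    | [/\ m = x4, x4 < x1, x4 < x2, x4 < x3 & x4 < x5] \/
      [/\ m = x5, x5 < x1, x5 < x2, x5 < x3 & x5 < x4]].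

(** All exponents in the fibers below are at most 3; the degree equations in the
    context refute the other values. *)
Ltac pin_exponent v := destruct v as [|[|[|[|v]]]]; try (exfalso; lia).

(** Specializes the minimality H to one monomial of k times the degree. *)
Ltac at_monomial H k na nb nc nd ne nf ng nh :=
  let X := fresh in
  have X := H k na nb nc nd ne nf ng nh;
  move: X => /(_ _)/wrap[]; [by split|];
  move=> /(_ _)/wrap[]; [by []|]; move=> X.

Section Fibers.
Variables (R : realType) (va vb vc vd ve vf vg vh : R).
Hypothesis G : fiberwise_generic va vb vc vd ve vf vg vh.

Lemma fiber_eg : exists m, strict_min2 m (ve + vg) (va + vc).
Proof.
have [ma [mb [mc [md [me [mf [mg [mh [[E1 E2 E3 E4] H]]]]]]]]] :=
  G 0 0 0 0 1 0 1 0.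
pin_exponent me; pin_exponent mg; pin_exponent ma; pin_exponent mc;
pin_exponent mb; pin_exponent md; pin_exponent mf; pin_exponent mh.
- at_monomial H 1%N 0%N 0%N 0%N 0%N 1%N 0%N 1%N 0%N.
  by exists (va + vc); right; split => //; lra.
- at_monomial H 1%N 1%N 0%N 1%N 0%N 0%N 0%N 0%N 0%N.
  by exists (ve + vg); left; split => //; lra.
Qed.

(** ab, cf and de are the monomials of their degree, and a e f h has twice this
    degree without being the square of one of them. *)
Lemma fiber_ab : exists m, strict_min3 m (va + vb) (vc + vf) (vd + ve) /\
  2 * m < va + ve + vf + vh.
Proof.
have [ma [mb [mc [md [me [mf [mg [mh [[E1 E2 E3 E4] H]]]]]]]]] :=
  G 1 1 0 0 0 0 0 0.
pin_exponent me; pin_exponent mc; pin_exponent ma; pin_exponent mg;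
pin_exponent mb; pin_exponent md; pin_exponent mf; pin_exponent mh;
  try at_monomial H 1%N 1%N 1%N 0%N 0%N 0%N 0%N 0%N 0%N;
  try at_monomial H 1%N 0%N 0%N 1%N 0%N 0%N 1%N 0%N 0%N;
  try at_monomial H 1%N 0%N 0%N 0%N 1%N 1%N 0%N 0%N 0%N;
  try at_monomial H 2%N 1%N 0%N 0%N 0%N 1%N 1%N 0%N 1%N;
  clear E1 E2 E3 E4 H;
  [exists (va + vb)|exists (vc + vf)|exists (vd + ve)]; split; try lra.
- by constructor 1; split => //; lra.
- by constructor 2; split => //; lra.
- by constructor 3; split => //; lra.
Qed.

(** These five monomials occur in the coefficient of al^2 of the elimination
    cubic, and m3, m1 are the valuations of those of al^3 and al.  A product of
    a monomial of the latter two has twice the degree of the minimal m, so it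
    has larger height unless it is its square, and a e h is the only one of the
    five whose square splits in this way. *)
Lemma fiber_aeh : exists m,
  strict_min5 m (2 * vc + vf) (va + vb + vc) (vc + vd + ve)
    (va + ve + vh) (vb + ve + vg) /\
  forall m3 m1, strict_min2 m3 (2 * ve + vh) (vb + vc + ve) ->
    strict_min5 m1 (2 * va + vh) (va + vc + vd) (va + vb + vg)
      (vc + vf + vg) (vd + ve + vg) ->
    2 * m < m3 + m1 \/ [/\ m = va + ve + vh, m3 = 2 * ve + vh & m1 = 2 * va + vh].
Proof.
have [ma [mb [mc [md [me [mf [mg [mh [[E1 E2 E3 E4] H]]]]]]]]] :=
  G 1 0 0 0 1 0 0 1.
pin_exponent me; pin_exponent mc; pin_exponent ma; pin_exponent mg;
pin_exponent mb; pin_exponent md; pin_exponent mf; pin_exponent mh;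
clear E1 E2 E3 E4 G.
- exists (va + vb + vc); split.
    at_monomial H 1%N 0%N 0%N 2%N 0%N 0%N 1%N 0%N 0%N.
    at_monomial H 1%N 1%N 0%N 0%N 0%N 1%N 0%N 0%N 1%N.
    at_monomial H 1%N 0%N 0%N 1%N 1%N 1%N 0%N 0%N 0%N.
    at_monomial H 1%N 0%N 1%N 0%N 0%N 1%N 0%N 1%N 0%N.
    by clear H; constructor 2; split => //; lra.
  move=> m3 m1 [[-> _]|[-> _]] [[-> _ _ _ _]|[-> _ _ _ _]|[-> _ _ _ _]|
    [[-> _ _ _ _]|[-> _ _ _ _]]].
  + left; at_monomial H 2%N 2%N 0%N 0%N 0%N 2%N 0%N 0%N 2%N; clear H; lra.
  + left; at_monomial H 2%N 1%N 0%N 1%N 1%N 2%N 0%N 0%N 1%N; clear H; lra.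
  + left; at_monomial H 2%N 1%N 1%N 0%N 0%N 2%N 0%N 1%N 1%N; clear H; lra.
  + left; at_monomial H 2%N 0%N 0%N 1%N 0%N 2%N 1%N 1%N 1%N; clear H; lra.
  + left; at_monomial H 2%N 0%N 0%N 0%N 1%N 3%N 0%N 1%N 1%N; clear H; lra.
  + left; at_monomial H 2%N 2%N 1%N 1%N 0%N 1%N 0%N 0%N 1%N; clear H; lra.
  + left; at_monomial H 2%N 1%N 1%N 2%N 1%N 1%N 0%N 0%N 0%N; clear H; lra.
  + left; at_monomial H 2%N 1%N 2%N 1%N 0%N 1%N 0%N 1%N 0%N; clear H; lra.
  + left; at_monomial H 2%N 0%N 1%N 2%N 0%N 1%N 1%N 1%N 0%N; clear H; lra.
  + left; at_monomial H 2%N 0%N 1%N 1%N 1%N 2%N 0%N 1%N 0%N; clear H; lra.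
- exists (2 * vc + vf); split.
    at_monomial H 1%N 1%N 1%N 1%N 0%N 0%N 0%N 0%N 0%N.
    at_monomial H 1%N 1%N 0%N 0%N 0%N 1%N 0%N 0%N 1%N.
    at_monomial H 1%N 0%N 0%N 1%N 1%N 1%N 0%N 0%N 0%N.
    at_monomial H 1%N 0%N 1%N 0%N 0%N 1%N 0%N 1%N 0%N.
    by clear H; constructor 1; split => //; lra.
  move=> m3 m1 [[-> _]|[-> _]] [[-> _ _ _ _]|[-> _ _ _ _]|[-> _ _ _ _]|
    [[-> _ _ _ _]|[-> _ _ _ _]]].
  + left; at_monomial H 2%N 2%N 0%N 0%N 0%N 2%N 0%N 0%N 2%N; clear H; lra.
  + left; at_monomial H 2%N 1%N 0%N 1%N 1%N 2%N 0%N 0%N 1%N; clear H; lra.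
  + left; at_monomial H 2%N 1%N 1%N 0%N 0%N 2%N 0%N 1%N 1%N; clear H; lra.
  + left; at_monomial H 2%N 0%N 0%N 1%N 0%N 2%N 1%N 1%N 1%N; clear H; lra.
  + left; at_monomial H 2%N 0%N 0%N 0%N 1%N 3%N 0%N 1%N 1%N; clear H; lra.
  + left; at_monomial H 2%N 2%N 1%N 1%N 0%N 1%N 0%N 0%N 1%N; clear H; lra.
  + left; at_monomial H 2%N 1%N 1%N 2%N 1%N 1%N 0%N 0%N 0%N; clear H; lra.
  + left; at_monomial H 2%N 1%N 2%N 1%N 0%N 1%N 0%N 1%N 0%N; clear H; lra.
  + left; at_monomial H 2%N 0%N 1%N 2%N 0%N 1%N 1%N 1%N 0%N; clear H; lra.
  + left; at_monomial H 2%N 0%N 1%N 1%N 1%N 2%N 0%N 1%N 0%N; clear H; lra.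
- exists (vb + ve + vg); split.
    at_monomial H 1%N 1%N 1%N 1%N 0%N 0%N 0%N 0%N 0%N.
    at_monomial H 1%N 0%N 0%N 2%N 0%N 0%N 1%N 0%N 0%N.
    at_monomial H 1%N 1%N 0%N 0%N 0%N 1%N 0%N 0%N 1%N.
    at_monomial H 1%N 0%N 0%N 1%N 1%N 1%N 0%N 0%N 0%N.
    by clear H; constructor 4; right; split => //; lra.
  move=> m3 m1 [[-> _]|[-> _]] [[-> _ _ _ _]|[-> _ _ _ _]|[-> _ _ _ _]|
    [[-> _ _ _ _]|[-> _ _ _ _]]].
  + left; at_monomial H 2%N 2%N 0%N 0%N 0%N 2%N 0%N 0%N 2%N; clear H; lra.
  + left; at_monomial H 2%N 1%N 0%N 1%N 1%N 2%N 0%N 0%N 1%N; clear H; lra.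
  + left; at_monomial H 2%N 1%N 1%N 0%N 0%N 2%N 0%N 1%N 1%N; clear H; lra.
  + left; at_monomial H 2%N 0%N 0%N 1%N 0%N 2%N 1%N 1%N 1%N; clear H; lra.
  + left; at_monomial H 2%N 0%N 0%N 0%N 1%N 3%N 0%N 1%N 1%N; clear H; lra.
  + left; at_monomial H 2%N 2%N 1%N 1%N 0%N 1%N 0%N 0%N 1%N; clear H; lra.
  + left; at_monomial H 2%N 1%N 1%N 2%N 1%N 1%N 0%N 0%N 0%N; clear H; lra.
  + left; at_monomial H 2%N 1%N 2%N 1%N 0%N 1%N 0%N 1%N 0%N; clear H; lra.
  + left; at_monomial H 2%N 0%N 1%N 2%N 0%N 1%N 1%N 1%N 0%N; clear H; lra.
  + left; at_monomial H 2%N 0%N 1%N 1%N 1%N 2%N 0%N 1%N 0%N; clear H; lra.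
- exists (va + ve + vh); split.
    at_monomial H 1%N 1%N 1%N 1%N 0%N 0%N 0%N 0%N 0%N.
    at_monomial H 1%N 0%N 0%N 2%N 0%N 0%N 1%N 0%N 0%N.
    at_monomial H 1%N 0%N 0%N 1%N 1%N 1%N 0%N 0%N 0%N.
    at_monomial H 1%N 0%N 1%N 0%N 0%N 1%N 0%N 1%N 0%N.
    by clear H; constructor 4; left; split => //; lra.
  move=> m3 m1 [[-> _]|[-> _]] [[-> _ _ _ _]|[-> _ _ _ _]|[-> _ _ _ _]|
    [[-> _ _ _ _]|[-> _ _ _ _]]].
  + by right; split.
  + left; at_monomial H 2%N 1%N 0%N 1%N 1%N 2%N 0%N 0%N 1%N; clear H; lra.
  + left; at_monomial H 2%N 1%N 1%N 0%N 0%N 2%N 0%N 1%N 1%N; clear H; lra.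
  + left; at_monomial H 2%N 0%N 0%N 1%N 0%N 2%N 1%N 1%N 1%N; clear H; lra.
  + left; at_monomial H 2%N 0%N 0%N 0%N 1%N 3%N 0%N 1%N 1%N; clear H; lra.
  + left; at_monomial H 2%N 2%N 1%N 1%N 0%N 1%N 0%N 0%N 1%N; clear H; lra.
  + left; at_monomial H 2%N 1%N 1%N 2%N 1%N 1%N 0%N 0%N 0%N; clear H; lra.
  + left; at_monomial H 2%N 1%N 2%N 1%N 0%N 1%N 0%N 1%N 0%N; clear H; lra.
  + left; at_monomial H 2%N 0%N 1%N 2%N 0%N 1%N 1%N 1%N 0%N; clear H; lra.
  + left; at_monomial H 2%N 0%N 1%N 1%N 1%N 2%N 0%N 1%N 0%N; clear H; lra.
- exists (vc + vd + ve); split.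
    at_monomial H 1%N 1%N 1%N 1%N 0%N 0%N 0%N 0%N 0%N.
    at_monomial H 1%N 0%N 0%N 2%N 0%N 0%N 1%N 0%N 0%N.
    at_monomial H 1%N 1%N 0%N 0%N 0%N 1%N 0%N 0%N 1%N.
    at_monomial H 1%N 0%N 1%N 0%N 0%N 1%N 0%N 1%N 0%N.
    by clear H; constructor 3; split => //; lra.
  move=> m3 m1 [[-> _]|[-> _]] [[-> _ _ _ _]|[-> _ _ _ _]|[-> _ _ _ _]|
    [[-> _ _ _ _]|[-> _ _ _ _]]].
  + left; at_monomial H 2%N 2%N 0%N 0%N 0%N 2%N 0%N 0%N 2%N; clear H; lra.
  + left; at_monomial H 2%N 1%N 0%N 1%N 1%N 2%N 0%N 0%N 1%N; clear H; lra.
  + left; at_monomial H 2%N 1%N 1%N 0%N 0%N 2%N 0%N 1%N 1%N; clear H; lra.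
  + left; at_monomial H 2%N 0%N 0%N 1%N 0%N 2%N 1%N 1%N 1%N; clear H; lra.
  + left; at_monomial H 2%N 0%N 0%N 0%N 1%N 3%N 0%N 1%N 1%N; clear H; lra.
  + left; at_monomial H 2%N 2%N 1%N 1%N 0%N 1%N 0%N 0%N 1%N; clear H; lra.
  + left; at_monomial H 2%N 1%N 1%N 2%N 1%N 1%N 0%N 0%N 0%N; clear H; lra.
  + left; at_monomial H 2%N 1%N 2%N 1%N 0%N 1%N 0%N 1%N 0%N; clear H; lra.
  + left; at_monomial H 2%N 0%N 1%N 2%N 0%N 1%N 1%N 1%N 0%N; clear H; lra.
  + left; at_monomial H 2%N 0%N 1%N 1%N 1%N 2%N 0%N 1%N 0%N; clear H; lra.
Qed.
End Fibers.

Lemma strict_min5_eq (R : realType) (m x1 x2 x3 x4 x5 y1 y2 y3 y4 y5 : R) :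
  strict_min5 m x1 x2 x3 x4 x5 ->
  x1 = y1 -> x2 = y2 -> x3 = y3 -> x4 = y4 -> x5 = y5 ->
  strict_min5 m y1 y2 y3 y4 y5.
Proof. by move=> H <- <- <- <- <-. Qed.

(** The situation in which the cubic has leading terms h al (e al + a)^2, up to
    its constant term: al = - a / e is then a double root to first order.  The
    last clause says that b al + d, at such al, has a valuation that places it
    strictly below the segment between the other two terms of the second line
    equation. *)
Definition double_slope (R : realType) (va vb vc vd ve vf vg vh m1 m0 : R) : Prop :=
  [/\ m1 = 2 * va + vh, 2 * m1 < va + ve + vh + m0,
      2 * va + vh < vc + vf + vg, 2 * va + vh < va + vc + vd &
      exists m, strict_min2 m (va + vb) (vd + ve) /\
                2 * m < va + ve + vf + vh].

(** By [fiber_aeh], the Newton polygon can lack a vertex at al^2 only if a e h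
    is minimal there; exchanging (x, y) with (z, w) gives the same for al.  In
    this case c f is not minimal among ab, cf, de: the square of c f would then
    lie below a e f h by [fiber_ab], while a e h lies below c c f. *)
Lemma newton_slopes (R : realType) (va vb vc vd ve vf vg vh : R) :
  fiberwise_generic va vb vc vd ve vf vg vh ->
  exists m3 m2 m1 m0,
  [/\ strict_min2 m3 (2 * ve + vh) (vb + vc + ve),
      strict_min5 m2 (2 * vc + vf) (va + vb + vc) (vc + vd + ve)
        (va + ve + vh) (vb + ve + vg),
      strict_min5 m1 (2 * va + vh) (va + vc + vd) (va + vb + vg)
        (vc + vf + vg) (vd + ve + vg),
      strict_min2 m0 (2 * vg + vf) (va + vd + vg) &
      [\/ 2 * m2 < m3 + m1 /\ 2 * m1 < m2 + m0,
          [/\ m3 = 2 * ve + vh, m2 = va + ve + vh &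
              double_slope va vb vc vd ve vf vg vh m1 m0]
        | [/\ m0 = 2 * vg + vf, m1 = vc + vg + vf &
              double_slope vc vd va vb vg vh ve vf m2 m3]]].
Proof.

move=> G.
have Gp := generic_swap_pairs G.
have [m2 [m2P m2lt]] := fiber_aeh G.
have [m1 [m1P m1lt]] := fiber_aeh Gp.
have [m3 m3P] : exists m, strict_min2 m (2 * ve + vh) (vb + vc + ve).
  have [m mP] := fiber_eg (generic_swap_zw G).
  exists (m + ve).
  by case: mP => -[-> ?]; [left|right]; split; lra.
have [m0 m0P] : exists m, strict_min2 m (2 * vg + vf) (va + vd + vg).
  have [m mP] := fiber_eg (generic_swap_zw Gp).
  exists (m + vg).
  by case: mP => -[-> ?]; [left|right]; split; lra.
have {}m1P : strict_min5 m1 (2 * va + vh) (va + vc + vd) (va + vb + vg)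
    (vc + vf + vg) (vd + ve + vg) by apply: (strict_min5_eq m1P); ring.
have {}m1lt := m1lt m0 m2 _ _; move: m1lt => /(_ _)/wrap[].
  by case: m0P => -[-> ?]; [left|right]; split; lra.
move=> /(_ _)/wrap[]; first by apply: (strict_min5_eq m2P); ring.
move=> m1lt; have {}m2lt := m2lt _ _ m3P m1P.
exists m3, m2, m1, m0; split => //.
have [m [mP mlt]] := fiber_ab G.
have [m' [mP' mlt']] := fiber_ab Gp.
case: m2lt m1lt => [m2lt|[m2E m3E m1E]] [m1lt|[m1E' m0E m2E']].
- by constructor 1; split; lra.
- constructor 3; split => //; rewrite /double_slope; split; try lra.
  + by case: m2P => [|||[|]] [? ? ? ? ?]; lra.
  + by case: m2P => [|||[|]] [? ? ? ? ?]; lra.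
  + case: mP' => -[? ? ?].
    * by exists m'; split => //; left; split; lra.
    * by case: m1P => [|||[|]] [? ? ? ? ?]; lra.
    * by exists m'; split; [right; split; lra|lra].
- constructor 2; split => //; rewrite /double_slope; split; try lra.
  + by case: m1P => [|||[|]] [? ? ? ? ?]; lra.
  + by case: m1P => [|||[|]] [? ? ? ? ?]; lra.
  + case: mP => -[? ? ?].
    * by exists m; split => //; left; split; lra.
    * by case: m2P => [|||[|]] [? ? ? ? ?]; lra.
    * by exists m; split; [right; split; lra|lra].
- by case: m2P => [|||[|]] [? ? ? ? ?]; lra.
Qed.

(** * Valuations and roots in a complete field *)

Section Valuation.
Variables (R : realType) (F : fieldType) (w : F -> \bar R).
Hypothesis hw : valuation w.

Lemma val_neqNy x : w x != -oo%E. Proof. by case: hw. Qed.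
Lemma val_eqy x : (w x == +oo%E) = (x == 0). Proof. by case: hw. Qed.
Lemma valM x y : (w (x * y) = w x + w y)%E. Proof. by case: hw. Qed.
Lemma val_addr x y : (Order.min (w x) (w y) <= w (x + y)%R)%E.
Proof. by case: hw. Qed.

Lemma val0 : w 0 = +oo%E. Proof. by apply/eqP; rewrite val_eqy. Qed.

Lemma val_finE x : x != 0 -> exists r : R, w x = r%:E.
Proof.
rewrite -val_eqy; have := val_neqNy x.
by case: (w x) => [r||]// _ _; exists r.
Qed.

Lemma val_fin_neq0 x (r : R) : w x = r%:E -> x != 0.
Proof. by move=> xr; rewrite -val_eqy xr. Qed.

Lemma val1 : w 1 = 0%E.
Proof.
have [r r1] := val_finE (oner_neq0 F).
have := valM 1 1; rewrite mulr1 r1 -EFinD => -[rr].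
by congr (_%:E); lra.
Qed.

Lemma valN x : w (- x) = w x.
Proof.
have wN1 : w (-1) = 0%E.
  have N10 : -1 != 0 :> F by rewrite oppr_eq0 oner_neq0.
  have [r r1] := val_finE N10.
  have := valM (-1) (-1); rewrite mulrNN mulr1 val1 r1 -EFinD => -[rr].
  by congr (_%:E); lra.
by rewrite -mulN1r valM wN1 add0e.
Qed.

Lemma valV x (r : R) : w x = r%:E -> w x^-1 = (- r)%:E.
Proof.
move=> xr; have x0 := val_fin_neq0 xr.
have xV0 : x^-1 != 0 by rewrite invr_eq0.
have [s xs] := val_finE xV0.
have := valM x x^-1; rewrite divff// val1 xr xs -EFinD => -[rs].
by congr (_%:E); lra.
Qed.

Lemma valX x (r : R) n : w x = r%:E -> w (x ^+ n) = (r *+ n)%:E.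
Proof.
move=> xr; elim: n => [|n IH]; first by rewrite expr0 val1.
by rewrite exprS valM xr IH -EFinD mulrS.
Qed.

Lemma val_addl_dom x y : (w x < w y)%E -> w (x + y) = w x.
Proof.
move=> xy; apply/eqP; rewrite eq_le; apply/andP; split; last first.
  by have := val_addr x y; rewrite min_l// ltW.
rewrite leNgt; apply/negP => H.
have := val_addr (x + y) (- y); rewrite addrK valN leNgt => /negP; apply.
by rewrite lt_min H xy.
Qed.

Lemma val_addr_dom x y : (w y < w x)%E -> w (x + y) = w y.
Proof. by move=> /val_addl_dom; rewrite addrC. Qed.

Lemma val_ge_add (r : \bar R) x y :
  (r <= w x)%E -> (r <= w y)%E -> (r <= w (x + y)%R)%E.
Proof. by move=> rx ry; rewrite (le_trans _ (val_addr x y))// le_min rx ry. Qed.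

Lemma val_gt_add (r : \bar R) x y :
  (r < w x)%E -> (r < w y)%E -> (r < w (x + y)%R)%E.
Proof. by move=> rx ry; rewrite (lt_le_trans _ (val_addr x y))// lt_min rx ry. Qed.

Lemma neq0_of_val x y : (w x < w y)%E -> x != 0.
Proof. by rewrite -val_eqy => xy; rewrite lt_eqF// (lt_le_trans xy) ?leey. Qed.

End Valuation.

Section CompleteSubfield.
Variables (p : nat) (R : realType) (K : fieldType) (v : K -> \bar R).
Variables (C : fieldType) (iota : {rmorphism K -> C}) (w : C -> \bar R).
Hypothesis hv : is_padic_field p v.
Hypothesis hw : valuation w.
Hypothesis hwv : forall x : K, w (iota x) = v x.

(** Linear growth of the valuations makes the approximations a Cauchy sequence
    of the base field; its limit is at infinite valuation from r. *)
Lemma limit_in_subfield (x : nat -> K) (r : C) (s t : R) : 0 < t ->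
  (forall n, ((s + t *+ n)%:E <= w (iota (x n) - r))%E) ->
  exists l, iota l = r.
Proof.
move=> t0 xr; case: hv => _ _ _ complete.
have large (M : R) : exists N : nat, forall n, (N <= n)%N -> M <= s + t *+ n.
  exists (Num.truncn ((M - s) / t)).+1 => n nN.
  have : (M - s) / t <= n%:R.
    by rewrite (le_trans (ltW (truncnS_gt _)))// ler_nat.
  by rewrite ler_pdivrMr// mulr_natl; lra.
have [|l lP] := complete x.
  move=> M; have [N NP] := large M; exists N => m n Nm Nn.
  rewrite -hwv rmorphB /=.
  have -> : iota (x m) - iota (x n) = (iota (x m) - r) - (iota (x n) - r) by ring.
  apply: (val_ge_add hw); rewrite ?(valN hw).
    by rewrite (le_trans _ (xr m))// lee_fin NP.
  by rewrite (le_trans _ (xr n))// lee_fin NP.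
exists l; apply/eqP; rewrite -subr_eq0; apply/negPn/negP => lr0.
have [c cE] := val_finE hw lr0.
have [N NP] := lP (c + 1); have [N' NP'] := large (c + 1).
pose n := maxn N N'.
suff : ((c + 1)%:E <= w (iota l - r))%E by rewrite cE lee_fin; lra.
have -> : iota l - r = (iota (x n) - r) - iota (x n - l) by rewrite rmorphB; ring.
apply: (val_ge_add hw); rewrite ?(valN hw).
  by rewrite (le_trans _ (xr n))// lee_fin NP'// leq_maxr.
by rewrite hwv NP// leq_maxl.
Qed.

Definition in_base (z : C) : Prop := exists l : K, iota l = z.

Lemma in_baseD x y : in_base x -> in_base y -> in_base (x + y).
Proof. by move=> [a <-] [b <-]; exists (a + b); rewrite rmorphD. Qed.
Lemma in_baseB x y : in_base x -> in_base y -> in_base (x - y).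
Proof. by move=> [a <-] [b <-]; exists (a - b); rewrite rmorphB. Qed.
Lemma in_baseM x y : in_base x -> in_base y -> in_base (x * y).
Proof. by move=> [a <-] [b <-]; exists (a * b); rewrite rmorphM. Qed.
Lemma in_baseV x : in_base x -> in_base x^-1.
Proof. by move=> [a <-]; exists (a^-1); rewrite fmorphV. Qed.

(** The power sums u_n of the roots are symmetric, so they lie in the base
    field, and u_(n+1) / u_n converges to the root of least valuation. *)
Lemma dominant_root r1 r2 r3 :
  in_base (r1 + r2 + r3) -> in_base (r1 * r2 + r1 * r3 + r2 * r3) ->
  in_base (r1 * r2 * r3) ->
  (w r1 < w r2)%E -> (w r1 < w r3)%E -> in_base r1.
Proof.
move=> e1 e2 e3 r12 r13.
have r10 : r1 != 0 by apply: neq0_of_val r12.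
have [s sE] := val_finE hw r10.
have [t t0 [t2 t3]] : exists2 t, 0 < t & ((s + t)%:E <= w r2 /\ (s + t)%:E <= w r3)%E.
  have fin x : (w r1 < w x)%E -> exists2 t, 0 < t & ((s + t)%:E <= w x)%E.
    rewrite sE; case: (w x) => [c||]//.
      by rewrite lte_fin => sc; exists (c - s); rewrite ?subr_gt0// lee_fin; lra.
    by exists 1; rewrite ?leey.
  have [t tp tx] := fin _ r12; have [t' tp' tx'] := fin _ r13.
  have [tt'|tt'] := leP t t'.
    exists t => //; split => //; rewrite (le_trans _ tx')// lee_fin; lra.
  exists t' => //; split => //; rewrite (le_trans _ tx)// lee_fin; lra.
have valX_ge (q : C) n : ((s + t)%:E <= w q)%E ->
    (((s + t) *+ n)%:E <= w (q ^+ n))%E.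
  move=> qP; elim: n => [|n IH]; first by rewrite expr0 (val1 hw).
  by rewrite exprS (valM hw) mulrS EFinD leeD.
pose u n := r1 ^+ n + r2 ^+ n + r3 ^+ n.
(* Newton's recursion of order three needs three consecutive power sums. *)
have u_in n : [/\ in_base (u n), in_base (u n.+1) & in_base (u n.+2)].
  elim: n => [|n [u0 u1 u2]].
    split.
    - by exists 3; rewrite rmorph_nat /u !expr0; ring.
    - by rewrite /u !expr1.
    - have -> : u 2 = (r1 + r2 + r3) * (r1 + r2 + r3) -
        ((r1 * r2 + r1 * r3 + r2 * r3) + (r1 * r2 + r1 * r3 + r2 * r3)).
        by rewrite /u; ring.
      by apply: in_baseB; [apply: in_baseM|apply: in_baseD].
  split => //.
  have -> : u n.+3 = (r1 + r2 + r3) * u n.+2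
     - (r1 * r2 + r1 * r3 + r2 * r3) * u n.+1 + r1 * r2 * r3 * u n.
    by rewrite /u !exprS; ring.
  by apply: in_baseD; [apply: in_baseB|]; apply: in_baseM.
have wu n : w (u n.+1) = (s *+ n.+1)%:E.
  rewrite /u -addrA val_addl_dom// (valX hw _ sE)//.
  have lt : ((s *+ n.+1)%:E < ((s + t) *+ n.+1)%:E)%E.
    by rewrite lte_fin mulrnDl ltrDl pmulrn_lgt0.
  by apply: (val_gt_add hw); apply: (lt_le_trans lt); apply: valX_ge.
have /all_tag[x xP] n : {x | iota x = u n.+2 / u n.+1}.
  by apply/cid; have [_ u1 u2] := u_in n; apply: in_baseM => //; exact: in_baseV.
apply: (@limit_in_subfield x _ (s + t) t t0) => n.
rewrite xP.
have u0 : u n.+1 != 0 by apply: val_fin_neq0 (wu n).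
have -> : u n.+2 / u n.+1 - r1 =
    (r2 ^+ n.+1 * (r2 - r1) + r3 ^+ n.+1 * (r3 - r1)) / u n.+1.
  apply: (mulIf u0); rewrite mulrBl !divfK// /u !exprS; ring.
rewrite (valM hw) (valV hw (wu n)).
suff : (((s + t) *+ n.+1 + s)%:E <=
    w (r2 ^+ n.+1 * (r2 - r1) + r3 ^+ n.+1 * (r3 - r1)))%E.
  case: (w _) => [c||]//; rewrite ?leey// -EFinD !lee_fin => H.
  by apply: le_trans (lerB H (lexx _)); rewrite mulrnDl !mulrS; lra.
have term q : (w r1 < w q)%E -> ((s + t)%:E <= w q)%E ->
   (((s + t) *+ n.+1 + s)%:E <= w (q ^+ n.+1 * (q - r1)))%E.
  move=> q1 q2; rewrite (valM hw) EFinD; apply: leeD; first exact: valX_ge.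
  by rewrite (val_addr_dom hw) ?(valN hw) ?sE// -sE.
by apply: (val_ge_add hw); apply: term.
Qed.

End CompleteSubfield.

(** * Valuations of sums and slopes of roots *)

Section StrictSums.
Variables (R : realType) (F : fieldType) (w : F -> \bar R).
Hypothesis hw : valuation w.

Lemma val_sum2 x1 x2 (v1 v2 m : R) : w x1 = v1%:E -> w x2 = v2%:E ->
  strict_min2 m v1 v2 -> w (x1 + x2) = m%:E.
Proof.
by move=> E1 E2 [[-> H]|[-> H]]; [rewrite -E1; apply: val_addl_dom
  |rewrite -E2; apply: val_addr_dom]; rewrite // E1 E2 lte_fin.
Qed.

Lemma val_sum5 x1 x2 x3 x4 x5 (v1 v2 v3 v4 v5 m : R) :
  w x1 = v1%:E -> w x2 = v2%:E -> w x3 = v3%:E -> w x4 = v4%:E ->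
  w x5 = v5%:E -> strict_min5 m v1 v2 v3 v4 v5 ->
  w (x1 + x2 + x3 + x4 + x5) = m%:E.
Proof.
move=> E1 E2 E3 E4 E5.
have dom y y1 y2 y3 y4 z : z = y + (y1 + y2 + y3 + y4) ->
   (w y < w y1)%E -> (w y < w y2)%E -> (w y < w y3)%E -> (w y < w y4)%E ->
   w z = w y.
  by move=> -> *; rewrite val_addl_dom//; do 3?apply: (val_gt_add hw).
case=> [|||[|]] [-> H1 H2 H3 H4].
- by rewrite -E1; apply: (@dom _ x2 x3 x4 x5);
   rewrite ?E1 ?E2 ?E3 ?E4 ?E5 ?lte_fin//; ring.
- by rewrite -E2; apply: (@dom _ x1 x3 x4 x5);
   rewrite ?E1 ?E2 ?E3 ?E4 ?E5 ?lte_fin//; ring.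
- by rewrite -E3; apply: (@dom _ x1 x2 x4 x5);
   rewrite ?E1 ?E2 ?E3 ?E4 ?E5 ?lte_fin//; ring.
- by rewrite -E4; apply: (@dom _ x1 x2 x3 x5);
   rewrite ?E1 ?E2 ?E3 ?E4 ?E5 ?lte_fin//; ring.
- by rewrite -E5; apply: (@dom _ x1 x2 x3 x4);
   rewrite ?E1 ?E2 ?E3 ?E4 ?E5 ?lte_fin//; ring.
Qed.

Lemma val_sum3_eq0 x y z (vx vy vz : R) : x + y + z = 0 ->
  w x = vx%:E -> w y = vy%:E -> w z = vz%:E ->
  [\/ vx = vy /\ vx <= vz, vx = vz /\ vx <= vy | vy = vz /\ vy <= vx].
Proof.
have dom a b c (va vb vc : R) : a + b + c = 0 ->
    w a = va%:E -> w b = vb%:E -> w c = vc%:E -> va < vb -> va < vc -> False.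
  move=> s0 Ea Eb Ec ab ac.
  have : w (a + (b + c)) = w a.
    by rewrite val_addl_dom//; apply: (val_gt_add hw); rewrite Ea ?Eb ?Ec lte_fin.
  by rewrite addrA s0 (val0 hw) Ea.
move=> s0 Ex Ey Ez.
have D1 := dom _ _ _ _ _ _ s0 Ex Ey Ez.
have D2 := dom y x z _ _ _ _ Ey Ex Ez.
have D3 := dom z x y _ _ _ _ Ez Ex Ey.
have {}D2 : vy < vx -> vy < vz -> False by apply: D2; rewrite -s0; ring.
have {}D3 : vz < vx -> vz < vy -> False by apply: D3; rewrite -s0; ring.
move: D1 D2 D3; clear; case: (ltgtP vx vy); case: (ltgtP vx vz); case: (ltgtP vy vz) => *.
all: try (by exfalso; auto); try (by constructor 1; split; lra);
  try (by constructor 2; split; lra); try (by constructor 3; split; lra).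
all: try (by exfalso; lra).
Qed.

(** The middle term lies strictly below the segment of the Newton polygon, so the
    two terms of least valuation are the first two or the last two. *)
Lemma quadratic_slopes (A B D b : F) (vA vB vD : R) : b != 0 ->
  A * b ^+ 2 + B * b + D = 0 ->
  w A = vA%:E -> w B = vB%:E -> w D = vD%:E -> 2 * vB < vA + vD ->
  w b = (vD - vB)%:E \/ w b = (vB - vA)%:E.
Proof.
move=> b0 E EA EB ED lt; have [y yE] := val_finE hw b0.
have E1 : w (A * b ^+ 2) = (vA + 2 * y)%:E.
  by rewrite (valM hw) EA (valX hw _ yE) -EFinD mulr2n; congr (_%:E); lra.
have E2 : w (B * b) = (vB + y)%:E by rewrite (valM hw) EB yE.
have := val_sum3_eq0 E E1 E2 ED; clear E; rewrite yE => -[] [H1 H2].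
- by right; congr (_%:E); lra.
- exfalso; suff : (0 : R) < 0 by rewrite ltxx.
  lra.
- by left; congr (_%:E); lra.
Qed.

End StrictSums.

Section CubicSlopes.
Variables (R : realType) (F : closedFieldType) (w : F -> \bar R).
Hypothesis hw : valuation w.

Lemma cubic_sorted_roots (s1 s2 s3 : F) : exists r1 r2 r3,
  [/\ r1 + r2 + r3 = s1, r1 * r2 + r1 * r3 + r2 * r3 = s2, r1 * r2 * r3 = s3
    & (w r3 <= w r2)%E /\ (w r2 <= w r1)%E].
Proof.
have [x1 x1E] := @solve_monicpoly F 3 (nth 0 [:: s3; - s2; s1]) isT.
rewrite !big_ord_recl big_ord0 /= expr0 expr1 in x1E.
have [x2 x2E] := @solve_monicpoly F 2
  (nth 0 [:: - (s2 - x1 * (s1 - x1)); s1 - x1]) isT.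
rewrite !big_ord_recl big_ord0 /= expr0 expr1 in x2E.
pose x3 := s1 - x1 - x2.
have e1 : x1 + x2 + x3 = s1 by rewrite /x3; ring.
have e2 : x1 * x2 + x1 * x3 + x2 * x3 = s2.
  have -> : x1 * x2 + x1 * x3 + x2 * x3 =
    x1 * (s1 - x1) + x2 * (s1 - x1) - x2 ^+ 2 by rewrite /x3; ring.
  by rewrite x2E; ring.
have e3 : x1 * x2 * x3 = s3.
  have -> : x1 * x2 * x3 = x1 * (x2 * (s1 - x1) - x2 ^+ 2) by rewrite /x3; ring.
  rewrite x2E; transitivity (s2 * x1 - s1 * x1 ^+ 2 + x1 ^+ 3); first by ring.
  by rewrite x1E; ring.
have sorted y1 y2 y3 : y1 + y2 + y3 = s1 -> y1 * y2 + y1 * y3 + y2 * y3 = s2 ->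
   y1 * y2 * y3 = s3 -> (w y3 <= w y2)%E -> (w y2 <= w y1)%E ->
  exists r1 r2 r3,
  [/\ r1 + r2 + r3 = s1, r1 * r2 + r1 * r3 + r2 * r3 = s2, r1 * r2 * r3 = s3
    & (w r3 <= w r2)%E /\ (w r2 <= w r1)%E].
  by move=> *; exists y1, y2, y3.
case: (leP (w x1) (w x2)) => [H12|/ltW H12];
case: (leP (w x2) (w x3)) => [H23|/ltW H23];
case: (leP (w x1) (w x3)) => [H13|/ltW H13].
- by apply: (sorted x3 x2 x1) => //; rewrite -?e1 -?e2 -?e3; ring.
- by apply: (sorted x3 x2 x1) => //; rewrite -?e1 -?e2 -?e3; ring.
- by apply: (sorted x2 x3 x1) => //; rewrite -?e1 -?e2 -?e3; ring.
- by apply: (sorted x2 x1 x3) => //; rewrite -?e1 -?e2 -?e3; ring.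
- by apply: (sorted x3 x1 x2) => //; rewrite -?e1 -?e2 -?e3; ring.
- by apply: (sorted x1 x3 x2) => //; rewrite -?e1 -?e2 -?e3; ring.
- by apply: (sorted x1 x2 x3) => //; rewrite -?e1 -?e2 -?e3; ring.
- by apply: (sorted x1 x2 x3) => //; rewrite -?e1 -?e2 -?e3; ring.
Qed.

(** The hypotheses say that the Newton polygon has a vertex at the linear term
    and is convex, possibly degenerate, at the quadratic one. *)
Lemma cubic_slopes r1 r2 r3 (E1 E2 E3 : R) :
  w (r1 + r2 + r3) = E1%:E -> w (r1 * r2 + r1 * r3 + r2 * r3) = E2%:E ->
  w (r1 * r2 * r3) = E3%:E -> (w r3 <= w r2)%E -> (w r2 <= w r1)%E ->
  2 * E1 <= E2 -> 2 * E2 < E1 + E3 ->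
  [/\ w r1 = (E3 - E2)%:E, w r2 = (E2 - E1)%:E & w r3 = E1%:E].
Proof.
move=> H1 H2 H3 H32 H21 L1 L2.
have : r1 * r2 * r3 != 0 by apply: val_fin_neq0 H3.
rewrite !mulf_eq0 !negb_or => /andP[/andP[r10 r20] r30].
have [x1 e1] := val_finE hw r10; have [x2 e2] := val_finE hw r20.
have [x3 e3] := val_finE hw r30.
move: H32 H21; rewrite e1 e2 e3 !lee_fin => H32 H21.
have P12 : w (r1 * r2) = (x1 + x2)%:E by rewrite (valM hw) e1 e2.
have P13 : w (r1 * r3) = (x1 + x3)%:E by rewrite (valM hw) e1 e3.
have P23 : w (r2 * r3) = (x2 + x3)%:E by rewrite (valM hw) e2 e3.
have F3 : E3 = x1 + x2 + x3.
  by move: H3; rewrite !(valM hw) e1 e2 e3 -!EFinD => -[].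
have F2 : x2 + x3 <= E2.
  rewrite -lee_fin -H2; do 2?apply: (val_ge_add hw);
  by rewrite ?P12 ?P13 ?P23 lee_fin; lra.
have F1 : x3 <= E1.
  rewrite -lee_fin -H1; do 2?apply: (val_ge_add hw);
  by rewrite ?e1 ?e2 ?e3 lee_fin; lra.
have F2' : x2 < x1 -> E2 = x2 + x3.
  move=> lt; have : w (r1 * r2 + r1 * r3 + r2 * r3) = w (r2 * r3).
    rewrite val_addr_dom//; apply: (val_gt_add hw);
    by rewrite ?P12 ?P13 ?P23 lte_fin; lra.
  by rewrite H2 P23 => -[].
have F1' : x3 < x2 -> E1 = x3.
  move=> lt; have : w (r1 + r2 + r3) = w r3.
    rewrite val_addr_dom//; apply: (val_gt_add hw);
    by rewrite ?e1 ?e2 ?e3 lte_fin; lra.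
  by rewrite H1 e3 => -[].
have x12 : x2 < x1.
  rewrite lt_neqAle H21 andbT; apply/eqP => x12.
  suff : (0 : R) < 0 by rewrite ltxx.
  have [lt|le] := ltP x3 x2; last lra.
  by have := F1' lt; lra.
have := F2' x12; have [lt|le] := ltP x3 x2.
  by move=> *; have := F1' lt; move=> *; split; congr (_%:E); lra.
by move=> *; split; congr (_%:E); lra.
Qed.

End CubicSlopes.

(** * Elimination in the line equations *)

(** The condition that x = al z, y = be w defines a line of the surface: after
    this substitution the equation is z w times a linear form in z and w, whose
    two coefficients are these. *)
Definition line_system (F : fieldType) (a b c d e f g h al be : F) : Prop :=
  e * al ^+ 2 * be + a * al * be + c * al + g = 0 /\
  f * al * be ^+ 2 + b * al * be + d * be + h = 0.

Section Elimination.
Variables (F : fieldType) (a b c d e f g h : F).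
Hypotheses (f0 : f != 0) (g0 : g != 0) (h0 : h != 0).
Hypotheses (egac : e * g + - (a * c) != 0).

(** The coefficients of the cubic are written as signed sums of monomials, one for
    each monomial of their degree; the only numerical factor other than a sign
    is 2. *)
Definition cubic3 : F := e * e * h + - (b * c * e).
Definition cubic2 : F :=
  c * c * f + - (a * b * c) + - (c * d * e) + 2 * (a * e * h) + - (b * e * g).
Definition cubic1 : F :=
  a * a * h + - (a * c * d) + - (a * b * g) + 2 * (c * f * g) + - (d * e * g).
Definition cubic0 : F := g * g * f + - (a * d * g).
Definition cubic (t : F) : F :=
  cubic3 * t ^+ 3 + cubic2 * t ^+ 2 + cubic1 * t + cubic0.

(** The first equation solved for be. *)
Definition beta_of (t : F) : F := - (c * t + g) / (t * (e * t + a)).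

(** This is the second equation with be eliminated. *)
Lemma cubicE t : cubic t = f * (c * t + g) ^+ 2
  - (b * t + d) * (c * t + g) * (e * t + a) + h * t * (e * t + a) ^+ 2.
Proof. by rewrite /cubic /cubic3 /cubic2 /cubic1 /cubic0; ring. Qed.

Lemma no_common_root t : e * t + a = 0 -> c * t + g = 0 -> False.
Proof.
move=> e0 c0; move/negP: egac; apply; apply/eqP.
have -> : e * g + - (a * c) = e * (c * t + g) - c * (e * t + a) by ring.
by rewrite e0 c0 !mulr0 subr0.
Qed.

Lemma line_system_neq0 al be :
  line_system a b c d e f g h al be -> al != 0 /\ be != 0.
Proof.
move=> [E1 E2]; split; apply/eqP => z.
  by move: E1; rewrite z expr0n /= !mulr0 !mul0r !add0r; apply/eqP.
by move: E2; rewrite z expr0n /= !mulr0 !add0r; apply/eqP.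
Qed.

Lemma system_denom_neq0 al be : line_system a b c d e f g h al be ->
  e * al + a != 0 /\ c * al + g != 0.
Proof.
move=> sys; have [al_neq0 be_neq0] := line_system_neq0 sys; case: sys => E1 _.
have E1' : al * be * (e * al + a) + (c * al + g) = 0 by rewrite -E1; ring.
split; apply/eqP => z; rewrite z ?mulr0 ?addr0 ?add0r in E1'.
  exact: no_common_root z E1'.
move/eqP: E1'; rewrite !mulf_eq0 (negbTE al_neq0) (negbTE be_neq0) /= => /eqP E1'.
exact: no_common_root E1' z.
Qed.

Lemma line_system_elim al be : line_system a b c d e f g h al be ->
  cubic al = 0 /\ be = beta_of al.
Proof.
move=> sys; have [al_neq0 be_neq0] := line_system_neq0 sys.
have [ea0 _] := system_denom_neq0 sys; case: sys => E1 E2.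
have beE : be = beta_of al.
  apply: (mulIf (mulf_neq0 al_neq0 ea0)); rewrite divfK ?mulf_neq0//.
  by apply/eqP; rewrite -subr_eq0 -E1; apply/eqP; ring.
split => //.
have : al * (e * al + a) ^+ 2 *
  (f * al * be ^+ 2 + b * al * be + d * be + h) = cubic al.
  by rewrite cubicE beE /beta_of; field; rewrite al_neq0 ea0.
by rewrite E2 mulr0.
Qed.

Hypothesis q0 : cubic0 != 0.

Lemma line_system_intro t : cubic t = 0 ->
  line_system a b c d e f g h t (beta_of t).
Proof.
move=> qt.
have t0 : t != 0.
  apply/eqP => z; move/eqP: qt; rewrite /cubic z !expr0n /= !mulr0 !add0r.
  exact/negP.
have ea0 : e * t + a != 0.
  apply/eqP => z; move/eqP: (qt); rewrite cubicE z expr0n /= !mulr0 subr0 addr0.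
  by rewrite mulf_eq0 (negbTE f0) sqrf_eq0 => /eqP; apply: no_common_root.
split.
  by rewrite /beta_of; field; rewrite t0 ea0.
have u0 : t * (e * t + a) ^+ 2 != 0 by rewrite mulf_neq0// expf_neq0.
apply: (mulfI u0); rewrite mulr0 -qt cubicE /beta_of; field.
by rewrite t0 ea0.
Qed.

End Elimination.

(** * Solving the line equations over the base field *)

(** The system has exactly three solutions, rational over the base field and
    separated by the pairs of valuations. *)
Definition solved_over (R : realType) (K : fieldType) (C : fieldType)
    (iota : {rmorphism K -> C}) (w : C -> \bar R) (a b c d e f g h : C) : Prop :=
  exists al be : 'I_3 -> C,
  [/\ forall k, in_base iota (al k) /\ in_base iota (be k),
      forall k, line_system a b c d e f g h (al k) (be k),
      forall k l, w (al k) = w (al l) -> w (be k) = w (be l) -> k = l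
    & forall x y, line_system a b c d e f g h x y ->
        exists k, x = al k /\ y = be k].

(** Exchanging (x, y) with (z, w) replaces al and be by their inverses. *)
Lemma solved_over_swap (R : realType) (K : fieldType) (C : fieldType)
    (iota : {rmorphism K -> C}) (w : C -> \bar R) (a b c d e f g h : C) :
  valuation w -> g != 0 -> h != 0 -> e != 0 -> f != 0 ->
  solved_over iota w c d a b g h e f -> solved_over iota w a b c d e f g h.
Proof.
move=> hw g0 h0 e0 f0 [al [be [ib sys inj all]]].
have swap (a' b' c' d' e' f' g' h' x y : C) : g' != 0 -> h' != 0 ->
    line_system a' b' c' d' e' f' g' h' x y ->
    line_system c' d' a' b' g' h' e' f' x^-1 y^-1.
  move=> g0' h0' s; have [x0 y0] := line_system_neq0 g0' h0' s.
  case: s => E1 E2; split.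
    have z : x ^+ 2 * y != 0 by rewrite mulf_neq0// expf_neq0.
    by apply: (mulfI z); rewrite mulr0 -E1; field; rewrite x0 y0.
  have z : x * y ^+ 2 != 0 by rewrite mulf_neq0// expf_neq0.
  by apply: (mulfI z); rewrite mulr0 -E2; field; rewrite x0 y0.
have valVE x y : x != 0 -> y != 0 -> w x^-1 = w y^-1 -> w x = w y.
  move=> x0 y0; have [r rE] := val_finE hw x0; have [s sE] := val_finE hw y0.
  by rewrite (valV hw rE) (valV hw sE) rE sE => -[/oppr_inj ->].
exists (fun k => (al k)^-1), (fun k => (be k)^-1); split.
- by move=> k; have [? ?] := ib k; split; exact: in_baseV.
- by move=> k; apply: swap.
- move=> k l H1 H2; have [a0 b0] := line_system_neq0 e0 f0 (sys k).
  have [a0' b0'] := line_system_neq0 e0 f0 (sys l).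
  by apply: inj; apply: valVE.
- move=> x y s; have [k [xk yk]] := all _ _ (swap _ _ _ _ _ _ _ _ _ _ g0 h0 s).
  by exists k; rewrite -xk -yk !invrK.
Qed.

Section Solve.
Variables (p : nat) (R : realType) (K : fieldType) (v : K -> \bar R).
Variables (C : closedFieldType) (iota : {rmorphism K -> C}) (w : C -> \bar R).
Hypothesis hv : is_padic_field p v.
Hypothesis hw : valuation w.
Hypothesis hwv : forall x : K, w (iota x) = v x.
Hypothesis w2 : w 2%:R = 0%E.
Let ib := in_base iota.

(** The inverses of the roots have a dominant one. *)
Lemma subdominant_root r1 r2 r3 :
  ib (r1 + r2 + r3) -> ib (r1 * r2 + r1 * r3 + r2 * r3) -> ib (r1 * r2 * r3) ->
  r1 != 0 -> r2 != 0 -> r3 != 0 ->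
  (w r2 < w r1)%E -> (w r3 < w r1)%E -> ib r1.
Proof.
move=> i1 i2 i3 r10 r20 r30.
have [x1 E1] := val_finE hw r10; have [x2 E2] := val_finE hw r20.
have [x3 E3] := val_finE hw r30.
rewrite E1 E2 E3 !lte_fin => L2 L3.
suff : ib r1^-1 by move=> /in_baseV; rewrite invrK.
apply: (dominant_root hv hw hwv (r2 := r2^-1) (r3 := r3^-1)).
- have -> : r1^-1 + r2^-1 + r3^-1 =
    (r1 * r2 + r1 * r3 + r2 * r3) / (r1 * r2 * r3).
    by field; rewrite r10 r20 r30.
  by apply: in_baseM => //; apply: in_baseV.
- have -> : r1^-1 * r2^-1 + r1^-1 * r3^-1 + r2^-1 * r3^-1 =
    (r1 + r2 + r3) / (r1 * r2 * r3).
    by field; rewrite r10 r20 r30.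
  by apply: in_baseM => //; apply: in_baseV.
- by rewrite -!invfM; apply: in_baseV.
- by rewrite (valV hw E1) (valV hw E2) lte_fin ltrN2.
- by rewrite (valV hw E1) (valV hw E3) lte_fin ltrN2.
Qed.

Section Coefficients.
Variables (a b c d e f g h : C) (va vb vc vd ve vf vg vh : R).
Hypotheses (Ea : w a = va%:E) (Eb : w b = vb%:E) (Ec : w c = vc%:E)
  (Ed : w d = vd%:E) (Ee : w e = ve%:E) (Ef : w f = vf%:E)
  (Eg : w g = vg%:E) (Eh : w h = vh%:E).
Hypotheses (ia : ib a) (ibb : ib b) (ic : ib c) (jd : ib d) (ie : ib e)
  (jf : ib f) (ig : ib g) (ih : ib h).
Variables (m3 m2 m1 m0 n : R).
Hypotheses (M3 : strict_min2 m3 (2 * ve + vh) (vb + vc + ve))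
  (M2 : strict_min5 m2 (2 * vc + vf) (va + vb + vc) (vc + vd + ve)
        (va + ve + vh) (vb + ve + vg))
  (M1 : strict_min5 m1 (2 * va + vh) (va + vc + vd) (va + vb + vg)
        (vc + vf + vg) (vd + ve + vg))
  (M0 : strict_min2 m0 (2 * vg + vf) (va + vd + vg))
  (N : strict_min2 n (ve + vg) (va + vc)).

Let wM x y (r s : R) : w x = r%:E -> w y = s%:E -> w (x * y) = (r + s)%:E.
Proof. by move=> xr ys; rewrite (valM hw) xr ys. Qed.
Let wN x (r : R) : w x = r%:E -> w (- x) = r%:E.
Proof. by rewrite (valN hw). Qed.
Let w3 x y z (r s t u : R) : w x = r%:E -> w y = s%:E -> w z = t%:E ->
  u = r + s + t -> w (x * y * z) = u%:E.
Proof. by move=> xr ys zt ->; do 2?apply: wM. Qed.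
Let wd x (r : R) : w x = r%:E -> w (2 * x) = r%:E.
Proof. by rewrite (valM hw) w2 add0e. Qed.

Lemma val_cubic3 : w (cubic3 b c e h) = m3%:E.
Proof. by apply: (val_sum2 hw _ _ M3); rewrite ?(valN hw); apply: w3; eauto; lra. Qed.
Lemma val_cubic2 : w (cubic2 a b c d e f g h) = m2%:E.
Proof.
by apply: (val_sum5 hw _ _ _ _ _ M2); rewrite ?(valN hw) ?(valM hw 2) ?w2 ?add0e;
  apply: w3; eauto; lra.
Qed.
Lemma val_cubic1 : w (cubic1 a b c d e f g h) = m1%:E.
Proof.
by apply: (val_sum5 hw _ _ _ _ _ M1); rewrite ?(valN hw) ?(valM hw 2) ?w2 ?add0e;
  apply: w3; eauto; lra.
Qed.
Lemma val_cubic0 : w (cubic0 a d f g) = m0%:E.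
Proof. by apply: (val_sum2 hw _ _ M0); rewrite ?(valN hw); apply: w3; eauto; lra. Qed.
Lemma val_minor : w (e * g + - (a * c)) = n%:E.
Proof. by apply: (val_sum2 hw _ _ N); rewrite ?(valN hw); apply: wM. Qed.

Lemma roots_of_cubic : exists r1 r2 r3, let q3 := cubic3 b c e h in
  [/\ forall t, cubic a b c d e f g h t = q3 * (t - r1) * (t - r2) * (t - r3),
    [/\ r1 + r2 + r3 = - (cubic2 a b c d e f g h / q3),
      r1 * r2 + r1 * r3 + r2 * r3 = cubic1 a b c d e f g h / q3
      & r1 * r2 * r3 = - (cubic0 a d f g / q3)],
    [/\ ib (r1 + r2 + r3), ib (r1 * r2 + r1 * r3 + r2 * r3)
      & ib (r1 * r2 * r3)],
    [/\ w (r1 + r2 + r3) = (m2 - m3)%:E,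
      w (r1 * r2 + r1 * r3 + r2 * r3) = (m1 - m3)%:E
      & w (r1 * r2 * r3) = (m0 - m3)%:E]
    & (w r3 <= w r2)%E /\ (w r2 <= w r1)%E].
Proof.
pose q3 := cubic3 b c e h.
have q30 : q3 != 0 by apply: val_fin_neq0 val_cubic3.
have [r1 [r2 [r3 [s1 s2 s3 sorted]]]] := cubic_sorted_roots w
  (- (cubic2 a b c d e f g h / q3)) (cubic1 a b c d e f g h / q3)
  (- (cubic0 a d f g / q3)).
have inat k : ib k%:R by exists k%:R; rewrite rmorph_nat.
have iN x : ib x -> ib (- x).
  by move=> ix; rewrite -[- x]add0r; apply: in_baseB => //; exact: (inat 0%N).
have i3 x y z : ib x -> ib y -> ib z -> ib (x * y * z).
  by move=> *; do 2?apply: in_baseM.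
have iq3 : ib q3 by apply: in_baseD; [exact: i3|apply: iN; exact: i3].
have iq0 : ib (cubic0 a d f g).
  by apply: in_baseD; [exact: i3|apply: iN; exact: i3].
have i5 x1 x2 x3 x4 x5 : ib x1 -> ib x2 -> ib x3 -> ib x4 -> ib x5 ->
    ib (x1 + - x2 + - x3 + 2 * x4 + - x5).
  move=> ? ? ? ? ?; do 4?apply: in_baseD => //; [exact: iN|exact: iN| |exact: iN].
  by apply: in_baseM => //; exact: (inat 2).
have iq2 : ib (cubic2 a b c d e f g h) by apply: i5; apply: i3.
have iq1 : ib (cubic1 a b c d e f g h) by apply: i5; apply: i3.
have iq x : ib x -> ib (x / q3).
  by move=> ix; apply: in_baseM => //; exact: in_baseV.
have wq x (r : R) : w x = r%:E -> w (x / q3) = (r - m3)%:E.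
  by move=> xr; rewrite (valM hw) xr (valV hw val_cubic3).
exists r1, r2, r3; split => //=.
- move=> t; rewrite /cubic -/q3.
  transitivity (q3 * (t ^+ 3 - (r1 + r2 + r3) * t ^+ 2
     + (r1 * r2 + r1 * r3 + r2 * r3) * t - r1 * r2 * r3)); last by ring.
  by rewrite s1 s2 s3; field.
- by rewrite s1 s2 s3; split; do ?apply: iN; apply: iq.
- rewrite s1 s2 s3 !(valN hw); split; apply: wq.
  + exact: val_cubic2.
  + exact: val_cubic1.
  + exact: val_cubic0.
Qed.

Lemma solved_of_roots r1 r2 r3 :
  (forall t, cubic a b c d e f g h t =
     cubic3 b c e h * (t - r1) * (t - r2) * (t - r3)) ->
  let bt := beta_of a c e g in
  [/\ ib r1, ib r2 & ib r3] -> [/\ ib (bt r1), ib (bt r2) & ib (bt r3)] ->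
  [/\ w r1 <> w r2, w r1 <> w r3 & w r2 <> w r3 \/ w (bt r2) <> w (bt r3)] ->
  solved_over iota w a b c d e f g h.
Proof.
move=> qE bt [i1 i2 i3] [j1 j2 j3] [d12 d13 d23].
have q30 : cubic3 b c e h != 0 by apply: val_fin_neq0 val_cubic3.
have q00 : cubic0 a d f g != 0 by apply: val_fin_neq0 val_cubic0.
have f0 : f != 0 by apply: val_fin_neq0 Ef.
have g0 : g != 0 by apply: val_fin_neq0 Eg.
have h0 : h != 0 by apply: val_fin_neq0 Eh.
have n0 : e * g + - (a * c) != 0 by apply: val_fin_neq0 val_minor.
pose al (k : 'I_3) := nth 0 [:: r1; r2; r3] k.
exists al, (fun k => bt (al k)); split.
- by case; do 3?[case => //].
- move=> k; apply: line_system_intro => //; rewrite qE /al.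
  by case: k; do 3?[case => //=]; move=> *; rewrite subrr !(mulr0, mul0r).
- move=> [k Hk] [l Hl] /= E1 E2; apply: val_inj => /=; move: E1 E2.
  case: k Hk => [|[|[|k]]]// Hk; case: l Hl => [|[|[|l]]]// Hl; rewrite /al /=;
    move=> E1 E2; by [case: d12|case: d13|case: d23 => H; case: H].
- move=> x y /(line_system_elim g0 h0 n0)[qx ->].
  move/eqP: qx; rewrite qE !mulf_eq0 (negbTE q30) /= !subr_eq0.
  move=> /orP[/orP[]|] /eqP ->; [exists 0|exists 1|exists 2]; split => //.
Qed.

Lemma in_base_beta t : ib t -> ib (beta_of a c e g t).
Proof.
move=> it; rewrite /beta_of -sub0r.
have i0 : ib 0 by exists 0; rewrite rmorph0.
apply: in_baseM; last apply: in_baseV.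
  by apply: in_baseB => //; apply: in_baseD => //; apply: in_baseM.
by apply: in_baseM => //; apply: in_baseD => //; apply: in_baseM.
Qed.

Lemma solved_simple : 2 * m2 < m3 + m1 -> 2 * m1 < m2 + m0 ->
  solved_over iota w a b c d e f g h.
Proof.
move=> L2 L1.
have [r1 [r2 [r3 [qE _ [i1 i2 i3] [w1 w2' w3'] [s32 s21]]]]] := roots_of_cubic.
have [||W1 W2 W3] := cubic_slopes hw w1 w2' w3' s32 s21; try lra.
have r10 : r1 != 0 by apply: val_fin_neq0 W1.
have r20 : r2 != 0 by apply: val_fin_neq0 W2.
have r30 : r3 != 0 by apply: val_fin_neq0 W3.
have j1 : ib r1.
  by apply: (subdominant_root i1 i2 i3) => //; rewrite W1 ?W2 ?W3 lte_fin; lra.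
have j3 : ib r3.
  apply: (dominant_root hv hw hwv (r2 := r2) (r3 := r1)).
  - by have -> : r3 + r2 + r1 = r1 + r2 + r3 by ring.
  - by have -> : r3 * r2 + r3 * r1 + r2 * r1 = r1 * r2 + r1 * r3 + r2 * r3 by ring.
  - by have -> : r3 * r2 * r1 = r1 * r2 * r3 by ring.
  - by rewrite W2 W3 lte_fin; lra.
  - by rewrite W1 W3 lte_fin; lra.
have j2 : ib r2.
  have -> : r2 = r1 + r2 + r3 - r1 - r3 by ring.
  by do 2?apply: in_baseB.
apply: (solved_of_roots qE) => //; first by split; exact: in_base_beta.
rewrite W1 W2 W3; split; [| |left]; move=> [] H; suff : (0 : R) < 0 by rewrite ltxx.
all: lra.
Qed.

(** A quadratic polynomial is a cubic one with an additional root 0, which has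
    infinite valuation. *)
Lemma conjugate_pair x y : x != 0 -> y != 0 -> ib (x + y) -> ib (x * y) ->
  w x <> w y -> ib x /\ ib y.
Proof.
have aux z t : z != 0 -> ib (z + t) -> ib (z * t) -> (w z < w t)%E -> ib z.
  move=> z0 iD iM lt.
  apply: (dominant_root hv hw hwv (r2 := t) (r3 := 0)) => //.
  - by rewrite addr0.
  - by rewrite !mulr0 !addr0.
  - by rewrite mulr0; exists 0; rewrite rmorph0.
  - by rewrite (val0 hw) (lt_le_trans lt)// leey.
move=> x0 y0 iD iM; have [lt _|lt _|//] := ltgtP (w x) (w y).
  have ix := aux x y x0 iD iM lt; split => //.
  have -> : y = x + y - x by ring.
  exact: (in_baseB iD ix).
have iy : ib y by apply: (aux y x) => //; rewrite 1?addrC// mulrC.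
split => //; have -> : x = x + y - y by ring.
exact: (in_baseB iD iy).
Qed.

(** The second equation is linear in al. *)
Lemma in_base_alpha al be : f * h + - (b * d) != 0 -> f != 0 -> be != 0 ->
  line_system a b c d e f g h al be -> ib be -> ib al.
Proof.
move=> n0 f0 be_neq0 [_ E2] ib_be.
have fb0 : be * (f * be + b) != 0.
  rewrite mulf_neq0//; apply/eqP => z; move/negP: n0; apply; apply/eqP.
  have dh : d * be + h = 0.
    have -> : d * be + h = (f * al * be ^+ 2 + b * al * be + d * be + h)
       - al * be * (f * be + b) by ring.
    by rewrite E2 z mulr0 subr0.
  have -> : f * h + - (b * d) = f * (d * be + h) - d * (f * be + b) by ring.
  by rewrite dh z !mulr0 subr0.
have -> : al = (0 - (d * be + h)) / (be * (f * be + b)).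
  apply: (mulIf fb0); rewrite divfK//; apply/eqP.
  rewrite -subr_eq0; apply/eqP; rewrite -[RHS]E2; ring.
have i0 : ib 0 by exists 0; rewrite rmorph0.
apply: in_baseM; last apply: in_baseV.
  by apply: in_baseB => //; apply: in_baseD => //; apply: in_baseM.
by apply: in_baseM => //; apply: in_baseD => //; apply: in_baseM.
Qed.

(** Here r1 has a larger valuation than r2 and r3, which share the valuation
    t = va - ve.  By [quadratic_slopes] applied to the second equation, be at r2
    and at r3 can only have two valuations.  The sum of the valuations of these two be is
    known, because the
    product of the values of be at all roots can be computed from the values of
    the cubic at - g / c and - a / e; it is the sum of the two possibilities,
    which therefore both occur.  So the two be are separated and rational, and
    they determine r2 and r3. *)
Lemma solved_double n' : m3 = 2 * ve + vh -> m2 = va + ve + vh ->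
  double_slope va vb vc vd ve vf vg vh m1 m0 ->
  strict_min2 n' (vf + vh) (vb + vd) ->
  solved_over iota w a b c d e f g h.
Proof.
move=> m3E m2E [m1E L1 cfg acd [mm [mmP Lm]]] N'.
have [r1 [r2 [r3 [qE _ [i1 i2 i3] [w1 w2' w3'] [s32 s21]]]]] := roots_of_cubic.
have [||W1 W2 W3] := cubic_slopes hw w1 w2' w3' s32 s21; try lra.
pose t := va - ve.
have {}W2 : w r2 = t%:E by rewrite W2 /t; congr (_%:E); lra.
have {}W3 : w r3 = t%:E by rewrite W3 /t; congr (_%:E); lra.
have r10 : r1 != 0 by apply: val_fin_neq0 W1.
have r20 : r2 != 0 by apply: val_fin_neq0 W2.
have r30 : r3 != 0 by apply: val_fin_neq0 W3.
have c0 : c != 0 by apply: val_fin_neq0 Ec.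
have e0 : e != 0 by apply: val_fin_neq0 Ee.
have f0 : f != 0 by apply: val_fin_neq0 Ef.
have g0 : g != 0 by apply: val_fin_neq0 Eg.
have h0 : h != 0 by apply: val_fin_neq0 Eh.
have n0 : e * g + - (a * c) != 0 by apply: val_fin_neq0 val_minor.
have n'0 : f * h + - (b * d) != 0.
  apply: (val_fin_neq0 (w := w) hw (r := n')); apply: (val_sum2 hw _ _ N').
    exact: wM.
  by rewrite (valN hw); apply: wM.
have q00 : cubic0 a d f g != 0 by apply: val_fin_neq0 val_cubic0.
have q30 : cubic3 b c e h != 0 by apply: val_fin_neq0 val_cubic3.
have j1 : ib r1.
  apply: (subdominant_root i1 i2 i3) => //; rewrite W1 ?W2 ?W3 lte_fin /t; lra.
have wc1 : w (c * r1 + g) = vg%:E.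
  rewrite (val_addr_dom hw)// (wM Ec W1) Eg lte_fin.
  by case: M0 => -[-> _]; lra.
have we1 : w (e * r1 + a) = va%:E.
  by rewrite (val_addr_dom hw)// (wM Ee W1) Ea lte_fin; lra.
pose bt := beta_of a c e g.
have sys x : cubic a b c d e f g h x = 0 ->
  line_system a b c d e f g h x (bt x) by move=> ?; apply: line_system_intro.
have sys2 : line_system a b c d e f g h r2 (bt r2).
  by apply: sys; rewrite qE subrr mulr0 mul0r.
have sys3 : line_system a b c d e f g h r3 (bt r3).
  by apply: sys; rewrite qE subrr mulr0.
have [ea2 cg2] := system_denom_neq0 g0 h0 n0 sys2.
have [ea3 cg3] := system_denom_neq0 g0 h0 n0 sys3.
have [_ b20] := line_system_neq0 g0 h0 sys2.
have [_ b30] := line_system_neq0 g0 h0 sys3.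
have bE : bt r2 * bt r3 =
    ((c * r2 + g) * (c * r3 + g)) / (r2 * r3 * ((e * r2 + a) * (e * r3 + a))).
  by rewrite /bt /beta_of; field; rewrite r20 r30 ea2 ea3.
have wn : w ((e * g + - (a * c)) ^+ 2) = (n + n)%:E.
  by rewrite expr2; apply: wM; exact: val_minor.
have [x xE] : exists x, w ((c * r2 + g) * (c * r3 + g)) = x%:E.
  by apply: val_finE; rewrite ?mulf_neq0.
have [y yE] : exists y, w ((e * r2 + a) * (e * r3 + a)) = y%:E.
  by apply: val_finE; rewrite ?mulf_neq0.
(* The product of the c r + g over the three roots is a value of the cubic, at
   which only the last term of [cubicE] survives; for e r + a below, the first. *)
have xV : x = vh + (n + n) - m3.
  have E : cubic3 b c e h * ((c * r1 + g) * ((c * r2 + g) * (c * r3 + g))) =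
      h * g * (e * g + - (a * c)) ^+ 2.
    transitivity (- c ^+ 3 * cubic a b c d e f g h (- g / c)).
      by rewrite qE; field.
    by rewrite cubicE; field.
  have := wM (wM Eh Eg) wn; rewrite -E.
  by rewrite (wM val_cubic3 (wM wc1 xE)) => -[] H; lra.
have yV : y = ve + vf + (n + n) - m3 - va.
  have E : cubic3 b c e h * ((e * r1 + a) * ((e * r2 + a) * (e * r3 + a))) =
      - (e * f * (e * g + - (a * c)) ^+ 2).
    transitivity (- e ^+ 3 * cubic a b c d e f g h (- a / e)).
      by rewrite qE; field.
    by rewrite cubicE; field.
  have := wM (wM Ee Ef) wn; rewrite -(valN hw) -E.
  by rewrite (wM val_cubic3 (wM we1 yE)) => -[] H; lra.
have [y2 y2E] := val_finE hw b20; have [y3 y3E] := val_finE hw b30.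
have ySum : y2 + y3 = vh - vf - t.
  have := wM y2E y3E; rewrite bE (valM hw) xE (valV hw (wM (wM W2 W3) yE)).
  by rewrite -EFinD => -[] H; rewrite /t in H *; lra.
(* Both possible valuations come from the second equation, seen as a quadratic
   equation in be. *)
have slope r z : w r = t%:E -> bt r != 0 -> w (bt r) = z%:E ->
    line_system a b c d e f g h r (bt r) ->
    z = vh - (mm - ve) \/ z = (mm - ve) - (vf + t).
  move=> rt b0 zE [_ E2].
  have E2' : f * r * bt r ^+ 2 + (b * r + d) * bt r + h = 0 by rewrite -E2; ring.
  have wB : w (b * r + d) = (mm - ve)%:E.
    apply: (val_sum2 hw (wM Eb rt) Ed).
    rewrite /t; case: mmP => -[-> lt]; [left|right]; split; try ring;
      by rewrite addrA ?ltrBlDr ?ltrBrDr (addrC vb).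
  have [||] := quadratic_slopes hw b0 E2' (wM Ef rt) wB Eh.
  - by rewrite /t; lra.
  - by rewrite zE => -[->]; left.
  - by rewrite zE => -[->]; right.
have y23 : y2 <> y3.
  move=> E; rewrite -E in y3E ySum.
  suff : (0 : R) < 0 by rewrite ltxx.
  by move: ySum; rewrite /t => ySum;
     case: (slope _ _ W2 b20 y2E sys2); rewrite /t => Hs; lra.
(* S and P are rational, and be r2 and be r3 are conjugate over them. *)
have [S SE iS] : exists2 S, r2 + r3 = S & ib S.
  by exists (r1 + r2 + r3 - r1); [ring|exact: in_baseB].
have [P PE iP] : exists2 P, r2 * r3 = P & ib P.
  exists (r1 * r2 * r3 / r1); first by field.
  by apply: in_baseM => //; apply: in_baseV.
have inat k : ib k%:R by exists k%:R; rewrite rmorph_nat.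
have iden : ib (P * (e * e * P + a * e * S + a * a)).
  by do ?[apply: in_baseD|apply: in_baseM].
have denE : r2 * r3 * ((e * r2 + a) * (e * r3 + a)) =
    P * (e * e * P + a * e * S + a * a) by rewrite -SE -PE; ring.
have ibM : ib (bt r2 * bt r3).
  rewrite bE denE; apply: in_baseM; last exact: in_baseV.
  have -> : (c * r2 + g) * (c * r3 + g) = c * c * P + c * g * S + g * g.
    by rewrite -SE -PE; ring.
  by do ?[apply: in_baseD|apply: in_baseM].
have ibD : ib (bt r2 + bt r3).
  have -> : bt r2 + bt r3 = (0 - (c * e * P * S + 2 * (a * c * P)
      + g * e * (S * S - 2 * P) + g * a * S))
      / (P * (e * e * P + a * e * S + a * a)).
    rewrite -denE -SE -PE /bt /beta_of; field; by rewrite r20 r30 ea2 ea3.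
  apply: in_baseM; last exact: in_baseV.
  by do ?[apply: in_baseB|apply: in_baseD|apply: in_baseM] => //;
    first [exact: (inat 0%N)|exact: (inat 1%N)|exact: (inat 2%N)].
have [ib2 ib3] : ib (bt r2) /\ ib (bt r3).
  by apply: conjugate_pair => //; rewrite y2E y3E => -[].
apply: (solved_of_roots qE).
- by split => //; [apply: (in_base_alpha n'0 f0 b20 sys2)
                  |apply: (in_base_alpha n'0 f0 b30 sys3)].
- by split => //; exact: in_base_beta.
- split; last by right; rewrite y2E y3E => -[].
    rewrite W1 W2 => -[] H; suff : (0 : R) < 0 by rewrite ltxx.
    by rewrite /t in H; lra.
  rewrite W1 W3 => -[] H; suff : (0 : R) < 0 by rewrite ltxx.
  by rewrite /t in H; lra.
Qed.

End Coefficients.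

Lemma solved_of_generic (a b c d e f g h : C) (va vb vc vd ve vf vg vh : R) :
  w a = va%:E -> w b = vb%:E -> w c = vc%:E -> w d = vd%:E ->
  w e = ve%:E -> w f = vf%:E -> w g = vg%:E -> w h = vh%:E ->
  ib a -> ib b -> ib c -> ib d -> ib e -> ib f -> ib g -> ib h ->
  fiberwise_generic va vb vc vd ve vf vg vh ->
  solved_over iota w a b c d e f g h.
Proof.
move=> Ea Eb Ec Ed Ee Ef Eg Eh ia ibb ic jd ie jf ig ih G.
have [m3 [m2 [m1 [m0 [M3 M2 M1 M0 slopes]]]]] := newton_slopes G.
have [n N] := fiber_eg G.
have [n' N'] := fiber_eg (generic_swap_zw (generic_swap_xy G)).
case: slopes => [[L2 L1]|[m3E m2E ds]|[m0E m1E ds]].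
- exact: (solved_simple Ea Eb Ec Ed Ee Ef Eg Eh ia ibb ic jd ie jf ig ih
    M3 M2 M1 M0 N L2 L1).
- exact: (solved_double Ea Eb Ec Ed Ee Ef Eg Eh ia ibb ic jd ie jf ig ih
    M3 M2 M1 M0 N m3E m2E ds N').
- have nz x (r : R) : w x = r%:E -> x != 0 by move=> xr; apply: val_fin_neq0 xr.
  apply: solved_over_swap; [exact: hw|exact: nz Eg|exact: nz Eh|exact: nz Ee
    |exact: nz Ef|].
  have [k Kk] : exists k, strict_min2 k (vg + ve) (vc + va).
    by exists n; case: N => -[-> ?]; [left|right]; split; lra.
  have [k' Kk'] : exists k, strict_min2 k (vh + vf) (vd + vb).
    by exists n'; case: N' => -[-> ?]; [left|right]; split; lra.
  apply: (solved_double (m3 := m0) (m2 := m1) (m1 := m2) (m0 := m3)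
    Ec Ed Ea Eb Eg Eh Ee Ef ic jd ia ibb ig ih ie jf _ _ _ _ Kk _ _ ds Kk').
  + by case: M0 => -[-> ?]; [left|right]; split; lra.
  + by apply: (strict_min5_eq M1); ring.
  + by apply: (strict_min5_eq M2); ring.
  + by case: M3 => -[-> ?]; [left|right]; split; lra.
  + by [].
  + by rewrite m1E; lra.
Qed.

End Solve.

(** * Tropical hyperplanes are closed *)

Section Tropical.
Local Open Scope classical_set_scope.
Variables (R : realType).

Lemma tcone_coord_continuous (j : 'I_4) :
  continuous (fun x : tcone R => val x ord0 j).
Proof.
move=> x A /= Anb.
have valc : continuous (val : tcone R -> 'rV[\bar R]_4).
  exact: initial_continuous.
apply: (valc x [set y | A (y ord0 j)]).
exists (fun i k => if k == j then A else setT).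
  move=> i k; case: eqP => [->|_]; last exact: filterT.
  by rewrite (ord1 i).
by move=> y /= /(_ ord0 j); rewrite eqxx.
Qed.

(** The tropical points at which the term j of the form with valuations c is the
    only smallest one. *)
Definition least_at (c : 'I_4 -> \bar R) (j : 'I_4) : set (tcone R) :=
  [set x : tcone R | forall k, k != j ->
     (c j + val x ord0 j < c k + val x ord0 k)%E].

(** Separating c j + x_j from c k + x_k by a real q reduces to the openness of rays
    in each coordinate. *)
Lemma open_least_at (c : 'I_4 -> \bar R) (j : 'I_4) (r : R) :
  c j = r%:E -> (forall k, c k != -oo%E) -> open (least_at c j).
Proof.
move=> cj cN; rewrite openE => x xD.
have F := nbhs_filter x.
apply: (@filter_forall _ _ (fun k => [set x : tcone R | k != j ->
  (c j + val x ord0 j < c k + val x ord0 k)%E]) _ F) => k.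
have [->|kj] := eqVneq k j; first by apply: filterE.
have := xD k kj; rewrite cj; have := cN k.
have coord i := @tcone_coord_continuous i x.
have [q] : exists q : R, (r%:E + val x ord0 j < q%:E < c k + val x ord0 k)%E.
  have := xD k kj; rewrite cj; case: (_ + _)%E (_ + _)%E => [s||] [t||] //=.
  - rewrite lte_fin => st; exists ((s + t) / 2); rewrite !lte_fin; lra.
  - by exists (s - 1); rewrite lte_fin ltNyr; lra.
  - by exists (t + 1); rewrite lte_fin ltry; lra.
  - by exists 0; rewrite ltry ltNyr.
move=> /andP[qj qk] ckN _.
have nj : nbhs x [set y : tcone R | (val y ord0 j < (q - r)%:E)%E].
  apply: (coord j [set z | (z < (q - r)%:E)%E]).
  apply: open_nbhs_nbhs; split; first exact: open_ereal_lt_ereal.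
  by move: qj => /=; case: (val x ord0 j) => [s||]//=;
    rewrite ?ltNyr// -EFinD !lte_fin; lra.
case: (c k) ckN qk => [ck||]// _ qk.
  have nk : nbhs x [set y : tcone R | ((q - ck)%:E < val y ord0 k)%E].
    apply: (coord k [set z | ((q - ck)%:E < z)%E]).
    apply: open_nbhs_nbhs; split; first exact: open_ereal_gt_ereal.
    by move: qk => /=; case: (val x ord0 k) => [s||]//=;
      rewrite ?ltry// -EFinD !lte_fin; lra.
  apply: filterS2 nj nk => y.
  rewrite /=; case: (val y ord0 j) => [s||]//; case: (val y ord0 k) => [t||]//.
  - by rewrite -!EFinD !lte_fin => *; lra.
  - by move=> _ _ _; rewrite /= ltry.
  - by move=> _ _ _; rewrite /= ltNyr.
apply: filterS nj => y yj _.
have : val y ord0 k != -oo%E by have := valP y; rewrite inE => -[].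
move: yj => /=; case: (val y ord0 j) => [s||]//; case: (val y ord0 k) => [t||]//;
  by move=> _ _; rewrite /= ?ltry ?ltNyr.
Qed.

(** If the term j were the only smallest one at the point of u, the same would
    hold near this point, in particular at a point of L1, whose coordinates
    would then have a nonzero combination. *)
Lemma tropical_vanishing (C : fieldType) (w : C -> \bar R) (hw : valuation w)
    (L1 L2 : {vspace 'rV[C]_4}) (c : 'I_4 -> C) :
  tropicalization w L1 = tropicalization w L2 ->
  (forall u, u \in L1 -> \sum_j c j * u 0 j = 0) ->
  forall u j, u \in L2 -> c j * u ord0 j != 0 ->
  exists2 k, k != j & (w (c k * u ord0 k)%R <= w (c j * u ord0 j)%R)%E.
Proof.
move=> tropE L1c u j uL2 cuj; apply: contrapT => H.
have cj0 : c j != 0 by apply: contraNneq cuj => ->; rewrite mul0r.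
have uj0 : u 0 j != 0 by apply: contraNneq cuj => ->; rewrite mulr0.
have [r rE] := val_finE hw cj0.
pose D := least_at (fun k => w (c k)) j.
have oD : open D by apply: open_least_at rE _ => k; exact: val_neqNy.
have DP (u' : 'rV[C]_4) (x : tcone R) : val x = map_mx w u' ->
    D x <-> forall k, k != j -> (w (c j * u' 0%R j)%R < w (c k * u' 0%R k)%R)%E.
  by move=> xE; split => P i ij; have := P i ij; rewrite /= xE !mxE !(valM hw).
have Dsat (x y : tcone R) : \pi_(TP3 R)%qT x = \pi_(TP3 R)%qT y -> D x -> D y.
  move=> /eqmodP /asboolP [s sE] xD k kj; have := xD k kj.
  rewrite !sE !addeA; case: (_ + _)%E (_ + _)%E => [a||] [b||] //=;
    by rewrite -?EFinD ?lte_fin ?ltrD2r ?ltry ?ltNyr.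
have uT : tcone_set (map_mx w u).
  split; first by move=> k; rewrite mxE val_neqNy.
  by exists j; rewrite mxE val_eqy.
pose x : tcone R := SigSub (mem_set uT).
have xE : val x = map_mx w u by [].
have Dx : D x.
  apply/(DP _ _ xE) => k kj; rewrite ltNge; apply/negP => le.
  by apply: H; exists k.
pose t := \pi_(TP3 R)%qT x.
have : tropicalization w L1 t.
  rewrite tropE; apply: subset_closure; exists u, x; split => //.
  by apply: contraNneq uj0 => ->; rewrite mxE.
(* The condition is invariant under scaling, so it descends to an open set. *)
pose U := [set t : TP3 R | exists2 y, D y & t = \pi_(TP3 R)%qT y].
have oU : open U.
  rewrite /open /= /quotient_open.
  suff -> : \pi_(TP3 R)%qT @^-1` U = D by [].
  apply/seteqP; split => y /=; first by move=> [z Dz /esym/Dsat]; apply.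
  by move=> Dy; exists y.
move=> /(_ U) [].
  by apply: open_nbhs_nbhs; split => //; exists x.
move=> _ [[u' [x' [u'L1 u'0 x'E ->]]] [y Dy /esym xy]].
have /(DP _ _ x'E) min := Dsat _ _ xy Dy.
have := L1c _ u'L1; rewrite (bigD1 j)//= => sum0.
have fin : w (c j * u' 0 j) != +oo%E.
  have [k kj] : exists k : 'I_4, k != j.
    by case: (eqVneq j ord0) => [->|]; [exists ord_max|exists ord0; rewrite eq_sym].
  by have := min _ kj; case: (w (c j * _)) => //; rewrite ltNge leey.
have [s sE] := val_finE hw (contra_neq (fun E => etrans (congr1 w E) (val0 hw)) fin).
have : w (c j * u' 0 j + \sum_(i | i != j) c i * u' 0 i) = s%:E.
  rewrite (val_addl_dom hw)// sE.
  elim/big_ind : _ => [|a b Ha Hb|k kj]; first by rewrite (val0 hw) ltry.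
    exact: (val_gt_add hw).
  by rewrite -sE min.
by rewrite sum0 (val0 hw).
Qed.
End Tropical.

(** * Classification of the lines *)

Section BinaryForms.
Variable C : closedFieldType.

(** Otherwise P + 1 would be a nonconstant polynomial without root. *)
Lemma poly_eq0_of_roots (P : {poly C}) : (forall x, P.[x] = 0) -> P = 0.
Proof.
move=> P0; have : ~~ (size (P + 1) != 1).
  apply/negP => /closed_rootP[x]; rewrite rootE hornerD P0 hornerC add0r.
  by rewrite oner_eq0.
rewrite negbK => /size_poly1P[c _ Pc].
have PE : P = (c - 1)%:P by rewrite polyCB -Pc addrK.
by have := P0 0; rewrite PE hornerC => ->.
Qed.

(** A pair stands for the linear form with these coefficients on the plane that
    parametrizes a line. *)
Definition ev (p : C * C) (s t : C) : C := p.1 * s + p.2 * t.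

(** A notion of polynomial function of two variables just strong enough to cancel
    linear factors. *)
Definition polynomial_on_lines (G : C -> C -> C) : Prop :=
  forall s t s1 t1, exists P : {poly C},
    forall x, P.[x] = G (s + x * s1) (t + x * t1).

Lemma polynomial_ev p : polynomial_on_lines (ev p).
Proof.
move=> s t s1 t1; exists ((ev p s t)%:P + (ev p s1 t1) *: 'X) => x.
by rewrite hornerD hornerC hornerZ hornerX /ev; ring.
Qed.

Lemma polynomialD G H : polynomial_on_lines G -> polynomial_on_lines H ->
  polynomial_on_lines (fun s t => G s t + H s t).
Proof.
move=> GP HP s t s1 t1; have [P PE] := GP s t s1 t1.
have [Q QE] := HP s t s1 t1.
by exists (P + Q) => x; rewrite hornerD PE QE.
Qed.

Lemma polynomialM G H : polynomial_on_lines G -> polynomial_on_lines H ->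
  polynomial_on_lines (fun s t => G s t * H s t).
Proof.
move=> GP HP s t s1 t1; have [P PE] := GP s t s1 t1.
have [Q QE] := HP s t s1 t1.
by exists (P * Q) => x; rewrite hornerM PE QE.
Qed.

Lemma polynomialC k : polynomial_on_lines (fun _ _ => k).
Proof. by move=> s t s1 t1; exists k%:P => x; rewrite hornerC. Qed.

Lemma ev0 p : p != 0 -> exists s t, ev p s t != 0.
Proof.
move=> p0; have [p1|p1] := eqVneq p.1 0.
  have [p2|p2] := eqVneq p.2 0; last by exists 0, 1; rewrite /ev p1 mulr1 mul0r add0r.
  by case/eqP: p0; case: p p1 p2 => ? ? /= -> ->.
by exists 1, 0; rewrite /ev mulr1 mulr0 addr0.
Qed.

Lemma ev_cancel p G : p != 0 -> polynomial_on_lines G ->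
  (forall s t, ev p s t * G s t = 0) -> forall s t, G s t = 0.
Proof.
move=> /ev0[s1 [t1 p1]] GP pG s t.
have [P PE] := GP s t s1 t1; have [Q QE] := polynomial_ev p s t s1 t1.
have : Q * P = 0.
  by apply: poly_eq0_of_roots => x; rewrite hornerM PE QE pG.
move=> /eqP; rewrite mulf_eq0 => /orP[/eqP Q0|/eqP P0].
  case/negP: p1; have := QE 1; have := QE 0.
  rewrite Q0 !horner0 !mul0r !addr0 !mul1r => E0 E1.
  have -> : ev p s1 t1 = ev p (s + s1) (t + t1) - ev p s t by rewrite /ev; ring.
  by rewrite -E0 -E1 subr0.
by have := PE 0; rewrite P0 horner0 !mul0r !addr0.
Qed.

Lemma ev_eq0 p : (forall s t, ev p s t = 0) -> p = 0.
Proof.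
by move=> p0; apply/eqP/negPn/negP => /ev0[s [t]]; rewrite p0 eqxx.
Qed.

Lemma ev_prod3 p q r : (forall s t, ev p s t * ev q s t * ev r s t = 0) ->
  [\/ p = 0, q = 0 | r = 0].
Proof.
move=> pqr; have [->|p0] := eqVneq p 0; first by constructor 1.
have [->|q0] := eqVneq q 0; first by constructor 2.
constructor 3; apply: ev_eq0; apply: (ev_cancel q0); first exact: polynomial_ev.
apply: (ev_cancel p0); first by apply: polynomialM; exact: polynomial_ev.
by move=> s t; rewrite mulrA.
Qed.

Lemma ev_proportional p q : p != 0 -> q != 0 -> ev q p.2 (- p.1) = 0 ->
  exists2 k, k != 0 & forall s t, ev p s t = k * ev q s t.
Proof.
case: p q => [p1 p2] [q1 q2]; rewrite /ev /= => p0 q0 E.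
have {}E : q1 * p2 = q2 * p1 by apply/eqP; rewrite -subr_eq0 -mulrN E.
have [q10|q10] := eqVneq q1 0.
  have q20 : q2 != 0 by apply: contraNneq q0 => ->; rewrite q10.
  have p10 : p1 = 0.
    by move/eqP: E; rewrite q10 mul0r eq_sym mulf_eq0 (negbTE q20) => /eqP.
  exists (p2 / q2); last by move=> s t; rewrite q10 p10; field.
  rewrite mulf_neq0 ?invr_eq0//; apply: contraNneq p0 => ->; rewrite p10//.
exists (p1 / q1).
  rewrite mulf_neq0 ?invr_eq0//; apply: contraNneq p0 => p10.
  move/eqP: E; rewrite p10 mulr0 mulf_eq0 (negbTE q10) /= => /eqP ->//.
move=> s t; have -> : p2 = q2 * p1 / q1 by rewrite -E; field.
by field.
Qed.

Lemma ev_surjective p q :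
  (forall s t, ev p s t = 0 -> ev q s t = 0 -> s = 0 /\ t = 0) ->
  forall u v, exists s t, ev p s t = u /\ ev q s t = v.
Proof.
case: p q => [p1 p2] [q1 q2]; rewrite /ev /= => inj u v.
have D : p1 * q2 - p2 * q1 != 0.
  apply/eqP => D.
  have [||q20 p20] := inj q2 (- q1); [by rewrite -D; ring|by ring|].
  have [||p20' p10] := inj p2 (- p1); [by ring|by rewrite -[RHS]oppr0 -D; ring|].
  have [||/eqP] := inj 1 0; last by rewrite oner_eq0.
    by rewrite p20'; move/eqP: p10; rewrite oppr_eq0 => /eqP ->; ring.
  by rewrite q20; move/eqP: p20; rewrite oppr_eq0 => /eqP ->; ring.
exists ((u * q2 - p2 * v) / (p1 * q2 - p2 * q1)),
  ((p1 * v - u * q1) / (p1 * q2 - p2 * q1)).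
by split; field.
Qed.

Section LinesOnOctanomial.
Variables (x y z w : C * C).
Hypothesis inj : forall s t, ev x s t = 0 -> ev y s t = 0 -> ev z s t = 0 ->
  ev w s t = 0 -> s = 0 /\ t = 0.

(** Once z and w are independent on the line, the equation is evaluated at
    (z, w) = (1, 0) and (0, 1). *)
Lemma transversal_system (a b c d e f g h al be : C) :
  (forall s t, ev x s t = al * ev z s t) ->
  (forall s t, ev y s t = be * ev w s t) ->
  (forall s t, al * be * (e * ev x s t + f * ev y s t + a * ev z s t + b * ev w s t)
    + (c * ev x s t + d * ev y s t + g * ev z s t + h * ev w s t) = 0) ->
  line_system a b c d e f g h al be.
Proof.
move=> Hx Hy HAB.
have zw : forall u v, exists s t, ev z s t = u /\ ev w s t = v.
  apply: ev_surjective => s t z0 w0.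
  by apply: inj => //; rewrite ?Hx ?Hy ?z0 ?w0 mulr0.
split.
  have [s [t [Z W]]] := zw 1 0; have := HAB s t.
  by rewrite Hx Hy Z W => <-; ring.
have [s [t [Z W]]] := zw 0 1; have := HAB s t.
by rewrite Hx Hy Z W => <-; ring.
Qed.

(** Here y and z are independent on the line, and the two equations are
    evaluated at (y, z) = (1, 0) and (0, 1).  The value be is the slope y / w of
    the transversal in the plane x = al z: it is determined by the equation
    al be f y = h w + (c al + g) z of the residual line. *)
Lemma residual_system (a b c d e f g h al ga : C) :
  f != 0 -> h != 0 -> al != 0 -> ga != 0 ->
  (forall s t, ev x s t = al * ev z s t) ->
  (forall s t, ev y s t =
     ga * (c * ev x s t + d * ev y s t + g * ev z s t + h * ev w s t)) ->
  (forall s t,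
     al * ga * (e * ev x s t + f * ev y s t + a * ev z s t + b * ev w s t)
     + ev w s t = 0) ->
  exists be, line_system a b c d e f g h al be /\
    forall s t, al * be * f * ev y s t =
                h * ev w s t + (c * al + g) * ev z s t.
Proof.
move=> f0 h0 al_neq0 ga0 Hx Hy Hw.
have gI : ga * ga^-1 = 1 by rewrite divff.
have yz : forall u v, exists s t, ev y s t = u /\ ev z s t = v.
  apply: ev_surjective => s t y0 z0.
  have x0 : ev x s t = 0 by rewrite Hx z0 mulr0.
  apply: inj => //; apply/eqP; have := Hy s t.
  rewrite x0 y0 z0 !mulr0 !add0r => /esym/eqP.
  by rewrite !mulf_eq0 (negbTE ga0) (negbTE h0).
have [s1 [t1 [Y1 Z1]]] := yz 1 0; have [s2 [t2 [Y2 Z2]]] := yz 0 1.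
have := Hw s1 t1; have := Hy s1 t1; have := Hw s2 t2; have := Hy s2 t2.
rewrite !Hx Y1 Z1 Y2 Z2; set W1 := ev w s1 t1; set W2 := ev w s2 t2.
move=> P2y P2w P1y P1w.
have hW1 : h * W1 = ga^-1 - d.
  apply: (mulfI ga0); rewrite mulrBr gI.
  by rewrite [X in _ = X - _]P1y; ring.
have hW2 : h * W2 = - (c * al + g).
  apply: (mulfI ga0); apply/eqP; rewrite -subr_eq0 [X in _ == X]P2y.
  by apply/eqP; ring.
exists (h * W1 / (al * f)); split; last first.
  move=> s t; have -> : al * (h * W1 / (al * f)) * f = h * W1.
    by field; rewrite al_neq0 f0.
  apply: (mulfI ga0); rewrite hW1 mulrA mulrBr gI mulrBl mul1r.
  by rewrite [X in X - _]Hy Hx; ring.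
set be := h * W1 / (al * f).
have beE : al * f * be = h * W1 by rewrite /be mulrC divfK ?mulf_neq0.
have nz : ga * al * f != 0 by rewrite !mulf_neq0.
split; apply: (mulfI nz); rewrite mulr0.
  transitivity (ga * al * ((al * f * be) * (e * al + a) + f * (c * al + g))).
    by ring.
  have -> : c * al + g = - (h * W2) by rewrite hW2 opprK.
  rewrite beE; transitivity (h * (W1 * (al * ga *
    (e * (al * 1) + f * 0 + a * 1 + b * W2) + W2) - W2 * (al * ga *
    (e * (al * 0) + f * 1 + a * 0 + b * W1) + W1))); first by ring.
  by rewrite P2w P1w !mulr0 subr0 mulr0.
transitivity (ga * ((al * f * be) * (al * f * be + d + b * al) + al * f * h)).
  by ring.
rewrite beE [in X in _ * (_ * X + _)]hW1 subrK.
transitivity (h * (al * ga * (e * (al * 0) + f * 1 + a * 0 + b * W1)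
  + (ga * ga^-1) * W1)); first by ring.
by rewrite gI mul1r P1w mulr0.
Qed.

(** In the plane x = al z the surface is the union of z = 0, y = be w and this
    line. *)
Definition on_residual_line (a b c d e f g h al be : C) (x y z w : C * C) :=
  forall s t, ev x s t = al * ev z s t /\
    al * be * f * ev y s t = h * ev w s t + (c * al + g) * ev z s t.

Definition on_transversal_line (al be : C) (x y z w : C * C) :=
  forall s t, ev x s t = al * ev z s t /\ ev y s t = be * ev w s t.

End LinesOnOctanomial.

Section Classification.
Variables (x y z w : C * C).
Hypothesis inj : forall s t, ev x s t = 0 -> ev y s t = 0 -> ev z s t = 0 ->
  ev w s t = 0 -> s = 0 /\ t = 0.
Variables (a b c d e f g h : C).
Hypotheses (e0 : e != 0) (f0 : f != 0) (g0 : g != 0) (h0 : h != 0).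

Definition lin (c1 c2 c3 c4 : C) : C * C :=
  (c1 * x.1 + c2 * y.1 + c3 * z.1 + c4 * w.1,
   c1 * x.2 + c2 * y.2 + c3 * z.2 + c4 * w.2).

Lemma ev_lin c1 c2 c3 c4 s t : ev (lin c1 c2 c3 c4) s t =
  c1 * ev x s t + c2 * ev y s t + c3 * ev z s t + c4 * ev w s t.
Proof. by rewrite /ev /lin /=; ring. Qed.

Let A := lin e f a b.
Let B := lin c d g h.

Hypothesis onS : forall s t,
  ev x s t * ev y s t * ev A s t + ev z s t * ev w s t * ev B s t = 0.

(** If no factor vanishes, a zero of x on the line is a zero of z, w or B, so x is
    proportional to one of them.  After cancelling this pair of factors the same
    argument applies to y, and the remaining factors are then proportional as
    well. *)
Lemma classification :
  [\/ [\/ x = 0, y = 0 | A = 0] /\ [\/ z = 0, w = 0 | B = 0],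
      exists al be, line_system a b c d e f g h al be /\
        on_transversal_line al be x y z w,
      exists al be, line_system b a c d e f h g al be /\
        on_transversal_line al be x y w z |
      exists al be,
      [\/ line_system a b c d e f g h al be /\
            on_residual_line a b c d e f g h al be x y z w,
          line_system b a c d e f h g al be /\
            on_residual_line b a c d e f h g al be x y w z,
          line_system a b d c f e g h al be /\
            on_residual_line a b d c f e g h al be y x z w |
          line_system b a d c f e h g al be /\
            on_residual_line b a d c f e h g al be y x w z]].
Proof.
have base1 : [\/ x = 0, y = 0 | A = 0] -> [\/ z = 0, w = 0 | B = 0].
  move=> xyA; apply: ev_prod3 => s t.
  have z0 : ev 0 s t = 0 by rewrite /ev /= !mul0r addr0.
  by have := onS s t; case: xyA => ->; rewrite z0 ?(mulr0, mul0r) add0r.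
have base2 : [\/ z = 0, w = 0 | B = 0] -> [\/ x = 0, y = 0 | A = 0].
  move=> zwB; apply: ev_prod3 => s t.
  have z0 : ev 0 s t = 0 by rewrite /ev /= !mul0r addr0.
  by have := onS s t; case: zwB => ->; rewrite z0 ?(mulr0, mul0r) addr0.
have [xyA|nxyA] := pselect [\/ x = 0, y = 0 | A = 0].
  by constructor 1; split => //; exact: base1.
have nzwB : ~ [\/ z = 0, w = 0 | B = 0] by move=> /base2.
have x0 : x != 0 by apply/eqP => H; apply: nxyA; constructor 1.
have y0 : y != 0 by apply/eqP => H; apply: nxyA; constructor 2.
have A0 : A != 0 by apply/eqP => H; apply: nxyA; constructor 3.
have z0 : z != 0 by apply/eqP => H; apply: nzwB; constructor 1.
have w0 : w != 0 by apply/eqP => H; apply: nzwB; constructor 2.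
have B0 : B != 0 by apply/eqP => H; apply: nzwB; constructor 3.
have zero2 p q r : (forall s t, ev p s t = 0 -> ev q s t * ev r s t = 0) ->
    p != 0 -> q != 0 -> r != 0 ->
    (exists2 k, k != 0 & forall s t, ev p s t = k * ev q s t) \/
    (exists2 k, k != 0 & forall s t, ev p s t = k * ev r s t).
  move=> pP p0 q0 r0; have := pP p.2 (- p.1).
  have -> : ev p p.2 (- p.1) = 0 by rewrite /ev; ring.
  move=> /(_ erefl)/eqP; rewrite mulf_eq0 => /orP[]/eqP E.
    by left; apply: ev_proportional.
  by right; apply: ev_proportional.
have pol := polynomial_ev.
have xP : [\/ exists2 k, k != 0 & forall s t, ev x s t = k * ev z s t,
      exists2 k, k != 0 & forall s t, ev x s t = k * ev w s t |
      exists2 k, k != 0 & forall s t, ev x s t = k * ev B s t].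
  have := onS x.2 (- x.1); have -> : ev x x.2 (- x.1) = 0 by rewrite /ev; ring.
  rewrite !mul0r add0r => /eqP; rewrite !mulf_eq0.
  move=> /orP[/orP[]|] /eqP E.
  - by constructor 1; apply: ev_proportional.
  - by constructor 2; apply: ev_proportional.
  - by constructor 3; apply: ev_proportional.
have cancel3 p k q r q' r' : p != 0 ->
    (forall s t, ev p s t * (k * ev q s t * ev r s t + ev q' s t * ev r' s t) = 0) ->
    forall s t, k * ev q s t * ev r s t + ev q' s t * ev r' s t = 0.
  move=> p0; apply: (ev_cancel p0).
  apply: polynomialD; last by apply: polynomialM.
  by apply: polynomialM => //; apply: polynomialM => //; exact: polynomialC.
have cancel2 p k q q' : p != 0 ->
    (forall s t, ev p s t * (k * ev q s t + ev q' s t) = 0) ->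
    forall s t, k * ev q s t + ev q' s t = 0.
  move=> p0; apply: (ev_cancel p0).
  apply: polynomialD => //.
  by apply: polynomialM => //; exact: polynomialC.
case: xP => -[al al_neq0 Ex].
- have onS1 : forall s t,
      al * ev y s t * ev A s t + ev w s t * ev B s t = 0.
    by apply: (cancel3 z) => // s t; rewrite -(onS s t) Ex; ring.
  have [||||[be be_neq0 Ey]|[ga ga0 Ey]] := @zero2 y w B; rewrite //.
  + by move=> s t E; have := onS1 s t; rewrite E mulr0 mul0r add0r.
  + have onS2 : forall s t, al * be * ev A s t + ev B s t = 0.
      by apply: (cancel2 w) => // s t; rewrite -(onS1 s t) Ey; ring.
    constructor 2; exists al, be; split; last by move=> s t.
    apply: transversal_system Ex Ey _ => // s t; rewrite -(onS2 s t) !ev_lin; ring.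
  + have onS2 : forall s t, al * ga * ev A s t + ev w s t = 0.
      by apply: (cancel2 B) => // s t; rewrite -(onS1 s t) Ey; ring.
    have [||be [sys Hbe]] := residual_system (x := x) (y := y) (z := z) (w := w)
      inj (a := a) (b := b) (c := c) (d := d) (e := e) (g := g) f0 h0 al_neq0 ga0 Ex.
    * by move=> s t; rewrite {1}Ey ev_lin.
    * by move=> s t; rewrite -(onS2 s t) ev_lin.
    * by constructor 4; exists al, be; constructor 1; split.
- have onS1 : forall s t,
      al * ev y s t * ev A s t + ev z s t * ev B s t = 0.
    by apply: (cancel3 w) => // s t; rewrite -(onS s t) Ex; ring.
  have inj' : forall s t, ev x s t = 0 -> ev y s t = 0 -> ev w s t = 0 ->
     ev z s t = 0 -> s = 0 /\ t = 0 by move=> *; exact: inj.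
  have [||||[be be_neq0 Ey]|[ga ga0 Ey]] := @zero2 y z B; rewrite //.
  + by move=> s t E; have := onS1 s t; rewrite E mulr0 mul0r add0r.
  + have onS2 : forall s t, al * be * ev A s t + ev B s t = 0.
      by apply: (cancel2 z) => // s t; rewrite -(onS1 s t) Ey; ring.
    constructor 3; exists al, be; split; last by move=> s t.
    apply: transversal_system Ex Ey _ => // s t; rewrite -(onS2 s t) !ev_lin; ring.
  + have onS2 : forall s t, al * ga * ev A s t + ev z s t = 0.
      by apply: (cancel2 B) => // s t; rewrite -(onS1 s t) Ey; ring.
    have [||be [sys Hbe]] := residual_system (x := x) (y := y) (z := w) (w := z)
      inj' (a := b) (b := a) (c := c) (d := d) (e := e) (g := h) f0 g0 al_neq0 ga0 Ex.
    * by move=> s t; rewrite {1}Ey ev_lin; ring.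
    * by move=> s t; rewrite -(onS2 s t) ev_lin; ring.
    * by constructor 4; exists al, be; constructor 2; split.
- have onS1 : forall s t,
      al * ev y s t * ev A s t + ev z s t * ev w s t = 0.
    by apply: (cancel3 B) => // s t; rewrite -(onS s t) Ex; ring.
  have [||||[be be_neq0 Ey]|[be be_neq0 Ey]] := @zero2 y z w; rewrite //.
  + by move=> s t E; have := onS1 s t; rewrite E mulr0 mul0r add0r.
  + have onS2 : forall s t, be * al * ev A s t + ev w s t = 0.
      by apply: (cancel2 z) => // s t; rewrite -(onS1 s t) Ey; ring.
    have inj' : forall s t, ev y s t = 0 -> ev x s t = 0 -> ev z s t = 0 ->
      ev w s t = 0 -> s = 0 /\ t = 0 by move=> *; exact: inj.
    have [||be' [sys Hbe]] := residual_system (x := y) (y := x) (z := z) (w := w)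
      inj' (a := a) (b := b) (c := d) (d := c) (e := f) (g := g) e0 h0 be_neq0 al_neq0 Ey.
    * by move=> s t; rewrite {1}Ex ev_lin; ring.
    * by move=> s t; rewrite -(onS2 s t) ev_lin; ring.
    * by constructor 4; exists be, be'; constructor 3; split.
  + have onS2 : forall s t, be * al * ev A s t + ev z s t = 0.
      by apply: (cancel2 w) => // s t; rewrite -(onS1 s t) Ey; ring.
    have inj' : forall s t, ev y s t = 0 -> ev x s t = 0 -> ev w s t = 0 ->
      ev z s t = 0 -> s = 0 /\ t = 0 by move=> *; exact: inj.
    have [||be' [sys Hbe]] := residual_system (x := y) (y := x) (z := w) (w := z)
      inj' (a := b) (b := a) (c := d) (d := c) (e := f) (g := h) e0 g0 be_neq0 al_neq0 Ey.
    * by move=> s t; rewrite {1}Ex ev_lin; ring.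
    * by move=> s t; rewrite -(onS2 s t) ev_lin; ring.
    * by constructor 4; exists be, be'; constructor 4; split.
Qed.

End Classification.
End BinaryForms.

(** * Lines spanned by two points *)

Section Points.
Variable C : fieldType.

Definition pt (s : seq C) : 'rV[C]_4 := \row_(j < 4) s`_j.

Lemma ptE s (n : nat) : (n < 4)%N -> pt s 0 (inord n) = s`_n.
Proof. by move=> n4; rewrite mxE inordK. Qed.

Definition join_line (P Q : seq C) : {vspace 'rV[C]_4} := <<[:: pt P; pt Q]>>%VS.

Lemma mem_join_line P Q u :
  reflect (exists s t, u = s *: pt P + t *: pt Q) (u \in join_line P Q).
Proof.
rewrite /join_line span_cons span_seq1.
apply: (iffP memv_addP) => [[_ /vlineP[s ->] [_ /vlineP[t ->] ->]]|[s [t ->]]].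
  by exists s, t.
by exists (s *: pt P); rewrite ?memvZ ?memv_line//; exists (t *: pt Q);
  rewrite ?memvZ ?memv_line.
Qed.

Lemma dim_join_line P Q m n : (m < 4)%N -> (n < 4)%N ->
  P`_m * Q`_n - Q`_m * P`_n != 0 -> \dim (join_line P Q) = 2%N.
Proof.
move=> m4 n4 D; have : free [:: pt P; pt Q].
  rewrite free_cons span_seq1 seq1_free; apply/andP; split.
    apply/negP => /vlineP[k E]; case/negP: D.
    have Pm : P`_m = k * Q`_m by rewrite -!ptE// E mxE.
    have Pn : P`_n = k * Q`_n by rewrite -!ptE// E mxE.
    by rewrite Pm Pn; apply/eqP; ring.
  apply: contraNneq D => E.
  have -> : Q`_m = 0 by rewrite -ptE// E mxE.
  have -> : Q`_n = 0 by rewrite -ptE// E mxE.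
  by rewrite mulr0 mul0r subr0.
by move=> /eqP; rewrite /join_line /= => ->.
Qed.

Lemma line_basis (L : {vspace 'rV[C]_4}) : \dim L = 2%N ->
  exists b1 b2, [/\ forall u, u \in L -> exists s t, u = s *: b1 + t *: b2,
    forall s t, s *: b1 + t *: b2 \in L &
    forall s t, s *: b1 + t *: b2 = 0 -> s = 0 /\ t = 0].
Proof.
move=> L2; have := vbasisP L; rewrite basisEfree => /and3P[fr sub _].
have sz : size (vbasis L) = 2%N by rewrite size_tuple.
have sp : <<vbasis L>>%VS = L by apply: span_basis; exact: vbasisP.
case: (vbasis L) sz fr sp {sub} => -[|b1 [|b2 [|]]]//= _ _ fr sp.
exists b1, b2; split.
- move=> u; rewrite -{1}sp span_cons span_seq1.
  by move=> /memv_addP[_ /vlineP[s ->] [_ /vlineP[t ->] ->]]; exists s, t.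
- move=> s t; rewrite -[in X in _ \in X]sp; apply: memvD; apply: memvZ;
    by rewrite memv_span// !inE eqxx ?orbT.
- move=> s t E; move: fr; rewrite free_cons span_seq1 seq1_free => /andP[b12 b20].
  have s0 : s = 0.
    apply/eqP; apply: contraNT b12 => s0; apply/vlineP; exists (- t / s).
    have -> : b1 = s^-1 *: (s *: b1 + t *: b2) - (t / s) *: b2.
      by rewrite scalerDr !scalerA mulVf// scale1r mulrC addrK.
    by rewrite E scaler0 sub0r -scaleNr mulNr.
  split => //; move/eqP: E; rewrite s0 scale0r add0r scaler_eq0 (negbTE b20) orbF.
  by move/eqP.
Qed.

End Points.

Lemma join_line_defined (K : fieldType) (C : closedFieldType)
    (iota : {rmorphism K -> C}) (P Q : seq C) :
  (forall n, in_base iota P`_n) -> (forall n, in_base iota Q`_n) ->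
  is_defined_over iota (join_line P Q).
Proof.
have lift s : (forall n, in_base iota s`_n) ->
    exists u : 'rV[K]_4, map_mx iota u = pt s.
  move=> sP; have ex (j : 'I_4) : {y : K | iota y = s`_j} by apply/cid/sP.
  exists (\row_j sval (ex j)); apply/rowP => j; rewrite !mxE.
  exact: (svalP (ex j)).
move=> /lift[u1 E1] /lift[u2 E2]; exists u1, u2.
by rewrite E1 E2.
Qed.

Section TwoTerms.
Variables (R : realType) (C : fieldType) (w : C -> \bar R).
Hypothesis hw : valuation w.
Variables (L1 L2 : {vspace 'rV[C]_4}).
Hypothesis tropE : tropicalization w L1 = tropicalization w L2.

(** [tropical_vanishing] in both directions: each of the two terms must be
    matched by another term, and only the other one can be finite. *)
Lemma trop_two_terms (c : 'I_4 -> C) (i j : 'I_4) (u : 'rV[C]_4) :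
  (forall u, u \in L1 -> \sum_k c k * u 0 k = 0) -> u \in L2 -> i != j ->
  (forall k, k != i -> k != j -> c k * u 0 k = 0) ->
  w (c i * u 0 i) = w (c j * u 0 j).
Proof.
move=> cL1 uL2 ij other.
have le i' j' : (forall k, k != i' -> k != j' -> c k * u 0 k = 0) ->
    (w (c j' * u 0 j')%R <= w (c i' * u 0 i')%R)%E.
  move=> oth; have [->|ci] := eqVneq (c i' * u 0 i') 0.
    by rewrite (val0 hw) leey.
  have [k ki] := tropical_vanishing hw tropE cL1 uL2 ci.
  have [->//|kj] := eqVneq k j'.
  rewrite (oth k ki kj) (val0 hw) leye_eq => /eqP E.
  by rewrite E leey.
by apply/eqP; rewrite eq_le !le// => k ? ?; exact: other.
Qed.

End TwoTerms.

(** * What a tropical line remembers *)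

Definition dot4 (C : fieldType) (r P : seq C) : C :=
  r`_0 * P`_0 + r`_1 * P`_1 + r`_2 * P`_2 + r`_3 * P`_3.

(** The Pluecker coordinate of the line through P and Q; it vanishes iff the
    coordinates m and n are linearly dependent on the line. *)
Definition minor (C : fieldType) (P Q : seq C) (m n : nat) : C :=
  P`_m * Q`_n - Q`_m * P`_n.

Lemma sum_ord4 (V : nmodType) (G : 'I_4 -> V) : \sum_k G k =
  G (inord 0) + G (inord 1) + G (inord 2) + G (inord 3).
Proof.
rewrite !big_ord_recl big_ord0 addr0 !addrA.
by do ![congr (_ + _)]; congr G; apply: val_inj; rewrite /= inordK.
Qed.

Section TropicalInvariants.
Variables (R : realType) (C : fieldType) (w : C -> \bar R).
Hypothesis hw : valuation w.
Variables (P1 Q1 P2 Q2 : seq C).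
Hypothesis tropE :
  tropicalization w (join_line P1 Q1) = tropicalization w (join_line P2 Q2).

Lemma trop_ratio (r U : seq C) (m n : nat) : (m < 4)%N -> (n < 4)%N -> m != n ->
  dot4 r P1 = 0 -> dot4 r Q1 = 0 -> pt U \in join_line P2 Q2 ->
  (forall k, k != m -> k != n -> r`_k * U`_k = 0) ->
  w (r`_m * U`_m) = w (r`_n * U`_n).
Proof.
move=> m4 n4 mn rP rQ UL other.
have := @trop_two_terms _ _ _ hw _ _ tropE (fun k => r`_k) (inord m) (inord n) (pt U).
rewrite !ptE// !inordK//; apply => //.
- move=> u /mem_join_line[s [t ->]]; rewrite sum_ord4 !mxE !inordK//.
  transitivity (s * dot4 r P1 + t * dot4 r Q1); first by rewrite /dot4; ring.
  by rewrite rP rQ !mulr0 addr0.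
- by rewrite -val_eqE /= !inordK.
- move=> k; rewrite -!val_eqE /= !inordK// => km kn.
  by rewrite mxE other.
Qed.

(** A relation between two coordinates on the first line forces them to have the
    same zeros on the second one, hence to be dependent there, because the
    second line contains a point at which a given coordinate vanishes. *)
Lemma trop_minor (m n : nat) : (m < 4)%N -> (n < 4)%N -> m != n ->
  minor P1 Q1 m n = 0 -> minor P2 Q2 m n = 0.
Proof.
move=> m4 n4 mn D1.
pose rel (a b : C) : seq C :=
  mkseq (fun k => if k == m then a else if k == n then b else 0) 4.
have relE a b k : (k < 4)%N -> (rel a b)`_k =
    if k == m then a else if k == n then b else 0.
  by move=> k4; rewrite nth_mkseq.
have relm a b : (rel a b)`_m = a by rewrite relE// eqxx.
have reln a b : (rel a b)`_n = b by rewrite relE// eq_sym (negbTE mn) eqxx.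
have relo a b k : k != m -> k != n -> (rel a b)`_k = 0.
  move=> km kn; have [k4|k4] := ltnP k 4.
    by rewrite relE// (negbTE km) (negbTE kn).
  by rewrite nth_default// size_mkseq.
have dotE a b P : dot4 (rel a b) P = a * P`_m + b * P`_n.
  rewrite /dot4 !relE//; clear -m4 n4 mn.
  by case: m n m4 n4 mn => [|[|[|[|m]]]] [|[|[|[|n]]]] //= _ _ _; ring.
have [a [b [ab0 aP bQ]]] : exists a b, [/\ (a != 0) || (b != 0),
    a * P1`_m + b * P1`_n = 0 & a * Q1`_m + b * Q1`_n = 0].
  have [P0|P0] := boolP ((P1`_m != 0) || (P1`_n != 0)).
    exists P1`_n, (- P1`_m); rewrite oppr_eq0 orbC P0; split => //; first ring.
    transitivity (- minor P1 Q1 m n); first by rewrite /minor; ring.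
    by rewrite D1 oppr0.
  have [Q0|Q0] := boolP ((Q1`_m != 0) || (Q1`_n != 0)).
    exists Q1`_n, (- Q1`_m); rewrite oppr_eq0 orbC Q0; split => //; last ring.
    by rewrite -[RHS]D1 /minor; ring.
  move: P0 Q0; rewrite !negb_or !negbK => /andP[/eqP -> /eqP ->].
  move=> /andP[/eqP -> /eqP ->].
  by exists 1, 0; rewrite oner_neq0 !mulr0 addr0.
have val_neq x : w x = w 0 -> x = 0.
  by move=> E; apply/eqP; rewrite -(val_eqy hw) E (val0 hw).
have eq k1 k2 : w (a * (k1 * P2`_m + k2 * Q2`_m)) =
    w (b * (k1 * P2`_n + k2 * Q2`_n)).
  pose U := mkseq (fun k => k1 * P2`_k + k2 * Q2`_k) 4.
  have UE k : (k < 4)%N -> U`_k = k1 * P2`_k + k2 * Q2`_k.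
    by move=> k4; rewrite nth_mkseq.
  have := @trop_ratio (rel a b) U m n m4 n4 mn.
  rewrite !dotE relm reln !UE//; apply => //.
    apply/mem_join_line; exists k1, k2; apply/rowP => j; rewrite !mxE UE//.
  by move=> k km kn; rewrite relo// mul0r.
have [a0|a0] := eqVneq a 0.
  have b0 : b != 0 by move: ab0; rewrite a0 eqxx.
  have := eq (- Q2`_m) P2`_m; rewrite a0 mul0r => /esym /val_neq /eqP.
  rewrite mulf_eq0 (negbTE b0) => /eqP <-; rewrite /minor; ring.
have := eq (Q2`_n) (- P2`_n).
have -> : b * (Q2`_n * P2`_n + - P2`_n * Q2`_n) = 0 by ring.
move=> /val_neq /eqP; rewrite mulf_eq0 (negbTE a0) => /eqP <-.
by rewrite /minor; ring.
Qed.

End TropicalInvariants.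

(** * The twenty-seven lines *)

(** The flags s and t record which of x, y and which of z, w play the first role,
    so that each family of lines is described once. *)
Definition swap_point (C : fieldType) (s t : bool) (x y z w : C) : seq C :=
  [:: if s then y else x; if s then x else y;
      if t then w else z; if t then z else w].

(** In this order: the lines x_s = z_t = 0; the lines x_s = B = 0 and
    z_t = A = 0; the line A = B = 0; the transversals; the residual lines. *)
Definition line_index : finType :=
  ((bool * bool) + (bool + bool) + unit + bool * 'I_3 + (bool * bool) * 'I_3)%type.

Lemma card_line_index : #|line_index| = 27%N.
Proof. by rewrite !card_sum !card_prod !card_bool card_unit card_ord. Qed.

Section Lines.
Variables (C : closedFieldType) (a b c d e f g h : C).
Variables (al be : bool -> bool -> 'I_3 -> C).

(** The coefficients of x_s and z_t in A (cE and cA) and in B (cC and cG). *)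
Definition cA (t : bool) := if t then b else a.
Definition cC (s : bool) := if s then d else c.
Definition cE (s : bool) := if s then f else e.
Definition cG (t : bool) := if t then h else g.

(** The residual line is residual_y y = (cG (~~ t)) w + residual_z z in the plane
    x = al z. *)
Definition residual_y s t k := al s t k * be s t k * cE (~~ s).
Definition residual_z s t k := cC s * al s t k + cG t.

Definition line_points (i : line_index) : seq C * seq C :=
  match i with
  | inl (inl (inl (inl (s, t)))) => (swap_point s t 0 1 0 0, swap_point s t 0 0 0 1)
  | inl (inl (inl (inr (inl s)))) =>
      (swap_point s false 0 g (- cC (~~ s)) 0, swap_point s false 0 h 0 (- cC (~~ s)))
  | inl (inl (inl (inr (inr t)))) =>
      (swap_point false t (cA (~~ t)) 0 0 (- e), swap_point false t f (- e) 0 0)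
  | inl (inl (inr _)) =>
      ([:: a * d - f * g; e * g - a * c; c * f - e * d; 0],
       [:: a * h - b * g; 0; b * c - e * h; e * g - a * c])
  | inl (inr (t, k)) =>
      (swap_point false t (al false t k) 0 1 0, swap_point false t 0 (be false t k) 0 1)
  | inr ((s, t), k) =>
      (swap_point s t (al s t k * residual_y s t k) (residual_z s t k)
         (residual_y s t k) 0,
       swap_point s t 0 (cG (~~ t)) 0 (residual_y s t k))
  end.

Definition line_of i := join_line (line_points i).1 (line_points i).2.

(** The pairs (s, t) such that the coordinates x_s and z_t are linearly dependent
    on the line. *)
Definition zero_pattern (i : line_index) (s t : bool) : bool :=
  match i with
  | inl (inl (inl (inl (s', t')))) => (s == s') || (t == t')
  | inl (inl (inl (inr (inl s')))) => s == s'
  | inl (inl (inl (inr (inr t')))) => t == t'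
  | inl (inl (inr _)) => false
  | inl (inr (t', _)) => s (+) t == t'
  | inr ((s', t'), _) => (s == s') && (t == t')
  end.

Hypotheses (a0 : a != 0) (b0 : b != 0) (c0 : c != 0) (d0 : d != 0)
  (e0 : e != 0) (f0 : f != 0) (g0 : g != 0) (h0 : h != 0).
Hypothesis minor0 : forall s t, cE s * cG t + - (cA t * cC s) != 0.
Hypothesis sys : forall s t k, line_system (cA t) (cA (~~ t)) (cC s) (cC (~~ s))
  (cE s) (cE (~~ s)) (cG t) (cG (~~ t)) (al s t k) (be s t k).

Lemma cG_neq0 t : cG t != 0. Proof. by case: t. Qed.
Lemma cE_neq0 t : cE t != 0. Proof. by case: t. Qed.

Lemma al_neq0 s t k : al s t k != 0.
Proof. by have [] := line_system_neq0 (cG_neq0 _) (cG_neq0 _) (sys s t k). Qed.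
Lemma be_neq0 s t k : be s t k != 0.
Proof. by have [] := line_system_neq0 (cG_neq0 _) (cG_neq0 _) (sys s t k). Qed.
Lemma residual_y_neq0 s t k : residual_y s t k != 0.
Proof. by rewrite /residual_y !mulf_neq0 ?al_neq0 ?be_neq0 ?cE_neq0. Qed.
Lemma residual_z_neq0 s t k : residual_z s t k != 0.
Proof.
by have [] := system_denom_neq0 (cG_neq0 _) (cG_neq0 _) (minor0 s t) (sys s t k).
Qed.

(** On the line A = B = 0 the four minors are products of minors of the
    coefficient matrix of A and B; in the other families they are monomials in
    nonzero quantities. *)
Lemma minor_zero_pattern i (s t : bool) :
  (minor (line_points i).1 (line_points i).2 s (2 + t)%N == 0) = zero_pattern i s t.
Proof.
pose simp := (mulr0, mul0r, mulr1, mul1r, subr0, sub0r, oppr0).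
have nz := (negbTE a0, negbTE b0, negbTE c0, negbTE d0, negbTE e0, negbTE f0,
  negbTE g0, negbTE h0, oner_eq0).
have sys0 s' t' k := (negbTE (al_neq0 s' t' k), negbTE (be_neq0 s' t' k),
  negbTE (residual_y_neq0 s' t' k), negbTE (residual_z_neq0 s' t' k)).
case: i => [[[[[s' t']|[s'|t']]|[]]|[t' k]]|[[s' t'] k]]; rewrite /minor /=.
- by case: s' t' s t => [] [] [] []; rewrite /= !simp ?oppr_eq0 ?eqxx ?nz.
- by case: s' s t => [] [] []; rewrite /= !simp ?oppr_eq0 ?mulf_eq0 ?oppr_eq0 ?eqxx ?nz.
- by case: t' s t => [] [] []; rewrite /= !simp ?oppr_eq0 ?mulf_eq0 ?oppr_eq0 ?eqxx ?nz.
- have m00 := minor0 false false; have m01 := minor0 false true.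
  have m10 := minor0 true false; have m11 := minor0 true true.
  rewrite /= in m00 m01 m10 m11.
  have m01' : b * c - e * h != 0 by rewrite -opprB oppr_eq0.
  have m10' : a * d - f * g != 0 by rewrite -opprB oppr_eq0.
  apply/negbTE; case: s t => [] []; rewrite /= ?simp ?mulf_neq0//.
  + rewrite (_ : _ - _ = (e * g + - (a * c)) * (f * h + - (b * d))); last by ring.
    by rewrite mulf_neq0.
- by case: t' s t => [] [] []; rewrite /= !simp ?oppr_eq0 ?mulf_eq0 ?oppr_eq0
   ?eqxx ?nz ?sys0.
- by case: s' t' s t => [] [] [] []; rewrite /= !simp ?oppr_eq0 ?mulf_eq0 ?oppr_eq0
   ?eqxx ?sys0 ?nz.
Qed.

Lemma zero_pattern_neqT i : exists s t : bool, zero_pattern i s t = false.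
Proof.
case: i => [[[[[s' t']|[s'|t']]|[]]|[t' k]]|[[s' t'] k]].
- by exists (~~ s'), (~~ t'); case: s' t' => [] [].
- by exists (~~ s'), true; case: s'.
- by exists true, (~~ t'); case: t'.
- by exists true, true.
- by exists (~~ t'), false; case: t'.
- by exists (~~ s'), t'; case: s' t' => [] [].
Qed.

Lemma dim_line_of i : \dim (line_of i) = 2%N.
Proof.
have [s [t zp]] := zero_pattern_neqT i.
apply: (@dim_join_line _ _ _ s (2 + t)%N); [by case: (s)|by case: (t)|].
by have := minor_zero_pattern i s t; rewrite zp => /negbT.
Qed.

Definition family (i : line_index) :
    (bool * bool) + (bool + bool) + unit + bool + (bool * bool) :=
  match i with
  | inl (inl j) => inl (inl j)
  | inl (inr (t, _)) => inl (inr t)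
  | inr (st, _) => inr st
  end.

(** The fifteen families realize each proper subset of the four pairs (s, t)
    exactly once. *)
Lemma zero_pattern_family i j :
  (forall s t, zero_pattern i s t = zero_pattern j s t) -> family i = family j.
Proof.
move=> zp; move: (zp false false) (zp false true) (zp true false) (zp true true).
case: i {zp} => [[[[[s' t']|[s'|t']]|[]]|[t' k]]|[[s' t'] k]];
case: j => [[[[[s t]|[s|t]]|[]]|[t l]]|[[s t] l]];
by do ?[case: s'|case: t'|case: s|case: t].
Qed.

Lemma mem_join_swap_point (s t : bool) (u : 'rV[C]_4) (k l x1 y1 z1 w1 x2 y2 z2 w2 : C) :
  u 0 (inord s) = k * x1 + l * x2 ->
  u 0 (inord (~~ s)) = k * y1 + l * y2 ->
  u 0 (inord (2 + t)%N) = k * z1 + l * z2 ->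
  u 0 (inord (2 + ~~ t)%N) = k * w1 + l * w2 ->
  u \in join_line (swap_point s t x1 y1 z1 w1) (swap_point s t x2 y2 z2 w2).
Proof.
move=> E1 E2 E3 E4; apply/mem_join_line; exists k, l; apply/rowP => j.
rewrite !mxE -[j]inord_val; case: j => -[|[|[|[|//]]]] /= _; rewrite inordK//.
- by case: s E1 E2 => /= E1 E2.
- by case: s E1 E2 => /= E1 E2.
- by case: t E3 E4 => /= E3 E4.
- by case: t E3 E4 => /= E3 E4.
Qed.

Lemma octanomial_swap_point s t x y z w :
  octanomial [tuple a; b; c; d; e; f; g; h] (pt (swap_point s t x y z w)) =
  x * y * (cE s * x + cE (~~ s) * y + cA t * z + cA (~~ t) * w)
  + z * w * (cC s * x + cC (~~ s) * y + cG t * z + cG (~~ t) * w).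
Proof. by rewrite octanomialE /= !ptE//; case: s t => [] []; rewrite /=; ring. Qed.

(** At a point of a residual line, be times the equation is y z (z S1 + w S2),
    where S1 and S2 are the left-hand sides of the system. *)
Lemma octanomial_line_of i u : u \in line_of i ->
  octanomial [tuple a; b; c; d; e; f; g; h] u = 0.
Proof.
move=> /mem_join_line[k [l ->]].
have comb s t x1 y1 z1 w1 x2 y2 z2 w2 :
    k *: pt (swap_point s t x1 y1 z1 w1) + l *: pt (swap_point s t x2 y2 z2 w2) =
    pt (swap_point s t (k * x1 + l * x2) (k * y1 + l * y2) (k * z1 + l * z2)
      (k * w1 + l * w2)).
  apply/rowP => j; rewrite !mxE; case: j => -[|[|[|[|//]]]] /= _;
    by case: s; case: t.
have comb0 x1 y1 z1 w1 x2 y2 z2 w2 :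
    k *: pt [:: x1; y1; z1; w1] + l *: pt [:: x2; y2; z2; w2] =
    pt (swap_point false false (k * x1 + l * x2) (k * y1 + l * y2) (k * z1 + l * z2)
      (k * w1 + l * w2)).
  exact: (comb false false).
case: i => [[[[[s t]|[s|t]]|[]]|[t m]]|[[s t] m]];
  rewrite ?comb ?comb0 octanomial_swap_point.
- by ring.
- by rewrite /=; ring.
- by rewrite /=; ring.
- by rewrite /=; ring.
- have [S1 S2] := sys false t m; set x := al false t m; set y := be false t m.
  rewrite -/x -/y in S1 S2.
  transitivity (k * k * l * (cE false * x ^+ 2 * y + cA t * x * y + cC false * x + cG t)
    + k * l * l * (cE (~~ false) * x * y ^+ 2 + cA (~~ t) * x * y
       + cC (~~ false) * y + cG (~~ t))); first by ring.
  by rewrite S1 S2 !mulr0 addr0.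
- have [S1 S2] := sys s t m; apply: (mulfI (be_neq0 s t m)); rewrite mulr0.
  rewrite /residual_y /residual_z; set x := al s t m; set y := be s t m.
  rewrite -/x -/y in S1 S2.
  pose z := k * (x * y * cE (~~ s)).
  pose w := l * (x * y * cE (~~ s)).
  pose v := k * (cC s * x + cG t) + l * cG (~~ t).
  transitivity (z * (v * z *
      (cE s * x ^+ 2 * y + cA t * x * y + cC s * x + cG t)
    + v * w * (cE (~~ s) * x * y ^+ 2 + cA (~~ t) * x * y
       + cC (~~ s) * y + cG (~~ t)))).
    by rewrite /z /w /v; ring.
  by rewrite S1 S2 !mulr0 addr0 mulr0.
Qed.

Section Rationality.
Variables (K : fieldType) (iota : {rmorphism K -> C}).
Local Notation ib := (in_base iota).
Hypotheses (ia : ib a) (ibb : ib b) (ic : ib c) (jd : ib d) (ie : ib e)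
  (jf : ib f) (ig : ib g) (ih : ib h).
Hypothesis isol : forall s t k, ib (al s t k) /\ ib (be s t k).

Lemma line_of_defined i : is_defined_over iota (line_of i).
Proof.
have i0 : ib 0 by exists 0; rewrite rmorph0.
have i1 : ib 1 by exists 1; rewrite rmorph1.
have iN x : ib x -> ib (- x).
  by move=> ix; rewrite -sub0r; apply: in_baseB.
have iC s : ib (cC s) by case: s.
have iE s : ib (cE s) by case: s.
have iA t : ib (cA t) by case: t.
have iG t : ib (cG t) by case: t.
have [ial ibe] : (forall s t k, ib (al s t k)) /\ (forall s t k, ib (be s t k)).
  by split=> s t k; have [] := isol s t k.
have irn s t k : ib (residual_y s t k) by do 2?apply: in_baseM.
have irm s t k : ib (residual_z s t k) by apply: in_baseD => //; apply: in_baseM.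
have swapP s t x y z w : ib x -> ib y -> ib z -> ib w ->
    forall n, ib (swap_point s t x y z w)`_n.
  move=> ? ? ? ? [|[|[|[|n]]]]; rewrite /= ?nth_nil//; by [case: s|case: t].
case: i => [[[[[s t]|[s|t]]|[]]|[t k]]|[[s t] k]]; apply: join_line_defined => /=.
all: try (by apply: swapP => //; do ?[apply: iN|apply: in_baseM]).
all: by move=> [|[|[|[|n]]]]; rewrite /= ?nth_nil//; apply: in_baseB; apply: in_baseM.
Qed.

End Rationality.

Section Distinctness.
Variables (R : realType) (w : C -> \bar R).
Hypothesis hw : valuation w.
Hypothesis val_inj : forall s t k l,
  w (al s t k) = w (al s t l) -> w (be s t k) = w (be s t l) -> k = l.

Lemma val_cancel x x' y : y != 0 -> w (x * y) = w (x' * y) -> w x = w x'.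
Proof.
move=> /(val_finE hw)[r yr]; rewrite !(valM hw) yr.
by case: (w x) (w x') => [p||] [q||] //= [] /addIr ->.
Qed.

Lemma swap_point_x s t (x y z u : C) : (swap_point s t x y z u)`_s = x.
Proof. by case: s. Qed.
Lemma swap_point_y s t (x y z u : C) : (swap_point s t x y z u)`_(~~ s) = y.
Proof. by case: s. Qed.
Lemma swap_point_z s t (x y z u : C) : (swap_point s t x y z u)`_(2 + t)%N = z.
Proof. by case: t. Qed.
Lemma swap_point_w s t (x y z u : C) : (swap_point s t x y z u)`_(2 + ~~ t)%N = u.
Proof. by case: t. Qed.

Lemma dot4_swap_point s t (x y z u x' y' z' u' : C) :
  dot4 (swap_point s t x y z u) (swap_point s t x' y' z' u') =
  x * x' + y * y' + z * z' + u * u'.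
Proof. by rewrite /dot4; case: s t => [] []; rewrite /=; ring. Qed.

Lemma line_pointl (P Q : seq C) : pt P \in join_line P Q.
Proof.
by apply/mem_join_line; exists (1 : C), 0; rewrite scale1r scale0r addr0.
Qed.

Lemma line_pointr (P Q : seq C) : pt Q \in join_line P Q.
Proof.
by apply/mem_join_line; exists (0 : C), 1; rewrite scale1r scale0r add0r.
Qed.

Section TropicalRatios.
Variables (P1 Q1 P2 Q2 : seq C).
Hypothesis tropE :
  tropicalization w (join_line P1 Q1) = tropicalization w (join_line P2 Q2).
Variables (s t : bool) (rx ry rz rw x y z u : C).
Hypotheses (rP : dot4 (swap_point s t rx ry rz rw) P1 = 0)
  (rQ : dot4 (swap_point s t rx ry rz rw) Q1 = 0)
  (UL : pt (swap_point s t x y z u) \in join_line P2 Q2).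

Lemma trop_ratio_xz : ry * y = 0 -> rw * u = 0 -> w (rx * x) = w (rz * z).
Proof.
move=> y0 u0; have := trop_ratio hw tropE (m := s) (n := (2 + t)%N) _ _ _ rP rQ UL.
rewrite !swap_point_x !swap_point_z; apply;
  [by case: s|by case: t|by case: s t => [] []|].
by move: y0 u0; clear; case: s t => [] [] y0 u0 [|[|[|[|k]]]]//= *;
  rewrite ?nth_nil ?mulr0.
Qed.

Lemma trop_ratio_yw : rx * x = 0 -> rz * z = 0 -> w (ry * y) = w (rw * u).
Proof.
move=> x0 z0; have := trop_ratio hw tropE (m := (~~ s)) (n := (2 + ~~ t)%N) _ _ _ rP rQ UL.
rewrite !swap_point_y !swap_point_w; apply;
  [by case: s|by case: t|by case: s t => [] []|].
by move: x0 z0; clear; case: s t => [] [] x0 z0 [|[|[|[|k]]]]//= *;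
  rewrite ?nth_nil ?mulr0.
Qed.

End TropicalRatios.

(** The family is determined by the vanishing minors.  On a transversal the
    relations x = al z and y = be w give the two valuations; on a residual line
    x = al z gives that of al, and the point x = z = 0 gives that of
    residual_y, which is al be up to a coefficient. *)
Lemma tropicalization_line_of_inj i j :
  tropicalization w (line_of i) = tropicalization w (line_of j) -> i = j.
Proof.
move=> tE.
have s4 (s : bool) : (s < 4)%N by case: s.
have t4 (t : bool) : (2 + t < 4)%N by case: t.
have st (s t : bool) : nat_of_bool s != (2 + t)%N by case: s t => [] [].
have pE : family i = family j.
  apply: zero_pattern_family => s t; rewrite -!minor_zero_pattern.
  apply/eqP/eqP; first exact: (trop_minor hw tE (s4 s) (t4 t) (st s t)).
  exact: (trop_minor hw (esym tE) (s4 s) (t4 t) (st s t)).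
case: i j pE tE => [[i|[t k]]|[[s t] k]] [[j|[t' l]]|[[s' t'] l]] //=.
- by move=> [->].
- move=> [<-] tE; congr (inl (inr (_, _))).
  apply: (val_inj (s := false) (t := t)).
  + rewrite -[al false t k]mulr1 -(valN hw) -mulNr -[al false t l]mul1r.
    apply: esym; apply: (trop_ratio_xz tE (ry := 0) (rw := 0) _ _ (line_pointl _ _)).
    * by rewrite dot4_swap_point; ring.
    * by rewrite dot4_swap_point; ring.
    * by rewrite mul0r.
    * by rewrite mulr0.
  + rewrite -[be false t k]mulr1 -(valN hw) -mulNr -[be false t l]mul1r.
    apply: esym; apply: (trop_ratio_yw tE (rx := 0) (rz := 0) _ _ (line_pointr _ _)).
    * by rewrite dot4_swap_point; ring.
    * by rewrite dot4_swap_point; ring.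
    * by rewrite mul0r.
    * by rewrite mul0r.
- move=> [<- <-] tE; congr (inr (_, _)).
  have wal : w (al s t k) = w (al s t l).
    apply: (val_cancel (residual_y_neq0 s t l)).
    rewrite -[X in _ = w X]mul1r -(valN hw) -mulNr.
    apply: esym; apply: (trop_ratio_xz tE (ry := 0) (rw := 0) _ _ (line_pointl _ _)).
    + by rewrite dot4_swap_point; ring.
    + by rewrite dot4_swap_point; ring.
    + by rewrite mul0r.
    + by rewrite mulr0.
  have wrn : w (residual_y s t k) = w (residual_y s t l).
    apply: (val_cancel (cG_neq0 (~~ t))).
    transitivity (w (- cG (~~ t) * residual_y s t l)); last by rewrite mulNr (valN hw) mulrC.
    apply: (trop_ratio_yw tE (rx := 0) (rz := - residual_z s t k) _ _ (line_pointr _ _)).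
    + by rewrite dot4_swap_point; ring.
    + by rewrite dot4_swap_point; ring.
    + by rewrite mul0r.
    + by rewrite mulr0.
  apply: (val_inj (s := s) (t := t)) => //.
  have wab : w (al s t k * be s t k) = w (al s t l * be s t l).
    by apply: (val_cancel (cE_neq0 (~~ s))).
  apply: (val_cancel (al_neq0 s t l)); rewrite [in RHS]mulrC -wab mulrC.
  by rewrite !(valM hw) wal.
Qed.

End Distinctness.

Section Completeness.
Hypothesis all_solutions : forall s t x y,
  line_system (cA t) (cA (~~ t)) (cC s) (cC (~~ s))
    (cE s) (cE (~~ s)) (cG t) (cG (~~ t)) x y ->
  exists k, x = al s t k /\ y = be s t k.

(** Each case of [classification] places every point of L on a line of the list;
    equality follows from the dimensions. *)
Lemma line_of_complete (L : {vspace 'rV[C]_4}) : \dim L = 2%N ->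
  (forall u, u \in L -> octanomial [tuple a; b; c; d; e; f; g; h] u = 0) ->
  exists i, L = line_of i.
Proof.
move=> L2 onL.
suff [i Li] : exists i, forall u, u \in L -> u \in line_of i.
  exists i; apply/eqP; rewrite eqEdim dim_line_of L2 leqnn andbT.
  exact/subvP.
have [b1 [b2 [Lb bL bfree]]] := line_basis L2.
pose form n : C * C := (b1 0 (inord n), b2 0 (inord n)).
have evE n p q : ev (form n) p q = (p *: b1 + q *: b2) 0 (inord n).
  by rewrite /ev /form !mxE /=; ring.
have inj p q : ev (form 0) p q = 0 -> ev (form 1) p q = 0 ->
    ev (form 2) p q = 0 -> ev (form 3) p q = 0 -> p = 0 /\ q = 0.
  rewrite !evE => E0 E1 E2 E3; apply: bfree; apply/rowP => j.
  by rewrite -[j]inord_val [RHS]mxE; case: j => -[|[|[|[|//]]]].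
have onS p q : ev (form 0) p q * ev (form 1) p q *
    ev (lin (form 0) (form 1) (form 2) (form 3) e f a b) p q +
    ev (form 2) p q * ev (form 3) p q *
    ev (lin (form 0) (form 1) (form 2) (form 3) c d g h) p q = 0.
  rewrite !ev_lin !evE; have := onL _ (bL p q); rewrite octanomialE => <-; ring.
have coord i s t x1 y1 z1 w1 x2 y2 z2 w2 (k l : C -> C -> C -> C -> C) :
   line_points i = (swap_point s t x1 y1 z1 w1, swap_point s t x2 y2 z2 w2) ->
   (forall p q, let x := ev (form s) p q in let y := ev (form (~~ s)) p q in
      let z := ev (form (2 + t)%N) p q in let w := ev (form (2 + ~~ t)%N) p q in
      [/\ x = k x y z w * x1 + l x y z w * x2,
          y = k x y z w * y1 + l x y z w * y2,
          z = k x y z w * z1 + l x y z w * z2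
        & w = k x y z w * w1 + l x y z w * w2]) ->
   exists i, forall u, u \in L -> u \in line_of i.
  move=> iE H; exists i => u /Lb[p [q ->]]; rewrite /line_of iE /=.
  have /= := H p q; rewrite !evE => -[E1 E2 E3 E4].
  exact: (mem_join_swap_point E1 E2 E3 E4).
have ev_0 p q : ev 0 p q = 0 :> C by rewrite /ev /= !mul0r addr0.
have residual s t x y : line_system (cA t) (cA (~~ t)) (cC s) (cC (~~ s))
      (cE s) (cE (~~ s)) (cG t) (cG (~~ t)) x y ->
    on_residual_line (cA t) (cA (~~ t)) (cC s) (cC (~~ s))
      (cE s) (cE (~~ s)) (cG t) (cG (~~ t)) x y (form s) (form (~~ s))
      (form (2 + t)%N) (form (2 + ~~ t)%N) ->
    exists i, forall u, u \in L -> u \in line_of i.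
  move=> /all_solutions[k [-> ->]] H.
  apply: (coord (inr (s, t, k)) s t _ _ _ _ _ _ _ _
    (fun _ _ z _ => z / residual_y s t k) (fun _ _ _ w => w / residual_y s t k)) erefl _.
  move=> p q /=; have [-> yE] := H p q; have n0 := residual_y_neq0 s t k.
  split; [by field|rewrite /residual_z; apply: (mulfI n0); rewrite [LHS]yE; field
    |by field|by field].
  exact: n0.
have transversal t x y : line_system (cA t) (cA (~~ t)) (cC false) (cC true)
      (cE false) (cE true) (cG t) (cG (~~ t)) x y ->
    on_transversal_line x y (form 0) (form 1) (form (2 + t)%N) (form (2 + ~~ t)%N) ->
    exists i, forall u, u \in L -> u \in line_of i.
  move=> /(all_solutions (s := false))[k [-> ->]] H.
  apply: (coord (inl (inr (t, k))) false t _ _ _ _ _ _ _ _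
    (fun _ _ z _ => z) (fun _ _ _ w => w)) erefl _.
  by move=> p q /=; have [-> ->] := H p q; split; ring.
have [base|[x [y [sysxy H]]]|[x [y [sysxy H]]]|[x [y]]] :=
  classification inj e0 f0 g0 h0 onS.
- have lin0 c1 c2 c3 c4 p q : lin (form 0) (form 1) (form 2) (form 3) c1 c2 c3 c4 = 0 ->
    c1 * ev (form 0) p q + c2 * ev (form 1) p q + c3 * ev (form 2) p q
     + c4 * ev (form 3) p q = 0 by rewrite -ev_lin => ->.
  have type0 (s t : bool) : form s = 0 -> form (2 + t)%N = 0 ->
      exists i, forall u, u \in L -> u \in line_of i.
    move=> x0 z0; apply: (coord (inl (inl (inl (inl (s, t))))) s t _ _ _ _ _ _ _ _
      (fun _ y _ _ => y) (fun _ _ _ w => w)) erefl _.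
    by move=> p q /=; rewrite x0 z0 !ev_0; split; ring.
  have typeB (s : bool) : form s = 0 ->
      lin (form 0) (form 1) (form 2) (form 3) c d g h = 0 ->
      exists i, forall u, u \in L -> u \in line_of i.
    move=> x0 B0; apply: (coord (inl (inl (inl (inr (inl s))))) s false
      _ _ _ _ _ _ _ _ (fun _ _ z _ => - z / cC (~~ s))
      (fun _ _ _ w => - w / cC (~~ s))) erefl _.
    move=> p q /=; have := lin0 _ _ _ _ p q B0.
    have s0 : cC (~~ s) != 0 by case: (s).
    rewrite x0 ev_0 => E; split; [by ring| |by field|by field].
    apply: (mulIf s0); apply/eqP; rewrite -subr_eq0 -[X in _ == X]E; apply/eqP.
    by move: x0 s0; case: s => /= x0 s0; rewrite x0 ev_0; field.
  have typeA (t : bool) : form (2 + t)%N = 0 ->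
      lin (form 0) (form 1) (form 2) (form 3) e f a b = 0 ->
      exists i, forall u, u \in L -> u \in line_of i.
    move=> z0 A0; apply: (coord (inl (inl (inl (inr (inr t))))) false t
      _ _ _ _ _ _ _ _ (fun _ _ _ w => - w / e)
      (fun _ y _ _ => - y / e)) erefl _.
    move=> p q /=; have := lin0 _ _ _ _ p q A0.
    rewrite z0 ev_0 => E; split; [|by field|by ring|by field].
    apply: (mulIf e0); apply/eqP; rewrite -subr_eq0 -[X in _ == X]E; apply/eqP.
    by move: z0; case: t => /= z0; rewrite z0 ev_0; field.
  case: base => -[x0|y0|A0] [z0|w0|B0].
  + exact: (type0 false false).
  + exact: (type0 false true).
  + exact: (typeB false).
  + exact: (type0 true false).
  + exact: (type0 true true).
  + exact: (typeB true).
  + exact: (typeA false).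
  + exact: (typeA true).
  + have m0 := minor0 false false; rewrite /= in m0.
    apply: (coord (inl (inl (inr tt))) false false _ _ _ _ _ _ _ _
      (fun _ y _ _ => y / (e * g + - (a * c)))
      (fun _ _ _ w => w / (e * g + - (a * c)))) erefl _.
    move=> p q /=; have EA := lin0 _ _ _ _ p q A0; have EB := lin0 _ _ _ _ p q B0.
    split; [|by field| |by field]; apply: (mulIf m0); apply/eqP; rewrite -subr_eq0.
    * have /= E0 := f_equal2 (fun A B => g * A - a * B) EA EB.
      by rewrite !mulr0 subr0 in E0; rewrite -[X in _ == X]E0; apply/eqP;
      field.
    * have /= E0 := f_equal2 (fun A B => e * B - c * A) EA EB.
      by rewrite !mulr0 subr0 in E0; rewrite -[X in _ == X]E0; apply/eqP;
      field.
- exact: (transversal false x y).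
- exact: (transversal true x y).
- case=> -[sysxy H].
  + exact: (residual false false x y).
  + exact: (residual false true x y).
  + exact: (residual true false x y).
  + exact: (residual true true x y).
Qed.

End Completeness.
End Lines.

(** * Specialization to a tropically smooth surface *)

(** 2 is a factor of one term in two coefficients of the cubic, and it must not
    change the valuation of this term. *)
Lemma val_two (p : nat) (R : realType) (K : fieldType) (v : K -> \bar R) :
  prime p -> (5 <= p)%N -> is_padic_field p v -> v 2%:R = 0%E.
Proof.
move=> pp p5 [_ vQ _ _]; have := vQ 2%:R; rewrite ratr_nat => -> //.
rewrite /padic_val_rat.
have -> : numq 2%:R = 2 by [].
have -> : denq 2%:R = 1 by [].
rewrite /= logn1 subr0 lognE pp /= gtnNdvd//.
by apply: leq_trans p5.
Qed.

Section Specialization.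
Variables (p : nat) (R : realType) (K : fieldType) (v : K -> \bar R).
Variables (C : closedFieldType) (iota : {rmorphism K -> C}) (w : C -> \bar R).
Hypothesis hv : is_padic_field p v.
Hypothesis hw : valuation w.
Hypothesis hwv : forall x : K, w (iota x) = v x.
Hypothesis w2 : w 2%:R = 0%E.
Variables (a b c d e f g h : K) (va vb vc vd ve vf vg vh : R).
Hypotheses (Ea : v a = va%:E) (Eb : v b = vb%:E) (Ec : v c = vc%:E)
  (Ed : v d = vd%:E) (Ee : v e = ve%:E) (Ef : v f = vf%:E)
  (Eg : v g = vg%:E) (Eh : v h = vh%:E).
Hypothesis G : fiberwise_generic va vb vc vd ve vf vg vh.

Let A t := cA (iota a) (iota b) t.
Let B s := cC (iota c) (iota d) s.
Let E s := cE (iota e) (iota f) s.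
Let H t := cG (iota g) (iota h) t.

Lemma generic_all (s t : bool) :
  let pick (b : bool) (x y : R) := if b then y else x in
  fiberwise_generic (pick t va vb) (pick (~~ t) va vb) (pick s vc vd)
    (pick (~~ s) vc vd) (pick s ve vf) (pick (~~ s) ve vf)
    (pick t vg vh) (pick (~~ t) vg vh).
Proof.
case: s t => [] [] /=.
- exact: generic_swap_zw (generic_swap_xy G).
- exact: generic_swap_xy.
- exact: generic_swap_zw.
- exact: G.
Qed.

Lemma solved_all (s t : bool) : solved_over iota w (A t) (A (~~ t)) (B s)
  (B (~~ s)) (E s) (E (~~ s)) (H t) (H (~~ t)).
Proof.
have ib x : in_base iota (iota x) by exists x.
apply: (solved_of_generic hv hw hwv w2 _ _ _ _ _ _ _ _ _ _ _ _ _ _ _ _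
  (generic_all s t)).
all: by case: s t => [] []; rewrite /= ?hwv//.
Qed.

Lemma minor_all (s t : bool) : E s * H t + - (A t * B s) != 0.
Proof.
have [n] := fiber_eg (generic_all s t).
case: s t => [] [] /= N; apply: (val_fin_neq0 hw (r := n));
  by apply: (val_sum2 hw _ _ N); rewrite ?(valN hw) (valM hw) !hwv
    ?Ea ?Eb ?Ec ?Ed ?Ee ?Ef ?Eg ?Eh.
Qed.

End Specialization.

Unset Implicit Arguments.

Theorem theorem3p5 (p : nat) (hp : prime p) (hp5 : (5 <= p)%N) (R : realType)
    (Qp : fieldType) (v : Qp -> \bar R) (hQp : is_padic_field p v)
    (C : closedFieldType) (iota : {rmorphism Qp -> C}) (w : C -> \bar R)
    (hC : is_valued_algebraic_closure v iota w)
    (a b c d e f g h : Qp)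
    (hS : tropically_smooth v [tuple a; b; c; d; e; f; g; h]) :
  exists lines : seq {vspace 'rV[C]_4},
    [/\ uniq lines /\ size lines = 27%N,
        forall L, L \in lines <-> is_line_on iota [tuple a; b; c; d; e; f; g; h] L,
        {in lines &, forall L1 L2,
           tropicalization w L1 = tropicalization w L2 -> L1 = L2}
      & {in lines, forall L, is_defined_over iota L}].
Proof.
have hv : valuation v by case: hQp.
case: hC => _ hw hwv.
have nz (i : nat) (i8 : (i < 8)%N) : [:: a; b; c; d; e; f; g; h]`_i != 0.
  by have := hS.1 (Ordinal i8); rewrite (tnth_nth 0).
have [[a0 b0 c0 d0] [e0 f0 g0 h0]] :
    [/\ a != 0, b != 0, c != 0 & d != 0] /\ [/\ e != 0, f != 0, g != 0 & h != 0].
  by split; split; [exact: (nz 0)|exact: (nz 1)|exact: (nz 2)|exact: (nz 3)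
    |exact: (nz 4)|exact: (nz 5)|exact: (nz 6)|exact: (nz 7)].
have [[va Ea] [vb Eb]] := (val_finE hv a0, val_finE hv b0).
have [[vc Ec] [vd Ed]] := (val_finE hv c0, val_finE hv d0).
have [[ve Ee] [vf Ef]] := (val_finE hv e0, val_finE hv f0).
have [[vg Eg] [vh Eh]] := (val_finE hv g0, val_finE hv h0).
have G := smooth_generic Ea Eb Ec Ed Ee Ef Eg Eh hS.
have w2 : w 2%:R = 0%E.
  by rewrite -(val_two hp hp5 hQp) -hwv rmorph_nat.
have min0 := minor_all hw hwv Ea Eb Ec Ed Ee Ef Eg Eh G.
have sol s t := cid (solved_all hQp hw hwv w2 Ea Eb Ec Ed Ee Ef Eg Eh G s t).
pose al s t := sval (sol s t).
have sol' s t := cid (svalP (sol s t)).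
pose be s t := sval (sol' s t).
pose A := cA (iota a) (iota b); pose B := cC (iota c) (iota d).
pose E := cE (iota e) (iota f); pose H := cG (iota g) (iota h).
pose system s t := line_system (A t) (A (~~ t)) (B s) (B (~~ s))
  (E s) (E (~~ s)) (H t) (H (~~ t)).
have solP s t : [/\ forall k, in_base iota (al s t k) /\ in_base iota (be s t k),
      forall k, system s t (al s t k) (be s t k),
      forall k l, w (al s t k) = w (al s t l) -> w (be s t k) = w (be s t l) ->
        k = l
    & forall x y, system s t x y -> exists k, x = al s t k /\ y = be s t k].
  exact: (svalP (sol' s t)).
have sys s t k : system s t (al s t k) (be s t k) by have [_ + _ _] := solP s t.
have complete s t x y : system s t x y -> exists k, x = al s t k /\ y = be s t k.
  by have [_ _ _ +] := solP s t; exact.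
have inj s t k l : w (al s t k) = w (al s t l) ->
    w (be s t k) = w (be s t l) -> k = l.
  by have [_ _ + _] := solP s t; exact.
have iz (x : Qp) : x != 0 -> iota x != 0 by rewrite fmorph_eq0.
have [a0' b0' c0' d0'] := And4 (iz _ a0) (iz _ b0) (iz _ c0) (iz _ d0).
have [e0' f0' g0' h0'] := And4 (iz _ e0) (iz _ f0) (iz _ g0) (iz _ h0).
have coefE : map_tuple iota [tuple a; b; c; d; e; f; g; h] =
    [tuple iota a; iota b; iota c; iota d; iota e; iota f; iota g; iota h].
  exact: val_inj.
pose line i := line_of (iota a) (iota b) (iota c) (iota d) (iota e) (iota f)
  (iota g) (iota h) al be i.
have lineI i j : tropicalization w (line i) = tropicalization w (line j) -> i = j.
  exact: (tropicalization_line_of_inj a0' b0' c0' d0' e0' f0' g0' h0' min0 sys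
    hw inj).
exists [seq line i | i <- enum line_index]; split.
- rewrite size_map -cardE card_line_index; split => //.
  by rewrite map_inj_uniq ?enum_uniq// => i j ij; apply: lineI; rewrite ij.
- move=> L; split => [/mapP[i _ ->]|[L2 onL]].
    split; first exact: (dim_line_of a0' b0' c0' d0' e0' f0' g0' h0' min0 sys).
    by move=> u; rewrite coefE; exact: (octanomial_line_of g0' h0' sys).
  rewrite coefE in onL.
  have [i ->] := line_of_complete a0' b0' c0' d0' e0' f0' g0' h0' min0 sys
    complete L2 onL.
  by apply: map_f; rewrite mem_enum.
- by move=> _ _ /mapP[i _ ->] /mapP[j _ ->] /lineI ->.
- move=> _ /mapP[i _ ->]; apply: line_of_defined; try by [exists a|exists b|
    exists c|exists d|exists e|exists f|exists g|exists h].
  by move=> s t k; have [ib _ _ _] := solP s t.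
Qed.
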